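(* Let $r>0$ and $0<\theta<\pi/2$ satisfy $r\cos\theta<1$. For $h>0$ let $R_h$ be the three-dimensional hyperbolic complete orthoscheme, in the projective ball model $\mathbb{B}$, with vertices $$P_0=(r\sin\theta,\ r\cos\theta,\ 0),\quad P_1=(0,\ r\cos\theta,\ 0),\quad P_2=(0,0,0),\quad P_3=(0,0,h),$$ and let $V(h)$ denote its hyperbolic volume. Then the function $V$ on $(0,+\infty)$ attains its maximum value at some $h\in(1,+\infty)$. Moreover, the point $h$ at which this maximum is attained is unique, and for this $h$ the complete orthoscheme $R_h$ is not a Lambert cube.
   Context: The projective ball (Beltrami–Klein) model $\mathbb{B}$ of hyperbolic 3-space is the open unit ball in $\mathbb{R}^3$ centered at the origin, with the metric induced via radial projection from the hyperboloid $\{x\in\mathbb{R}^4: -x_0^2+x_1^2+x_2^2+x_3^2=-1,\ x_0>0\}$ onto the affine hyperplane $x_0=1$; hyperbolic planes are intersections of Euclidean planes with $\mathbb{B}$. Points of $\partial\mathbb{B}$ are called ideal, points outside the closed ball ultraideal. Each ultraideal point $v$ has a polar plane: the hyperbolic plane whose boundary circle is the set of tangency points on $\partial\mathbb{B}$ of the cone from $v$ tangent to $\partial\mathbb{B}$ (it is orthogonal to every hyperbolic line/plane through $v$). Truncation of a Euclidean tetrahedron $R$ at an ultraideal vertex $v$ means replacing $R$ by $R\cap T$, where $T$ is the closed half-space bounded by the polar plane of $v$ not containing $v$. For the tetrahedron with vertices $P_0,P_1,P_2,P_3$ (here $P_1,P_2\in\mathbb{B}$, $P_0,P_3$ are the principal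 vertices, the edge $P_0P_1$ is perpendicular to the face $P_1P_2P_3$ and the face $P_0P_1P_2$ is orthogonal to the edge $P_2P_3$), the complete orthoscheme $R_h$ is the hyperbolic polyhedron obtained from the tetrahedron intersected with $\mathbb{B}$ by truncating at each principal vertex that is ultraideal. Thus $R_h$ is an ordinary orthoscheme (principal vertices ordinary or ideal), a simple frustum (exactly one principal vertex ultraideal), a double frustum (both ultraideal and their polar planes disjoint in the closure of $\mathbb{B}$, or tangent at an ideal point), or a Lambert cube (both ultraideal and their polar planes intersecting in $\mathbb{B}$; then the edge $P_0P_3$ is cut away entirely). For $r>1$, $R_h$ is a Lambert cube exactly when $h>r/\sqrt{r^2-1}$. *)

(* Defs.v *)
From HB Require Import structures.
From mathcomp Require Import all_boot all_order all_algebra.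
From mathcomp Require Import all_classical all_reals all_analysis.
Set Implicit Arguments. Unset Strict Implicit. Unset Printing Implicit Defensive.
Import Order.TTheory GRing.Theory Num.Theory.
Local Open Scope classical_set_scope.
Local Open Scope ring_scope.

Section Klein.
Variable R : realType.

Definition pt := (R * R * R)%type.
Definition mkpt (x y z : R) : pt := ((x, y), z).

Definition dot3 (p q : pt) : R := p.1.1 * q.1.1 + p.1.2 * q.1.2 + p.2 * q.2.
Definition sqn3 (p : pt) : R := dot3 p p.

Definition in_ball (p : pt) : Prop := sqn3 p < 1.
Definition ultraideal (p : pt) : Prop := 1 < sqn3 p.

Definition tetra (P0 P1 P2 P3 : pt) : set pt :=
  [set x | exists l0 l1 l2 l3 : R,
     [/\ 0 <= l0, 0 <= l1, 0 <= l2 & 0 <= l3] /\ l0 + l1 + l2 + l3 = 1 /\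
     x.1.1 = l0 * P0.1.1 + l1 * P1.1.1 + l2 * P2.1.1 + l3 * P3.1.1 /\
     x.1.2 = l0 * P0.1.2 + l1 * P1.1.2 + l2 * P2.1.2 + l3 * P3.1.2 /\
     x.2   = l0 * P0.2   + l1 * P1.2   + l2 * P2.2   + l3 * P3.2].

(* The polar plane of an ultraideal point v is {x | <x,v> = 1}; the closed
   half-space bounded by it not containing v is {x | <x,v> <= 1}. *)
Definition trunc_halfspace (v : pt) : set pt := [set x | dot3 x v <= 1].

Definition complete_orthoscheme (P0 P1 P2 P3 : pt) : set pt :=
  [set x | tetra P0 P1 P2 P3 x /\ in_ball x /\
     (ultraideal P0 -> trunc_halfspace P0 x) /\
     (ultraideal P3 -> trunc_halfspace P3 x)].

Definition is_lambert_cube (P0 P3 : pt) : Prop :=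
  ultraideal P0 /\ ultraideal P3 /\
  exists x : pt, in_ball x /\ dot3 x P0 = 1 /\ dot3 x P3 = 1.

(* hyperbolic volume in the Klein model: density (1 - |x|^2)^(-2)
   w.r.t. Lebesgue measure on R^3 (written as an iterated integral of a
   nonnegative function, equal to the 3-dimensional integral by Tonelli) *)
Definition hyp_volume (A : set pt) : \bar R :=
  (\int[@lebesgue_measure R]_x \int[@lebesgue_measure R]_y
     \int[@lebesgue_measure R]_z
        ((\1_A (mkpt x y z) : R) * (1 - sqn3 (mkpt x y z)) ^- 2)%:E)%E.

End Klein.

(* Main.v *)
Require Import Defs.
From HB Require Import structures.
From mathcomp Require Import all_boot all_order all_algebra.
From mathcomp Require Import all_classical all_reals all_analysis.
From mathcomp Require Import measurable_realfun.
From mathcomp Require Import ring lra.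
Set Implicit Arguments. Unset Strict Implicit. Unset Printing Implicit Defensive.
Import Order.TTheory GRing.Theory Num.Theory numFieldNormedType.Exports.
Local Open Scope classical_set_scope.
Local Open Scope ring_scope.

(* Write a = r cos theta and b = r sin theta. The slice of R_h at ordinate y is
   a rectangle, so V is the integral over y of an explicit function of its two
   sides. As h grows past 1 the slices near P1 rise (with the face P0 P1 P3) and
   those near P2 are cut down (by the polar plane of P3); by Tonelli, V changes
   by the integral over h of rise h - fall h, two integrals over these faces.
   Both have explicit primitives, and their boundary terms on the common edge
   cancel, which leaves Schlaefli's formula:
     2 K (rise h - fall h) = (length of P0 P3) * weight - const,   K > 0,
   whose right-hand side strictly decreases from +oo as long as P0 P3 survives.
   Once R_h is a Lambert cube, rise h < fall h. Hence V increases up to a unique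
   point and decreases after it; when r > 1 that point may be the threshold
   h = r / sqrt (r^2 - 1) itself, where V has a corner. *)

(** * Fundamental theorem of calculus on open intervals *)

(** [V] is never differentiated: it may have a corner, and for r > 1 the densities are unbounded
    near the ordinate where a slice touches the sphere as h approaches the threshold. Instead, the
    smaller volume plus the gains and the larger one plus the losses are both compared with a third
    integral, which needs additions only; one bound valid for all h makes everything finite. In
    Schlaefli's formula the weight is [a * b / Num.sqrt (disc_edge a b h)], and the constant comes
    from the fixed edge P0 P1, about which the face P0 P1 P3 turns. The right-hand side starts from
    +oo because P3 becomes ideal at h = 1. Its monotonicity depends on r. For r < 1 weight and
    length both decrease. For r > 1 the weight increases and has to be merged with the length
    through the monotonicity of atanh x / x. For r = 1 the vertex P0 is ideal, the edges P0 P1 and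
    P0 P3 are both infinitely long, and only a limit of their difference makes sense. *)

Section FTC.
Variable R : realType.
Notation mu := (@lebesgue_measure R).

(** The integrand may blow up at the ends, and [F] is only asked for one-sided limits there, as an
    ideal vertex requires. The closed intervals [E n] exhaust the open one; nonnegativity of [f]
    gives monotone convergence of the integrals. *)
Lemma ge0_FTC2_oo (f F : R -> R) (a b la lb : R) : a < b ->
  {in `]a, b[, forall x, 0 <= f x} ->
  {in `]a, b[, forall x, {for x, continuous f}} ->
  (forall x : R, x \in `]a, b[ -> is_derive x 1 F (f x)) ->
  F x @[x --> a^'+] --> la -> F x @[x --> b^'-] --> lb ->
  (\int[mu]_(x in `]a, b[) (f x)%:E = (lb - la)%:E)%E.
Proof.
move=> ab f0 cf dF Fa Fb.
(* The offset 3 gives [2 * e n < b - a] for every n, so [E n] is never degenerate. *)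
pose e n : R := (b - a) / n.+3%:R.
have e0 n : 0 < e n by rewrite divr_gt0// subr_gt0.
have e3 n : 3 * e n <= b - a.
  rewrite /e mulrCA ler_piMr ?subr_ge0 ?(ltW ab)//.
  by rewrite ler_pdivrMr// mul1r ler_nat.
have ecvg : e n @[n --> \oo] --> (0 : R).
  rewrite -(mulr0 (b - a)); apply: cvgM; first exact: cvg_cst.
  have -> : (fun n => n.+3%:R^-1 : R) = (fun n => @harmonic R (n + 2)%N).
    by apply/funext => n; rewrite /harmonic /= addn2.
  by rewrite (cvg_shiftn 2 (@harmonic R)); exact: cvg_harmonic.
pose E n := `[a + e n, b - e n]%classic.
have EU : \bigcup_n E n = `]a, b[%classic.
  apply/seteqP; split=> x /=.
    move=> [n _]; rewrite /E /= !in_itv/= => /andP[h1 h2].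
    by have := e0 n; lra.
  rewrite in_itv/= => /andP[ax xb].
  have m0 : 0 < Num.min (x - a) (b - x) by rewrite lt_min; lra.
  have [n _ /(_ n (leqnn _))/= H] : \forall n \near \oo, e n < Num.min (x - a) (b - x).
    by move/cvgr_lt : ecvg; apply.
  exists n => //; rewrite /E/= in_itv/=; move: H; rewrite lt_min => /andP[]; lra.
have mE i : measurable (E i) by exact: measurable_itv.
have mf : measurable_fun `]a, b[ (EFin \o f).
  apply/measurable_EFinP; apply: open_continuous_measurable_fun => // x.
  by rewrite inE/=; exact: cf.
have Eab n : E n `<=` `]a, b[.
  by rewrite -EU; exact: bigcup_sup.
have nE : nondecreasing_seq E.
  apply/nondecreasing_seqP => n; rewrite subsetEset => x.
  rewrite /E/= !in_itv/=.
  have : e n.+1 <= e n.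
    by rewrite ler_pM2l ?subr_gt0// lef_pV2 ?posrE// ler_nat.
  lra.
have cv : (\int[mu]_(x in E i) (f x)%:E)%E @[i --> \oo] --> (\int[mu]_(x in `]a, b[) (f x)%:E)%E.
  rewrite -EU; apply: ge0_nondecreasing_set_cvg_integral => //.
  - by move=> i; exact: measurable_funS (Eab i) mf.
  - by move=> i x /Eab /= xab; rewrite lee_fin f0.
apply/esym/(cvg_unique _ _ cv); first exact: ereal_hausdorff.
have -> : (fun i => \int[mu]_(x in E i) (f x)%:E)%E =
   (fun n => (F (b - e n) - F (a + e n))%:E).
  apply/funext => n.
  have eab : a + e n < b - e n by have := e0 n; have := e3 n; lra.
  have inab x : x \in `[a + e n, b - e n] -> x \in `]a, b[.
    by rewrite !in_itv/=; have := e0 n; lra.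
  rewrite (@continuous_FTC2 _ f F) ?EFinB//.
  - apply: continuous_in_subspaceT => x; rewrite inE/= => /inab; exact: cf.
  - split.
    + move=> x xE; have ? := dF x (inab x (subset_itv_oo_cc xE)).
      exact: ex_derive.
    + have /= ? := dF (a + e n) (inab _ _).
      apply/cvg_at_right_filter/differentiable_continuous/derivable1_diffP.
      by apply: (@ex_derive _ _ _ _ _ _ (f (a + e n))); apply: dF; apply: inab; rewrite in_itv/=; lra.
    + apply/cvg_at_left_filter/differentiable_continuous/derivable1_diffP.
      by apply: (@ex_derive _ _ _ _ _ _ (f (b - e n))); apply: dF; apply: inab; rewrite in_itv/=; lra.
  - move=> x xE; rewrite derive1E; have ? := dF x (inab x (subset_itv_oo_cc xE)).
    exact: derive_val.
apply: cvg_EFin; first exact: nearW.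
apply: cvgB.
  move/cvg_at_leftP: Fb; apply; split=> [n|]; first by have := e0 n; lra.
  by rewrite -[X in _ --> X]subr0; apply: cvgB => //; exact: cvg_cst.
move/cvg_at_rightP: Fa; apply; split=> [n|]; first by have := e0 n; lra.
by rewrite -[X in _ --> X]addr0; apply: cvgD => //; exact: cvg_cst.
Qed.

End FTC.

(** * The inverse hyperbolic tangent and its primitives *)

Section Atanh.
Variable R : realType.
Implicit Types x y z : R.

Definition atanh x : R := (ln (1 + x) - ln (1 - x)) / 2.

Lemma atanh0 : atanh 0 = 0.
Proof. by rewrite /atanh addr0 subr0 subrr mul0r. Qed.

Lemma atanhN x : atanh (- x) = - atanh x.
Proof. by rewrite /atanh opprK -mulNr opprB. Qed.

Lemma ltr_atanh x y : -1 < x -> x < y -> y < 1 -> atanh x < atanh y.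
Proof.
move=> x1 xy y1; rewrite /atanh ltr_pM2r ?invr_gt0//.
by apply: ltrB; rewrite ltr_ln ?posrE; lra.
Qed.

Lemma ler_atanh x y : -1 < x -> x <= y -> y < 1 -> atanh x <= atanh y.
Proof.
by move=> x1; rewrite le_eqVlt => /predU1P[->//|xy y1]; apply/ltW/ltr_atanh.
Qed.

Lemma atanh_ge0 x : 0 <= x -> x < 1 -> 0 <= atanh x.
Proof. by move=> x0 x1; rewrite -atanh0 ler_atanh//; lra. Qed.

Lemma atanh_gt0 x : 0 < x -> x < 1 -> 0 < atanh x.
Proof. by move=> x0 x1; rewrite -atanh0 ltr_atanh//; lra. Qed.

Lemma atanh_ratio x : -1 < x -> x < 1 -> atanh x = ln ((1 + x) / (1 - x)) / 2.
Proof. by move=> x1 x2; rewrite /atanh ln_div ?posrE//; lra. Qed.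

(** With p and m the square roots of 1 + x and 1 - x, [atanh x = ln (p / m) <= p / m - 1], and the
    right-hand side is this times [(p + m) / p >= 1]. The logarithm is traded for an inverse square
    root, whose integrability suffices for finite volume. *)
Lemma atanh_le x : 0 <= x -> x < 1 -> atanh x <= 2 * x / Num.sqrt (1 - x ^+ 2).
Proof.
move=> x0 x1.
set p := Num.sqrt (1 + x); set m := Num.sqrt (1 - x).
have p0 : 0 < p by rewrite sqrtr_gt0; lra.
have m0 : 0 < m by rewrite sqrtr_gt0; lra.
have pE : p ^+ 2 = 1 + x by rewrite sqr_sqrtr; lra.
have mE : m ^+ 2 = 1 - x by rewrite sqr_sqrtr; lra.
have -> : 1 - x ^+ 2 = (1 + x) * (1 - x) by ring.
rewrite sqrtrM ?addr_ge0// -/p -/m.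
have -> : atanh x = ln (p / m).
  rewrite /atanh -pE -mE ln_div ?posrE// !lnXn//.
  by rewrite -(mulr_natl (ln p)) -(mulr_natl (ln m)); field.
have pm : m <= p by rewrite ler_wsqrtr; lra.
apply: (@le_trans _ _ (p / m - 1)).
  have := @ln_sublinear _ (p / m); have := @le_ln1Dx _ (p / m - 1).
  rewrite addrCA subrr addr0 => H _; apply: H.
  by have := divr_gt0 p0 m0; lra.
have -> : 2 * x / (p * m) = (p ^+ 2 - m ^+ 2) / (p * m).
  by rewrite pE mE; congr (_ / _); ring.
have -> : (p ^+ 2 - m ^+ 2) / (p * m) = (p / m - 1) * ((p + m) / p).
  by field; rewrite !gt_eqF.
rewrite ler_peMr// ?subr_ge0 ?ler_pdivlMr ?mul1r//; lra.
Qed.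

Lemma is_derive_atanh x : -1 < x -> x < 1 ->
  is_derive x 1 atanh (1 - x ^+ 2)^-1.
Proof.
move=> x1 x2.
have d1 : is_derive x 1 (fun y : R => ln (1 + y)) (1 + x)^-1.
  have ? : is_derive (1 + x) 1 (@ln R) (1 + x)^-1.
    by apply: is_derive1_ln; lra.
  by apply: is_derive_eq; rewrite /GRing.scale/=; ring.
have d2 : is_derive x 1 (fun y : R => ln (1 - y)) (- (1 - x)^-1).
  have ? : is_derive (1 - x) 1 (@ln R) (1 - x)^-1.
    by apply: is_derive1_ln; lra.
  by apply: is_derive_eq; rewrite /GRing.scale/=; ring.
have -> : atanh = (2^-1 \*: ((fun y : R => ln (1 + y)) - (fun y : R => ln (1 - y)))).
  by apply/funext => y; rewrite /atanh mulrC.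
apply: is_derive_eq; rewrite /GRing.scale/=.
by field; rewrite !gt_eqF//; nra.
Qed.

(** On a chord of the ball of half-length [Num.sqrt D], this is the signed hyperbolic distance from
    the midpoint to the point at Euclidean offset [X]. Boundary terms thus read as edge lengths. *)
Definition artq (D X : R) := atanh (X / Num.sqrt D).

(* the integral of (D - x ^+ 2) ^- 2 over [0, X] *)
Definition segint (D X : R) :=
  X / (2 * D * (D - X ^+ 2)) + artq D X / (2 * D * Num.sqrt D).

(* the integral of (C - x ^+ 2 - t ^+ 2) ^- 2 over [0, X] x [0, z] *)
Definition rectint (C X z : R) :=
  z / (2 * C * Num.sqrt (C - z ^+ 2)) * artq (C - z ^+ 2) X +
  X / (2 * C * Num.sqrt (C - X ^+ 2)) * artq (C - X ^+ 2) z.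

Lemma rectintC C X z : rectint C X z = rectint C z X.
Proof. by rewrite /rectint addrC. Qed.

Lemma ratio_sqrt_itv (D X : R) : X ^+ 2 < D ->
  -1 < X / Num.sqrt D /\ X / Num.sqrt D < 1.
Proof.
move=> XD; have D0 : 0 < D by apply: le_lt_trans XD; exact: sqr_ge0.
have s0 : 0 < Num.sqrt D by rewrite sqrtr_gt0.
rewrite ltr_pdivlMr// ltr_pdivrMr// mulN1r mul1r; apply/andP.
by rewrite -ltr_norml -sqrtr_sqr ltr_sqrt.
Qed.

Lemma artq_ge0 D X : 0 <= X -> X ^+ 2 < D -> 0 <= artq D X.
Proof.
move=> X0 /ratio_sqrt_itv[_ ?].
by apply: atanh_ge0 => //; rewrite divr_ge0// sqrtr_ge0.
Qed.

Lemma artq_gt0 D X : 0 < X -> X ^+ 2 < D -> 0 < artq D X.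
Proof.
move=> X0 XD; have [_ ?] := ratio_sqrt_itv XD.
apply: atanh_gt0 => //; rewrite divr_gt0// sqrtr_gt0.
by apply: le_lt_trans XD; exact: sqr_ge0.
Qed.

Lemma artq_le D X : 0 <= X -> X ^+ 2 < D ->
  artq D X <= 2 * X / Num.sqrt (D - X ^+ 2).
Proof.
move=> X0 XD; have [_ ?] := ratio_sqrt_itv XD.
have D0 : 0 < D by apply: le_lt_trans XD; exact: sqr_ge0.
have s0 : 0 < Num.sqrt D by rewrite sqrtr_gt0.
apply: le_trans (atanh_le _ _) _ => //; first by rewrite divr_ge0// sqrtr_ge0.
rewrite expr_div_n sqr_sqrtr ?(ltW D0)//.
have -> : D - X ^+ 2 = D * (1 - X ^+ 2 / D) by field; rewrite gt_eqF.
by rewrite sqrtrM ?(ltW D0)// invfM !mulrA.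
Qed.

Lemma segint_ge0 D X : 0 <= X -> X ^+ 2 < D -> 0 <= segint D X.
Proof.
move=> X0 XD; have D0 : 0 < D by apply: le_lt_trans XD; exact: sqr_ge0.
by rewrite addr_ge0// divr_ge0// ?artq_ge0// !mulr_ge0 ?sqrtr_ge0 ?subr_ge0// ltW.
Qed.

Lemma is_derive_artq (D X : R -> R) (x d' x' : R) :
  is_derive x 1 D d' -> is_derive x 1 X x' -> X x ^+ 2 < D x ->
  is_derive x 1 (fun y => artq (D y) (X y))
    ((x' * D x - X x * d' / 2) / (Num.sqrt (D x) * (D x - X x ^+ 2))).
Proof.
move=> dD dX XD; have D0 : 0 < D x by apply: le_lt_trans XD; exact: sqr_ge0.
have [h1 h2] := ratio_sqrt_itv XD.
set s := Num.sqrt (D x).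
have s0 : 0 < s by rewrite sqrtr_gt0.
have sE : D x = s ^+ 2 by rewrite sqr_sqrtr// ltW.
have ds : is_derive x 1 (fun y => Num.sqrt (D y)) ((2 * s)^-1 * d').
  have ? : is_derive (D x) 1 (@Num.sqrt R) (2 * s)^-1 by exact: is_derive1_sqrt.
  exact: (@is_derive1_comp _ (@Num.sqrt R) D).
have dV : is_derive x 1 (fun y => (Num.sqrt (D y))^-1) (- s ^- 2 * ((2 * s)^-1 * d')).
  by apply: (@is_deriveV _ (fun y => Num.sqrt (D y))) => //; rewrite gt_eqF.
have dR : is_derive x 1 (fun y => X y / Num.sqrt (D y))
    (X x * (- s ^- 2 * ((2 * s)^-1 * d')) + s^-1 * x').
  exact: (@is_deriveM _ _ X (fun y => (Num.sqrt (D y))^-1)).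
have ? := is_derive_atanh h1 h2.
apply: is_derive_eq.
rewrite -/s expr_div_n sE; rewrite sE in XD.
field; rewrite !gt_eqF// ?subr_gt0//.
Qed.

(* The Wronskian of N and X is all that is left after integrating by parts:
   it is constant when N and X are affine, and zero when they are proportional. *)
Lemma is_derive_artq_wronskian (D N X : R -> R) (x d' n' x' w : R) :
  is_derive x 1 D d' -> is_derive x 1 N n' -> is_derive x 1 X x' ->
  X x ^+ 2 < D x -> n' * D x - N x * d' / 2 = w ->
  is_derive x 1 (fun y => N y / (2 * Num.sqrt (D y)) * artq (D y) (X y))
    (w * segint (D x) (X x) - (X x * n' - N x * x') / (2 * (D x - X x ^+ 2))).
Proof.
move=> dD dN dX XD <-.
have D0 : 0 < D x by apply: le_lt_trans XD; exact: sqr_ge0.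
have dA := is_derive_artq dD dX XD.
set s := Num.sqrt (D x).
have s0 : 0 < s by rewrite sqrtr_gt0.
have sE : D x = s ^+ 2 by rewrite sqr_sqrtr// ltW.
have ds : is_derive x 1 (fun y => Num.sqrt (D y)) ((2 * s)^-1 * d').
  have ? : is_derive (D x) 1 (@Num.sqrt R) (2 * s)^-1 by exact: is_derive1_sqrt.
  exact: (@is_derive1_comp _ (@Num.sqrt R) D).
have d2s : is_derive x 1 (fun y => 2 * Num.sqrt (D y)) (2 * ((2 * s)^-1 * d')).
  exact: (@is_deriveZ _ _ _ (fun y => Num.sqrt (D y))).
have dV : is_derive x 1 (fun y => (2 * Num.sqrt (D y))^-1)
    (- (2 * s) ^- 2 * (2 * ((2 * s)^-1 * d'))).
  apply: (@is_deriveV _ (fun y => 2 * Num.sqrt (D y))) => //.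
  by rewrite gt_eqF// mulr_gt0.
have dR : is_derive x 1 (fun y => N y / (2 * Num.sqrt (D y)))
    (N x * (- (2 * s) ^- 2 * (2 * ((2 * s)^-1 * d'))) + (2 * s)^-1 * n').
  exact: (@is_deriveM _ _ N (fun y => (2 * Num.sqrt (D y))^-1)).
apply: is_derive_eq.
rewrite /GRing.scale/= /segint -/s; rewrite sE in XD *.
by field; rewrite !gt_eqF// ?subr_gt0.
Qed.

(** The numerator [z / C] gives weight 1 in [is_derive_artq_wronskian]. The Wronskian term left
    over, [X / (2 * C * (C - X ^+ 2 - z ^+ 2))], is cancelled by the derivative of the second
    summand of [rectint]. *)
Lemma is_derive_rectint (C X z : R) : X ^+ 2 + z ^+ 2 < C ->
  is_derive z 1 (rectint C X) (segint (C - z ^+ 2) X).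
Proof.
move=> XzC.
have C0 : 0 < C by apply: le_lt_trans XzC; rewrite addr_ge0// sqr_ge0.
have dD : is_derive z 1 (fun y : R => C - y ^+ 2) (- (2 * z)).
  by apply: is_derive_eq; rewrite /GRing.scale/=; ring.
have dN : is_derive z 1 (fun y : R => y / C) C^-1.
  by apply: is_derive_eq; rewrite /GRing.scale/=; ring.
have dX : is_derive z 1 (fun _ : R => X) 0 by exact: is_derive_cst.
have XD : X ^+ 2 < C - z ^+ 2 by rewrite ltrBrDr.
have zQ : z ^+ 2 < C - X ^+ 2 by rewrite ltrBrDr addrC.
have d1 := is_derive_artq_wronskian dD dN dX XD erefl.
have dQ : is_derive z 1 (fun _ : R => C - X ^+ 2) 0 by exact: is_derive_cst.
have dz : is_derive z 1 (fun y : R => y) 1 by exact: is_derive_id.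
have d2 := is_derive_artq dQ dz zQ.
have -> : rectint C X = (fun y => y / C / (2 * Num.sqrt (C - y ^+ 2)) * artq (C - y ^+ 2) X) +
   (X / (2 * C * Num.sqrt (C - X ^+ 2)) \*: (fun y => artq (C - X ^+ 2) y)).
  apply/funext => y; rewrite /rectint /GRing.scale/=; congr (_ * _ + _ * _).
  by rewrite !invfM; ring.
apply: is_derive_eq; rewrite /GRing.scale/=.
set s := Num.sqrt (C - X ^+ 2).
have s0 : 0 < s by rewrite sqrtr_gt0; apply: le_lt_trans zQ; exact: sqr_ge0.
have sE : C - X ^+ 2 = s ^+ 2.
  by rewrite sqr_sqrtr// ltW//; apply: le_lt_trans zQ; exact: sqr_ge0.
move: (segint _ _) => S.
have -> : (C^-1 * (C - z ^+ 2) - z / C * - (2 * z) / 2) = 1.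
  by field; rewrite gt_eqF.
rewrite -(addrAC C); have -> : C - X ^+ 2 - z ^+ 2 = s ^+ 2 - z ^+ 2 by rewrite sE.
rewrite sE; rewrite sE in zQ; by field; rewrite !gt_eqF// subr_gt0.
Qed.

Lemma is_derive_segint (D x : R) : x ^+ 2 < D ->
  is_derive x 1 (segint D) ((D - x ^+ 2) ^- 2).
Proof.
move=> xD; have D0 : 0 < D by apply: le_lt_trans xD; exact: sqr_ge0.
have dD : is_derive x 1 (fun _ : R => D) 0 by exact: is_derive_cst.
have dx : is_derive x 1 (fun y : R => y) 1 by exact: is_derive_id.
have d2 := is_derive_artq dD dx xD.
have dP : is_derive x 1 (fun y : R => 2 * D * (D - y ^+ 2)) (2 * D * (- (2 * x))).
  by apply: is_derive_eq; rewrite /GRing.scale/=; ring.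
have dV : is_derive x 1 (fun y => (2 * D * (D - y ^+ 2))^-1)
    (- (2 * D * (D - x ^+ 2)) ^- 2 * (2 * D * (- (2 * x)))).
  apply: (@is_deriveV _ (fun y => 2 * D * (D - y ^+ 2))) => //.
  by rewrite gt_eqF// !mulr_gt0 ?subr_gt0.
have -> : segint D = (fun y : R => y) * (fun y => (2 * D * (D - y ^+ 2))^-1) +
   ((2 * D * Num.sqrt D)^-1 \*: (fun y => artq D y)).
  by apply/funext => y; rewrite /segint /GRing.scale/=; congr (_ + _); rewrite mulrC.
apply: is_derive_eq; rewrite /GRing.scale/=.
set s := Num.sqrt D.
have s0 : 0 < s by rewrite sqrtr_gt0.
have sE : D = s ^+ 2 by rewrite sqr_sqrtr// ltW.
rewrite sE in xD *; field; by rewrite !gt_eqF// ?subr_gt0.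
Qed.

Lemma derivable_segint (D X : R -> R) (x : R) :
  derivable D x 1 -> derivable X x 1 -> X x ^+ 2 < D x ->
  derivable (fun y => segint (D y) (X y)) x 1.
Proof.
move=> /derivableP dD /derivableP dX XD.
have D0 : 0 < D x by apply: le_lt_trans XD; exact: sqr_ge0.
have s0 : 0 < Num.sqrt (D x) by rewrite sqrtr_gt0.
have dA := is_derive_artq dD dX XD.
have ds : is_derive x 1 (fun y => Num.sqrt (D y)) ((2 * Num.sqrt (D x))^-1 * 'D_1 D x).
  have ? : is_derive (D x) 1 (@Num.sqrt R) (2 * Num.sqrt (D x))^-1 by exact: is_derive1_sqrt.
  exact: (@is_derive1_comp _ (@Num.sqrt R) D).
apply: derivableD; apply: derivableM => //.
- apply: derivableV; first by rewrite gt_eqF// !mulr_gt0 ?subr_gt0.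
  apply: derivableM; first exact: derivableM.
  by apply: derivableB => //; apply: derivableX.
- apply: derivableV; first by rewrite gt_eqF// !mulr_gt0.
  by apply: derivableM => //; exact: derivableM.
Qed.

End Atanh.

(** * Measurability and strict comparison of integrals *)

Section Measurability.
Variable R : realType.
Notation mu := (@lebesgue_measure R).

Lemma measurable_invr : measurable_fun [set: R] (fun x : R => x^-1).
Proof.
have -> : [set: R] = [set~ 0] `|` [set 0] by rewrite setUC setUCr.
apply/measurable_funU => //; first exact: measurableC.
split; last exact: measurable_fun_set1.
apply: open_continuous_measurable_fun; first exact/closed_openC/closed_eq.
by move=> x; rewrite inE/= => /eqP x0; exact: inv_continuous.
Qed.

Lemma measurable_atanh : measurable_fun [set: R] (@atanh R).
Proof.
apply: measurable_funM => //; apply: measurable_funB.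
  apply: (measurableT_comp (@measurable_ln R)).
  by apply: measurable_funD => //; exact: measurable_id.
apply: (measurableT_comp (@measurable_ln R)).
by apply: measurable_funB => //; exact: measurable_id.
Qed.

Context d (T : measurableType d).
Implicit Types f g D X C z : T -> R.

Lemma measurable_funV f : measurable_fun setT f ->
  measurable_fun setT (fun t => (f t)^-1).
Proof. by move=> mf; exact: (measurableT_comp measurable_invr). Qed.

Lemma measurable_fun_sqrt f : measurable_fun setT f ->
  measurable_fun setT (fun t => Num.sqrt (f t)).
Proof.
move=> mf; apply: (@measurableT_comp _ _ _ _ _ _ (@Num.sqrt R)) => //.
by apply: continuous_measurable_fun => x; exact: sqrt_continuous.
Qed.

Lemma measurable_fun_artq D X : measurable_fun setT D -> measurable_fun setT X ->
  measurable_fun setT (fun t => artq (D t) (X t)).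
Proof.
move=> mD mX; apply: (measurableT_comp measurable_atanh).
apply: measurable_funM => //; apply: measurable_funV.
exact: measurable_fun_sqrt.
Qed.

Lemma measurable_fun_segint D X : measurable_fun setT D -> measurable_fun setT X ->
  measurable_fun setT (fun t => segint (D t) (X t)).
Proof.
move=> mD mX; apply: measurable_funD; apply: measurable_funM => //.
- apply: measurable_funV; apply: measurable_funM; first exact: measurable_funM.
  by apply: measurable_funB => //; exact: measurable_funX.
- exact: measurable_fun_artq.
- apply: measurable_funV; apply: measurable_funM; first exact: measurable_funM.
  exact: measurable_fun_sqrt.
Qed.

Lemma measurable_fun_rectint C X z : measurable_fun setT C ->
  measurable_fun setT X -> measurable_fun setT z ->
  measurable_fun setT (fun t => rectint (C t) (X t) (z t)).
Proof.
move=> mC mX mz.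
have aux (p q : T -> R) : measurable_fun setT p -> measurable_fun setT q ->
    measurable_fun setT (fun t => p t / (2 * C t * Num.sqrt (C t - p t ^+ 2))
      * artq (C t - p t ^+ 2) (q t)).
  move=> mp mq.
  have mCp : measurable_fun setT (fun t => C t - p t ^+ 2).
    by apply: measurable_funB => //; exact: measurable_funX.
  apply: measurable_funM; last exact: measurable_fun_artq.
  apply: measurable_funM => //; apply: measurable_funV.
  by apply: measurable_funM; [exact: measurable_funM|exact: measurable_fun_sqrt].
by apply: measurable_funD; exact: aux.
Qed.

Lemma integral_if (m : {measure set T -> \bar R}) (p : T -> bool) (f : T -> \bar R) :
  (\int[m]_(x in [set x | p x]) f x = \int[m]_x (if p x then f x else 0%:E))%E.
Proof.
rewrite integral_mkcond; apply: eq_integral => x _; rewrite patchE.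
by case: ifPn; rewrite ?inE ?notin_setE/=; [move=> ->|move=> /negP/negbTE ->].
Qed.

End Measurability.

Section Comparison.
Variable R : realType.
Notation mu := (@lebesgue_measure R).
Local Open Scope ereal_scope.

(** Otherwise the positive function [g - f] would have integral 0 and vanish almost everywhere, on
    an interval of positive length. The larger integral may be infinite. *)
Lemma lt_integral_itv (f g : R -> \bar R) (a b : R) : (a < b)%R ->
  measurable_fun `]a, b[ f -> measurable_fun `]a, b[ g ->
  (forall x, x \in `]a, b[ -> 0 <= f x) ->
  (forall x, x \in `]a, b[ -> f x < g x) ->
  \int[mu]_(x in `]a, b[) f x < +oo ->
  \int[mu]_(x in `]a, b[) f x < \int[mu]_(x in `]a, b[) g x.
Proof.
move=> ab mf mg f0 fg foo.
have ffin x : x \in `]a, b[ -> f x \is a fin_num.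
  move=> xab; rewrite ge0_fin_numE ?f0//.
  by apply: lt_le_trans (fg x xab) _; rewrite leey.
pose k x := g x - f x.
have k0 x : x \in `]a, b[ -> 0 < k x by move=> xab; rewrite sube_gt0 fg.
have mk : measurable_fun `]a, b[ k by exact: emeasurable_funB.
have -> : \int[mu]_(x in `]a, b[) g x = \int[mu]_(x in `]a, b[) (f x + k x).
  apply: eq_integral => x; rewrite inE/= => xab.
  by rewrite /k addeC subeK// ffin.
rewrite ge0_integralD//; last by move=> x xab; exact/ltW/k0.
have ifin : \int[mu]_(x in `]a, b[) f x \is a fin_num.
  by rewrite ge0_fin_numE// integral_ge0.
rewrite -[ltLHS]adde0 lteD2lE//.
rewrite lt0e integral_ge0 ?andbT; last by move=> x xab; exact/ltW/k0.
apply/eqP => ik0.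
have : ae_eq mu `]a, b[%classic k (cst 0).
  apply/ae_eq_integral_abs => //; rewrite -[RHS]ik0.
  by apply: eq_integral => x; rewrite inE/= => xab; rewrite gee0_abs// ltW// k0.
move=> [N [mN N0 sub]].
have : mu `]a, b[ <= mu N.
  apply: le_measure; rewrite ?inE//=.
  apply: subset_trans sub => x/= xab; apply/not_implyP; split => //.
  by apply/eqP; rewrite gt_eqF// k0.
by rewrite N0 lebesgue_measure_itv/= lte_fin ab -EFinB lee_fin subr_le0 leNgt ab.
Qed.

End Comparison.

(** * The volume as an integral over slices *)

Section Slices.
Variables (R : realType) (a b : R).
Hypotheses (a0 : 0 < a) (a1 : a < 1) (b0 : 0 < b).
Notation mu := (@lebesgue_measure R).

Definition rsq : R := a ^+ 2 + b ^+ 2.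

(* The slice of R_h at ordinate y is [0, width y] x [0, height h y]. *)
Definition width (y : R) : R :=
  if 1 < rsq then Num.min (b * y / a) ((1 - a * y) / b) else b * y / a.

Definition height (h y : R) : R :=
  if h <= 1 then h * (1 - y / a) else Num.min (h * (1 - y / a)) h^-1.

Lemma rsq_gt0 : 0 < rsq.
Proof. by rewrite addr_gt0// exprn_gt0. Qed.

(** The bounds [b * y / a] and [(1 - a * y) / b] cross at [y = a / rsq], the ordinate where the line
    P0 P2 meets the polar plane of P0. *)
Lemma width_diag y : 0 < y -> y < a -> rsq * y <= a -> width y = b * y / a.
Proof.
move=> y0 ya ry; rewrite /width; case: ifP => // _; apply/min_idPl.
rewrite ler_pdivrMr// mulrAC ler_pdivlMr//.
by move: ry; rewrite /rsq; nra.
Qed.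

Lemma width_polar y : 1 < rsq -> 0 < y -> y < a -> a <= rsq * y -> width y = (1 - a * y) / b.
Proof.
move=> r1 y0 ya ry; rewrite /width r1; apply/min_idPr.
rewrite ler_pdivrMr// mulrAC ler_pdivlMr//.
by move: ry; rewrite /rsq; nra.
Qed.

Lemma widthP y : 0 < y -> y < a ->
  (rsq * y <= a /\ width y = b * y / a) \/
  [/\ 1 < rsq, a < rsq * y & width y = (1 - a * y) / b].
Proof.
move=> y0 ya; have [ry|ry] := leP (rsq * y) a; first by left; rewrite width_diag.
have [r1|r1] := ltP 1 rsq; last by exfalso; nra.
by right; rewrite width_polar// ltW.
Qed.

Lemma onemM_gt0 y : y < a -> 0 < 1 - a * y.
Proof.
move=> ya; have : 0 < a * (a - y) by rewrite mulr_gt0 ?subr_gt0.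
have : 0 < a * (1 - a) by rewrite mulr_gt0 ?subr_gt0.
nra.
Qed.

Lemma width_gt0 y : 0 < y -> y < a -> 0 < width y.
Proof.
move=> y0 ya; have [[_ ->]|[_ _ ->]] := widthP y0 ya; first by rewrite !mulr_gt0 ?invr_gt0.
by rewrite divr_gt0// onemM_gt0.
Qed.

(** The difference of the two sides factors as [y / a ^+ 2 * (a - rsq * y)] before the crossing
    ordinate and as [(rsq * y - a) * (1 - a * y) / (a * b ^+ 2)] after it. As [1 - y / a] bounds the
    square of every height, the far corner of a slice stays inside the ball and can reach the sphere
    only at [a / rsq]. *)
Lemma width_ball y : 0 < y -> y < a -> rsq * y != a ->
  width y ^+ 2 < 1 - y ^+ 2 - (1 - y / a).
Proof.
move=> y0 ya nr; rewrite -subr_gt0.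
have yE : y = a * (y / a) by rewrite mulrCA divff ?mulr1// gt_eqF.
have [[ry ->]|[r1 ry ->]] := widthP y0 ya.
  have -> : 1 - y ^+ 2 - (1 - y / a) - (b * y / a) ^+ 2 = y / a ^+ 2 * (a - rsq * y).
    by rewrite /rsq; field; rewrite gt_eqF.
  by rewrite mulr_gt0 ?divr_gt0 ?exprn_gt0// subr_gt0 lt_neqAle nr.
have -> : 1 - y ^+ 2 - (1 - y / a) - ((1 - a * y) / b) ^+ 2 =
    (rsq * y - a) * (1 - a * y) / (a * b ^+ 2).
  by rewrite /rsq; field; rewrite !gt_eqF.
by rewrite divr_gt0 ?(mulr_gt0, exprn_gt0, onemM_gt0) ?subr_gt0.
Qed.

Lemma width_ball_lt y z : 0 < y -> y < a -> z ^+ 2 < 1 - y / a ->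
  width y ^+ 2 < 1 - y ^+ 2 - z ^+ 2.
Proof.
move=> y0 ya zu; have [ry|/width_ball h] := eqVneq (rsq * y) a; last by have := h y0 ya; lra.
rewrite width_diag ?ry//.
suff : (b * y / a) ^+ 2 = 1 - y ^+ 2 - (1 - y / a) by lra.
apply/eqP; rewrite -subr_eq0; apply/eqP.
have -> : (b * y / a) ^+ 2 - (1 - y ^+ 2 - (1 - y / a)) = - (y / a ^+ 2 * (a - rsq * y)).
  by rewrite /rsq; field; rewrite gt_eqF.
by rewrite ry subrr mulr0 oppr0.
Qed.

Lemma height_gt0 h y : 0 < h -> y < a -> 0 < height h y.
Proof.
move=> h0 ya; have u0 : 0 < 1 - y / a by rewrite subr_gt0 ltr_pdivrMr ?mul1r.
by rewrite /height; case: ifP => _; rewrite ?lt_min ?mulr_gt0 ?invr_gt0.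
Qed.

(** A minimum is at most the geometric mean of its arguments, and [h * (1 - y / a)] times [h^-1] is
    [1 - y / a]. The bound is free of h and is attained when [h ^+ 2 * (1 - y / a) = 1]. *)
Lemma height_le h y : 0 < h -> 0 < y -> y < a -> height h y ^+ 2 <= 1 - y / a.
Proof.
move=> h0 y0 ya; have u0 : 0 < 1 - y / a by rewrite subr_gt0 ltr_pdivrMr ?mul1r.
have v0 : 0 < y / a by rewrite divr_gt0.
have t0 := height_gt0 h0 ya; move: t0; rewrite /height; case: ifP => [h1 t0|_].
  have : h * (1 - y / a) <= 1 by nra.
  nra.
set t := Num.min _ _ => t0.
have tu : t <= h * (1 - y / a) by rewrite ge_min lexx.
have th : t <= h^-1 by rewrite ge_min lexx orbT.
rewrite expr2; apply: le_trans (_ : t * t <= h * (1 - y / a) * h^-1) _.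
  by apply: ler_pM => //; exact: ltW.
by rewrite mulrAC divff ?mul1r// gt_eqF.
Qed.

Lemma height_ball h y : 0 < h -> 0 < y -> y < a -> rsq * y != a ->
  width y ^+ 2 + height h y ^+ 2 < 1 - y ^+ 2.
Proof.
by move=> h0 y0 ya /(width_ball y0 ya); have := height_le h0 y0 ya; lra.
Qed.

Definition Pt0 : pt R := mkpt b a 0.
Definition Pt1 : pt R := mkpt 0 a 0.
Definition Pt2 : pt R := mkpt 0 0 0.
Definition Pt3 (h : R) : pt R := mkpt 0 0 h.

(** Barycentric coordinates are eliminated in favour of inequalities. Apart from the ball, each of
    them involves only x and y, or only y and z; this is why the slices at fixed y are
    rectangles. *)
Definition orth_mem (h : R) (p : pt R) : bool :=
  [&& 0 <= p.1.1, a * p.1.1 <= b * p.1.2, 0 <= p.2, p.1.2 / a + p.2 / h <= 1,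
      p.1.1 ^+ 2 + p.1.2 ^+ 2 + p.2 ^+ 2 < 1,
      (1 < rsq) ==> (p.1.1 * b + p.1.2 * a <= 1) & (1 < h) ==> (p.2 * h <= 1)].

Lemma orth_memP h p : 0 < h ->
  complete_orthoscheme Pt0 Pt1 Pt2 (Pt3 h) p <-> orth_mem h p.
Proof.
move=> h0; case: p => [[x y] z]; rewrite /complete_orthoscheme /orth_mem /tetra /=.
rewrite /in_ball /ultraideal /trunc_halfspace /sqn3 /dot3 /=.
have hh : (1 < 0 * 0 + 0 * 0 + h * h) = (1 < h).
  by apply/idP/idP => ?; nra.
have rE : (1 < b * b + a * a + 0 * 0) = (1 < rsq) by congr (_ < _); rewrite /rsq; ring.
rewrite hh rE; split.
- move=> [[l0 [l1 [l2 [l3 [[p0 p1 p2 p3] [ls [xE [yE zE]]]]]]]] [ball [t0 t3]]].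
  have xE' : x = l0 * b by rewrite xE; ring.
  have yE' : y = (l0 + l1) * a by rewrite yE; ring.
  have zE' : z = l3 * h by rewrite zE; ring.
  apply/and5P; split; last (apply/and3P; split).
  + by rewrite xE' mulr_ge0// ltW.
  + have : 0 <= l1 * (a * b) by rewrite !mulr_ge0// ltW.
    by rewrite xE' yE'; nra.
  + by rewrite zE' mulr_ge0// ltW.
  + by rewrite yE' zE' !mulfK ?gt_eqF//; lra.
  + by move: ball; rewrite !expr2.
  + by apply/implyP => /t0; lra.
  + by apply/implyP => /t3; lra.
- move=> /and5P[x0 xy z0 yz /and3P[ball t0 t3]]; split; last first.
    split; first by move: ball; rewrite !expr2.
    split=> [/(implyP t0)|/(implyP t3)]; lra.
  (* Barycentric coordinates, solved from [x = l0 * b], [y = (l0 + l1) * a] and [z = l3 * h]. *)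
  exists (x / b), (y / a - x / b), (1 - y / a - z / h), (z / h); split.
    split.
    + by rewrite divr_ge0// ltW.
    + by rewrite subr_ge0 ler_pdivrMr// mulrAC ler_pdivlMr// mulrC (mulrC y).
    + lra.
    + by rewrite divr_ge0// ltW.
  split; first by ring.
  by split; [|split]; field; rewrite ?gt_eqF.
Qed.

Lemma orth_mem_slice h x y z : 0 < h -> 0 < y -> y < a -> rsq * y != a ->
  orth_mem h (mkpt x y z) = (0 <= x <= width y) && (0 <= z <= height h y).
Proof.
move=> h0 y0 ya nr; rewrite /orth_mem/=.
have ball := height_ball h0 y0 ya nr.
have xw : ((a * x <= b * y) && ((1 < rsq) ==> (x * b + y * a <= 1))) = (x <= width y).
  rewrite /width; case: ifP => _ /=; rewrite ?le_min ?andbT ler_pdivlMr// mulrC.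
    by congr (_ && _); rewrite ler_pdivlMr// lerBrDr (mulrC a).
  by [].
have zh : ((y / a + z / h <= 1) && ((1 < h) ==> (z * h <= 1))) = (z <= height h y).
  have E : (y / a + z / h <= 1) = (z <= h * (1 - y / a)).
    by rewrite -lerBrDl ler_pdivrMr// mulrC.
  rewrite E /height; case: leP => h1 /=; first by rewrite andbT.
  by rewrite le_min; congr (_ && _); rewrite -ler_pdivlMr// mul1r.
apply/idP/idP.
  move=> /and5P[x0 xy z0 yz /and3P[_ t0 t3]].
  by rewrite x0 z0 -xw -zh xy yz t0 t3.
move=> /andP[/andP[x0 xX] /andP[z0 zt]].
have /andP[-> ->] : (a * x <= b * y) && ((1 < rsq) ==> (x * b + y * a <= 1)) by rewrite xw.
have /andP[-> ->] : (y / a + z / h <= 1) && ((1 < h) ==> (z * h <= 1)) by rewrite zh.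
rewrite x0 z0 /= andbT.
have : x ^+ 2 <= width y ^+ 2 by rewrite ler_sqr ?nnegrE// (le_trans x0).
have : z ^+ 2 <= height h y ^+ 2 by rewrite ler_sqr ?nnegrE// (le_trans z0).
lra.
Qed.

End Slices.

(** * Tonelli: the volume as an integral of [rectint] over the ordinates *)

Section Volume.
Variables (R : realType) (a b : R).
Hypotheses (a0 : 0 < a) (a1 : a < 1) (b0 : 0 < b).
Notation mu := (@lebesgue_measure R).
Local Notation wid := (width a b).
Local Notation hgt := (height a).
Local Notation rr := (rsq a b).

(* The omitted ordinate, a / r ^+ 2, is the one where a slice may touch the sphere. *)
Definition ordinates : set R := [set y | [&& 0 < y, y < a & rr * y != a]].

Lemma measurable_ordinates : measurable ordinates.
Proof.
have -> : ordinates = `]0, a[%classic `\` [set a / rr].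
  apply/seteqP; split=> y /=; rewrite in_itv/=.
    move=> /and3P[-> -> nr]; split => // yE; move: nr; rewrite yE mulrC divfK ?eqxx//.
    by rewrite gt_eqF// rsq_gt0.
  rewrite /ordinates/= => -[/andP[-> ->] nr] /=; apply/eqP => e; apply: nr.
  by rewrite -[LHS](mulfK (lt0r_neq0 (rsq_gt0 a0 b0))) (mulrC y) e.
by apply: measurableD.
Qed.

Lemma measurable_width : measurable_fun setT wid.
Proof.
rewrite /wid; have m1 : measurable_fun setT (fun y : R => b * y / a).
  by apply: measurable_funM => //; apply: measurable_funM => //; exact: measurable_id.
case: (1 < _) => //; apply: measurable_minr => //.
by apply: measurable_funM => //; apply: measurable_funB => //; apply: measurable_funM.
Qed.

Lemma measurable_height h : measurable_fun setT (hgt h).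
Proof.
rewrite /hgt; have m1 : measurable_fun setT (fun y : R => h * (1 - y / a)).
  apply: measurable_funM => //; apply: measurable_funB => //.
  by apply: measurable_funM => //; exact: measurable_id.
by case: (h <= 1) => //; apply: measurable_minr.
Qed.

Lemma integral_invsq_segint (D X : R) : 0 < X -> X ^+ 2 < D ->
  (\int[mu]_(x in `[0%R, X]) ((D - x ^+ 2) ^- 2)%:E = (segint D X)%:E)%E.
Proof.
move=> X0 XD.
have sq x : x \in `]0, X[ -> x ^+ 2 < D.
  rewrite in_itv/= => /andP[x0 xX]; apply: le_lt_trans XD.
  by rewrite ler_sqr ?nnegrE ltW.
have cf x : x \in `]0, X[ -> {for x, continuous (fun x : R => (D - x ^+ 2) ^- 2)}.
  move=> /sq xD; apply: continuousV; first by rewrite sqrf_eq0 subr_eq0 gt_eqF.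
  by apply/differentiable_continuous/derivable1_diffP; exact: ex_derive.
have ends x : x ^+ 2 < D -> {for x, continuous (segint D)}.
  move=> /is_derive_segint d1.
  by apply/differentiable_continuous/derivable1_diffP; exact: ex_derive.
rewrite integral_itv_bndoo; last first.
  apply/measurable_EFinP; apply: open_continuous_measurable_fun => // x.
  by rewrite inE/=; exact: cf.
have -> : segint D X = segint D X - segint D 0.
  by rewrite /segint /artq !mul0r atanh0 mul0r addr0 subr0.
apply: (@ge0_FTC2_oo _ _ (segint D)) => //.
- by move=> x _; rewrite invr_ge0 sqr_ge0.
- by move=> x xX; apply: is_derive_segint; exact: sq.
- by apply: cvg_at_right_filter; apply: ends; rewrite expr0n/= (le_lt_trans _ XD)// sqr_ge0.
- by apply: cvg_at_left_filter; exact: ends.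
Qed.

Lemma rectint0 (C X : R) : rectint C X 0 = 0.
Proof. by rewrite /rectint /artq !mul0r atanh0 mulr0 addr0. Qed.

Lemma rectint_cont (C X z : R) : X ^+ 2 + z ^+ 2 < C ->
  {for z, continuous (rectint C X)}.
Proof.
move=> /is_derive_rectint ?.
by apply/differentiable_continuous/derivable1_diffP; exact: ex_derive.
Qed.

Lemma segint_cont (D X : R -> R) (x : R) :
  derivable D x 1 -> derivable X x 1 -> X x ^+ 2 < D x ->
  {for x, continuous (fun y => segint (D y) (X y))}.
Proof.
move=> dD dX XD; apply/differentiable_continuous/derivable1_diffP.
exact: derivable_segint.
Qed.

Lemma integral_segint_rectint (C X z : R) : 0 < X -> 0 < z -> X ^+ 2 + z ^+ 2 < C ->
  (\int[mu]_(x in `[0%R, X]) (segint (C - x ^+ 2) z)%:E = (rectint C X z)%:E)%E.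
Proof.
move=> X0 z0 XzC.
have sq x : x \in `]0, X[ -> z ^+ 2 + x ^+ 2 < C.
  rewrite in_itv/= => /andP[x0 xX]; apply: le_lt_trans XzC.
  by rewrite addrC lerD2r ler_sqr ?nnegrE ltW.
have cf x : x \in `]0, X[ -> {for x, continuous (fun x : R => segint (C - x ^+ 2) z)}.
  move=> /sq xD; apply: (@segint_cont (fun x => C - x ^+ 2) (fun=> z)) => //.
  by rewrite ltrBrDr.
rewrite integral_itv_bndoo; last first.
  apply/measurable_EFinP; apply: open_continuous_measurable_fun => // x.
  by rewrite inE/=; exact: cf.
(* [rectint] is symmetric in its two sides, so its derivative in the last argument also serves the
   integration in [x]. *)
have -> : rectint C X z = rectint C z X - rectint C z 0 by rewrite rectint0 subr0 rectintC.
apply: (@ge0_FTC2_oo _ _ (rectint C z)) => //.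
- by move=> x /sq ?; rewrite segint_ge0 ?(ltW z0)// ltrBrDr.
- by move=> x xX; apply: is_derive_rectint; exact: sq.
- apply: cvg_at_right_filter; apply: rectint_cont.
  by rewrite expr0n/= addr0 (le_lt_trans _ XzC)// lerDr sqr_ge0.
- by apply: cvg_at_left_filter; apply: rectint_cont; rewrite addrC.
Qed.

Lemma measurable_orth_mem h : measurable_fun setT (orth_mem a b h).
Proof.
have mx : measurable_fun [set: R * R * R] (fun p : R * R * R => p.1.1).
  exact: (measurableT_comp measurable_fst measurable_fst).
have my : measurable_fun [set: R * R * R] (fun p : R * R * R => p.1.2).
  exact: (measurableT_comp measurable_snd measurable_fst).
have mz : measurable_fun [set: R * R * R] (fun p : R * R * R => p.2).
  exact: measurable_snd.
rewrite /orth_mem.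
apply: measurable_and; first exact: measurable_fun_ler.
apply: measurable_and; first by apply: measurable_fun_ler; apply: measurable_funM.
apply: measurable_and; first exact: measurable_fun_ler.
apply: measurable_and.
  by apply: measurable_fun_ler => //; apply: measurable_funD; apply: measurable_funM.
apply: measurable_and.
  apply: measurable_fun_ltr => //; apply: measurable_funD; last exact: measurable_funX.
  by apply: measurable_funD; exact: measurable_funX.
apply: measurable_and.
  case: (1 < _) => //=.
  by apply: measurable_fun_ler => //; apply: measurable_funD; apply: measurable_funM.
case: (1 < _) => //=.
by apply: measurable_fun_ler => //; apply: measurable_funM.
Qed.

Let dens (h : R) (p : R * R * R) : \bar R :=
  if orth_mem a b h p then ((1 - sqn3 p) ^- 2)%:E else 0%:E.

Lemma measurable_dens h : measurable_fun setT (dens h).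
Proof.
have mx : measurable_fun [set: R * R * R] (fun p : R * R * R => p.1.1).
  exact: (measurableT_comp measurable_fst measurable_fst).
have my : measurable_fun [set: R * R * R] (fun p : R * R * R => p.1.2).
  exact: (measurableT_comp measurable_snd measurable_fst).
have mz : measurable_fun [set: R * R * R] (fun p : R * R * R => p.2).
  exact: measurable_snd.
apply: measurable_fun_ifT => //; first exact: measurable_orth_mem.
apply/measurable_EFinP; apply: measurable_funV; apply: measurable_funX.
apply: measurable_funB => //; rewrite /sqn3 /dot3.
by apply: measurable_funD; [apply: measurable_funD|]; exact: measurable_funM.
Qed.

Lemma dens_ge0 h p : (0 <= dens h p)%E.
Proof. by rewrite /dens; case: ifP => // _; rewrite lee_fin invr_ge0 sqr_ge0. Qed.

(** [hyp_volume] integrates over x last, whereas the slices are taken at fixed y: Tonelli exchanges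
    the two outer integrals. *)
Lemma hyp_volume_swap h : 0 < h ->
  (hyp_volume (complete_orthoscheme (Pt0 a b) (Pt1 a) (Pt2 R) (Pt3 h)) =
   \int[mu]_y \int[mu]_x \int[mu]_z dens h (x, y, z))%E.
Proof.
move=> h0.
pose G (q : R * R) := (\int[mu]_z dens h (q, z))%E.
have mG : measurable_fun setT G.
  apply: (@measurable_fun_fubini_tonelli_F _ _ _ _ _ mu (dens h)).
  - exact: measurable_dens.
  - exact: dens_ge0.
have G0 q : (0 <= G q)%E by apply: integral_ge0 => z _; exact: dens_ge0.
have := @fubini_tonelli _ _ _ _ R mu mu G mG G0.
rewrite /G => <-; rewrite /hyp_volume.
apply: eq_integral => x _; apply: eq_integral => y _; apply: eq_integral => z _.
rewrite /dens indicE; case: ifPn => om.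
  by rewrite mem_set ?mul1r//; apply/orth_memP.
by rewrite memNset ?mul0r//; move/(orth_memP a0 b0 _ h0); exact/negP.
Qed.

Lemma slice_integral h y : 0 < h -> 0 < y -> y < a -> rr * y != a ->
  (\int[mu]_x \int[mu]_z dens h (x, y, z) =
   (rectint (1 - y ^+ 2) (wid y) (hgt h y))%:E)%E.
Proof.
move=> h0 y0 ya nr.
have X0 := width_gt0 a0 a1 b0 y0 ya; have t0 := height_gt0 a0 h0 ya.
have ball := height_ball a0 a1 b0 h0 y0 ya nr.
rewrite -integral_segint_rectint//.
have -> : `[0, wid y]%classic = [set x | 0 <= x <= wid y].
  by apply/seteqP; split => x /=; rewrite in_itv.
rewrite integral_if; apply: eq_integral => x _.
case: ifPn => [/andP[x0 xX]|nx]; last first.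
  under eq_integral do rewrite /dens (orth_mem_slice a0 a1 b0 _ _ h0 y0 ya nr) (negbTE nx)/=.
  by rewrite integral0.
have xw : x ^+ 2 <= wid y ^+ 2 by rewrite ler_sqr ?nnegrE// (le_trans x0).
rewrite -(@integral_invsq_segint _ (hgt h y))//; last by lra.
have -> : `[0, hgt h y]%classic = [set x | 0 <= x <= hgt h y].
  by apply/seteqP; split => z /=; rewrite in_itv.
rewrite integral_if; apply: eq_integral => z _.
rewrite /dens (orth_mem_slice a0 a1 b0 _ _ h0 y0 ya nr) x0 xX/=.
case: ifP => // _; congr (_ ^- 2)%:E; rewrite /sqn3 /dot3/=; ring.
Qed.

(** Points of [R_h] satisfy [0 <= y <= a], so outside [ordinates] only the three ordinates of the
    null set [N] can carry any of them. *)
Lemma hyp_volumeE h : 0 < h ->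
  (hyp_volume (complete_orthoscheme (Pt0 a b) (Pt1 a) (Pt2 R) (Pt3 h)) =
   \int[mu]_(y in ordinates) (rectint (1 - y ^+ 2) (wid y) (hgt h y))%:E)%E.
Proof.
move=> h0; rewrite hyp_volume_swap//.
pose phi y := (\int[mu]_x \int[mu]_z dens h (x, y, z))%E.
have mphi : measurable_fun setT phi.
  pose G (q : R * R) := (\int[mu]_z dens h (q, z))%E.
  have mG : measurable_fun setT G.
    apply: (@measurable_fun_fubini_tonelli_F _ _ _ _ _ mu (dens h)).
    - exact: measurable_dens.
    - exact: dens_ge0.
  apply: (@measurable_fun_fubini_tonelli_G _ _ _ _ _ mu G) => //.
  by move=> q; apply: integral_ge0 => z _; exact: dens_ge0.
have phi0 y : (0 <= phi y)%E.
  by apply: integral_ge0 => x _; apply: integral_ge0 => z _; exact: dens_ge0.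
pose N : set R := [set 0] `|` [set a] `|` [set a / rr].
have mN : measurable N by apply: measurableU => //; exact: measurableU.
have N0 : mu N = 0.
  apply: countable_lebesgue_measure0.
  by apply: finite_set_countable; rewrite !finite_setU; split => //; split.
rewrite (@ge0_negligible_integral _ _ _ mu setT N)//; last by move=> y _; exact: phi0.
have -> : (\int[mu]_(y in ordinates) (rectint (1 - y ^+ 2) (wid y) (hgt h y))%:E =
           \int[mu]_(y in ordinates) phi y)%E.
  apply: eq_integral => y; rewrite inE/= => /and3P[y0 ya nr].
  by rewrite /phi slice_integral.
rewrite integral_mkcond [RHS]integral_mkcond; apply: eq_integral => y _.
rewrite !patchE; case: ifPn; rewrite ?inE ?notin_setE; last first.
  move=> nN; have Ny : N y by apply: contrapT => nNy; apply: nN.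
  rewrite memNset// => /and3P[y0 ya nr].
  case: Ny => [[|]|] yE; move: y0 ya nr; rewrite ?yE ?ltxx//.
  by move=> _ _; rewrite (mulrC _ (a / _)) divfK ?eqxx// gt_eqF// rsq_gt0.
move=> [_ Ny]; case: ifPn; rewrite ?inE ?notin_setE// => Yy.
rewrite /phi -[RHS](integral0 mu setT); apply: eq_integral => x _.
rewrite -[RHS](integral0 mu setT); apply: eq_integral => z _.
rewrite /dens; case: ifPn => // /and5P[/= x0 xy z0 yz _]; exfalso; apply: Yy => /=.
have zh : 0 <= z / h by rewrite divr_ge0// ltW.
have y0 : 0 <= y by rewrite -(pmulr_rge0 _ b0); apply: le_trans xy; rewrite mulr_ge0// ltW.
have ya : y <= a by rewrite -[leRHS]mul1r -ler_pdivrMr//; lra.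
rewrite /ordinates/= !lt_neqAle y0 ya !andbT; apply/and3P; split.
- by apply/eqP => yE; apply: Ny; left; left.
- by apply/eqP => yE; apply: Ny; left; right.
- apply/eqP => yE; apply: Ny; right => /=.
  by rewrite -[LHS](mulfK (lt0r_neq0 (rsq_gt0 a0 b0))) (mulrC y) yE.
Qed.

End Volume.

(** * Finiteness *)

Section Finiteness.
Variables (R : realType) (a b : R).
Hypotheses (a0 : 0 < a) (a1 : a < 1) (b0 : 0 < b).
Notation mu := (@lebesgue_measure R).
Local Notation wid := (width a b).
Local Notation hgt := (height a).
Local Notation rr := (rsq a b).
Local Notation ydom := (ordinates a b).

Lemma onem_sqr_gt0 : 0 < 1 - a ^+ 2.
Proof.
have h : 0 < a * (1 - a) by rewrite mulr_gt0 ?subr_gt0.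
by rewrite expr2; nra.
Qed.

Lemma rectint_mono (C X z1 z2 : R) : 0 <= X -> 0 <= z1 -> z1 <= z2 ->
  X ^+ 2 + z2 ^+ 2 < C -> rectint C X z1 <= rectint C X z2.
Proof.
move=> X0 z10; rewrite le_eqVlt => /predU1P[->//|z12 XzC].
have sq z : z1 <= z -> z <= z2 -> X ^+ 2 + z ^+ 2 < C.
  move=> ? ?; apply: le_lt_trans XzC; rewrite lerD2l ler_sqr ?nnegrE//; lra.
have dF z : z \in `]z1, z2[ -> is_derive z 1 (rectint C X) (segint (C - z ^+ 2) X).
  by rewrite in_itv/= => /andP[? ?]; apply: is_derive_rectint; apply: sq; exact: ltW.
have cF : {within `[z1, z2], continuous (rectint C X)}.
  apply: continuous_in_subspaceT => z; rewrite inE/= in_itv/= => /andP[? ?].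
  by apply: rectint_cont; exact: sq.
have [c /[!in_itv]/= /andP[? ?] E] := MVT z12 dF cF.
rewrite -subr_ge0 E mulr_ge0 ?subr_ge0 ?(ltW z12)// segint_ge0//.
by rewrite ltrBrDr; apply: sq; exact: ltW.
Qed.

Lemma rectint_le (C X z : R) : 0 <= X -> 0 <= z -> X ^+ 2 + z ^+ 2 < C ->
  rectint C X z <= z * X / (C * Num.sqrt (C - z ^+ 2) * Num.sqrt (C - z ^+ 2 - X ^+ 2)) +
                   z * X / (C * Num.sqrt (C - X ^+ 2) * Num.sqrt (C - z ^+ 2 - X ^+ 2)).
Proof.
move=> X0 z0 XzC.
have C0 : 0 < C by apply: le_lt_trans XzC; rewrite addr_ge0// sqr_ge0.
have aux p q : 0 <= p -> 0 <= q -> p ^+ 2 + q ^+ 2 < C ->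
    p / (2 * C * Num.sqrt (C - p ^+ 2)) * artq (C - p ^+ 2) q <=
    p * q / (C * Num.sqrt (C - p ^+ 2) * Num.sqrt (C - p ^+ 2 - q ^+ 2)).
  move=> p0 q0 pqC.
  have q2 := sqr_ge0 q.
  have s0 : 0 < Num.sqrt (C - p ^+ 2) by rewrite sqrtr_gt0; lra.
  have e0 : 0 < Num.sqrt (C - p ^+ 2 - q ^+ 2) by rewrite sqrtr_gt0; lra.
  have := @artq_le R (C - p ^+ 2) q q0.
  move=> /(_ ltac:(lra)) H.
  apply: le_trans (ler_wpM2l _ H) _; first by rewrite divr_ge0// !mulr_ge0// ltW.
  by rewrite le_eqVlt; apply/predU1P; left; field; rewrite !gt_eqF.
apply: lerD; first by apply: aux; rewrite // addrC.
have -> : C - z ^+ 2 - X ^+ 2 = C - X ^+ 2 - z ^+ 2 by ring.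
by rewrite (mulrC z); exact: aux.
Qed.

(** The first term serves the slices bounded by the plane of P0 P2 P3, through
    [1 - a ^+ 2 <= 1 - a * y]; the second serves those bounded by the polar plane of P0, through
    [a <= rr * y]. *)
Definition topbound : R := a * b ^+ 2 / (1 - a ^+ 2) + a * rr.

(** For the extreme height, z squared equal to [1 - y / a], the two factors after [topbound] are the
    squares of the roots that occur in the denominators of [rectint_le]. The quotient of the width
    by their product is therefore at most a constant over the square root of [a - rr * y] in
    absolute value: an integrable singularity. *)
Lemma width_bound y : 0 < y -> y < a -> rr * y != a ->
  wid y ^+ 2 * `|a - rr * y| <=
  topbound * ((1 - y ^+ 2 - (1 - y / a)) * (1 - y ^+ 2 - (1 - y / a) - wid y ^+ 2)).
Proof.
move=> y0 ya nr.
have a21 := onem_sqr_gt0.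
have r0 := rsq_gt0 a0 b0.
have ay := onemM_gt0 a0 a1 ya.
have ay2 : 1 - a ^+ 2 <= 1 - a * y by nra.
have k1 : 0 <= a * b ^+ 2 / (1 - a ^+ 2) by rewrite divr_ge0 ?mulr_ge0 ?sqr_ge0 ?ltW.
have -> : 1 - y ^+ 2 - (1 - y / a) = y / a * (1 - a * y).
  by field; rewrite gt_eqF.
have [[ry ->]|[r1 ry ->]] := widthP a0 b0 y0 ya.
  have -> : `|a - rr * y| = a - rr * y by rewrite ger0_norm// subr_ge0.
  have -> : y / a * (1 - a * y) - (b * y / a) ^+ 2 = y / a ^+ 2 * (a - rr * y).
    by rewrite /rsq; field; rewrite gt_eqF.
  rewrite [leRHS](_ : _ = (topbound * (1 - a * y) / a ^+ 3) * (y ^+ 2 * (a - rr * y))); last first.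
    by field; rewrite gt_eqF.
  rewrite exprMn exprVn exprMn -mulrA [leLHS](_ : _ = (b ^+ 2 / a ^+ 2) * (y ^+ 2 * (a - rr * y))); last by ring.
  apply: ler_wpM2r; first by rewrite mulr_ge0 ?sqr_ge0 ?subr_ge0.
  rewrite ler_pdivlMr ?exprn_gt0// [leLHS](_ : _ = a * b ^+ 2 / (1 - a ^+ 2) * (1 - a ^+ 2)); last first.
    by field; rewrite !gt_eqF.
  rewrite /topbound; apply: ler_pM => //; first exact: ltW.
  by rewrite lerDl mulr_ge0 ?ltW.
have -> : `|a - rr * y| = rr * y - a by rewrite ler0_norm ?opprB// subr_le0 ltW.
have -> : y / a * (1 - a * y) - ((1 - a * y) / b) ^+ 2 = (rr * y - a) * (1 - a * y) / (a * b ^+ 2).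
  by rewrite /rsq; field; rewrite !gt_eqF.
rewrite [leRHS](_ : _ = (topbound * y / (a ^+ 2 * b ^+ 2)) * ((1 - a * y) ^+ 2 * (rr * y - a))); last first.
  by field; rewrite !gt_eqF.
rewrite [leLHS](_ : _ = (b ^- 2) * ((1 - a * y) ^+ 2 * (rr * y - a))); last first.
  by field; rewrite !gt_eqF.
apply: ler_wpM2r; first by rewrite mulr_ge0 ?sqr_ge0 ?subr_ge0 ?ltW.
rewrite ler_pdivlMr ?mulr_gt0 ?exprn_gt0// mulrCA mulVf ?mulr1; last by rewrite gt_eqF ?exprn_gt0.
rewrite /topbound mulrDl; have : 0 <= a * b ^+ 2 / (1 - a ^+ 2) * y by rewrite mulr_ge0// ltW.
suff : a ^+ 2 <= a * rr * y by lra.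
by rewrite expr2 -mulrA ler_pM2l// ltW.
Qed.

Lemma rectint_top_le y : 0 < y -> y < a -> rr * y != a ->
  rectint (1 - y ^+ 2) (wid y) (Num.sqrt (1 - y / a)) <=
  2 * Num.sqrt topbound / (1 - a ^+ 2) / Num.sqrt `|a - rr * y|.
Proof.
move=> y0 ya nr.
have u0 : 0 < 1 - y / a by rewrite subr_gt0 ltr_pdivrMr ?mul1r.
have v0 : 0 < y / a by rewrite divr_gt0.
set z := Num.sqrt (1 - y / a).
have z0 : 0 < z by rewrite sqrtr_gt0.
have zE : z ^+ 2 = 1 - y / a by rewrite sqr_sqrtr// ltW.
have ball := width_ball a0 a1 b0 y0 ya nr.
have X0 := width_gt0 a0 a1 b0 y0 ya.
have wb := width_bound y0 ya nr.
have a21 := onem_sqr_gt0.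
apply: le_trans (rectint_le (ltW X0) (ltW z0) _) _; first by rewrite zE; lra.
set X := wid y in X0 ball wb *.
set C := 1 - y ^+ 2 in ball wb *; rewrite -zE in ball wb.
set W := `|a - rr * y| in wb *.
have W0 : 0 < W by rewrite normr_gt0 subr_eq0 eq_sym.
have Ca : 1 - a ^+ 2 <= C by rewrite lerD2l lerN2 ler_sqr ?nnegrE ltW.
have X2 : 0 < X ^+ 2 by rewrite exprn_gt0.
set e := Num.sqrt (C - z ^+ 2 - X ^+ 2).
set s := Num.sqrt (C - z ^+ 2).
set q := Num.sqrt (C - X ^+ 2).
have e0 : 0 < e by rewrite sqrtr_gt0; lra.
have s0 : 0 < s by rewrite sqrtr_gt0; lra.
have q0 : 0 < q by rewrite sqrtr_gt0; have := sqr_ge0 z; lra.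
have w0 : 0 < Num.sqrt W by rewrite sqrtr_gt0.
have s1 : s <= 1.
  by rewrite -[leRHS]sqrtr1 ler_wsqrtr// zE /C; have := sqr_ge0 y; nra.
have z1 : z <= 1 by rewrite -[leRHS]sqrtr1 ler_wsqrtr//; lra.
have zq : z <= q by apply: ler_wsqrtr; rewrite -zE; lra.
have t0 : 0 <= Num.sqrt topbound := sqrtr_ge0 _.
have key : X * Num.sqrt W <= Num.sqrt topbound * (s * e).
  have -> : X = Num.sqrt (X ^+ 2) by rewrite sqrtr_sqr gtr0_norm.
  have T0 : 0 <= topbound.
    rewrite addr_ge0 ?divr_ge0 ?mulr_ge0 ?sqr_ge0 ?ltW//; exact: rsq_gt0.
  rewrite /s /e -!sqrtrM ?sqr_ge0//; last by lra.
  exact: ler_wsqrtr.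
have key1 : X / (s * e) <= Num.sqrt topbound / Num.sqrt W.
  by rewrite ler_pdivrMr ?mulr_gt0// mulrAC ler_pdivlMr.
have C0 : 0 < C by lra.
have Ci : C^-1 <= (1 - a ^+ 2)^-1 by rewrite lef_pV2 ?posrE.
have Xse : 0 <= X / (s * e) by rewrite divr_ge0 ?mulr_ge0 ?ltW.
have b1 : z * X / (C * s * e) <= (1 - a ^+ 2)^-1 * (Num.sqrt topbound / Num.sqrt W).
  rewrite [leLHS](_ : _ = z * (C^-1 * (X / (s * e)))); last by field; rewrite !gt_eqF.
  apply: (@le_trans _ _ (1 * (C^-1 * (X / (s * e))))).
    by apply: ler_wpM2r => //; rewrite mulr_ge0// invr_ge0 ltW.
  by rewrite mul1r; apply: ler_pM => //; rewrite invr_ge0 ltW.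
have b2 : z * X / (C * q * e) <= (1 - a ^+ 2)^-1 * (Num.sqrt topbound / Num.sqrt W).
  rewrite [leLHS](_ : _ = (z / q * s) * (C^-1 * (X / (s * e)))); last by field; rewrite !gt_eqF.
  apply: (@le_trans _ _ (1 * (C^-1 * (X / (s * e))))).
    apply: ler_wpM2r; first by rewrite mulr_ge0// invr_ge0 ltW.
    rewrite -[leRHS]mulr1; apply: ler_pM => //.
    - by rewrite divr_ge0// ltW.
    - exact: ltW.
    - by rewrite ler_pdivrMr// mul1r.
  by rewrite mul1r; apply: ler_pM => //; rewrite invr_ge0 ltW.
apply: le_trans (lerD b1 b2) _; rewrite le_eqVlt; apply/predU1P; left.
by field; rewrite !gt_eqF.
Qed.

Lemma is_derive_sqrt_affine (p k y : R) : 0 < p + k * y ->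
  is_derive y 1 (fun y : R => Num.sqrt (p + k * y)) (k / (2 * Num.sqrt (p + k * y))).
Proof.
move=> py.
have ? : is_derive (p + k * y) 1 (@Num.sqrt R) (2 * Num.sqrt (p + k * y))^-1.
  exact: is_derive1_sqrt.
have ? : is_derive y 1 (fun y : R => p + k * y) k.
  by apply: is_derive_eq; rewrite /GRing.scale/=; ring.
by apply: is_derive_eq; rewrite mulrC.
Qed.

Lemma integral_invsqrt_affine (p k x1 x2 : R) : x1 < x2 -> k != 0 ->
  (forall y, y \in `]x1, x2[ -> 0 < p + k * y) ->
  (\int[mu]_(y in `]x1, x2[) ((Num.sqrt (p + k * y))^-1)%:E < +oo)%E.
Proof.
move=> x12 k0 pos.
have cs y : {for y, continuous (fun y : R => Num.sqrt (p + k * y))}.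
  apply: (@continuous_comp _ _ _ (fun y : R => p + k * y) (@Num.sqrt R)).
    by apply/differentiable_continuous/derivable1_diffP; exact: ex_derive.
  exact: sqrt_continuous.
have cF y : {for y, continuous (fun y : R => 2 / k * Num.sqrt (p + k * y))}.
  by apply: continuousM; [exact: cvg_cst|exact: cs].
suff -> : (\int[mu]_(y in `]x1, x2[) ((Num.sqrt (p + k * y))^-1)%:E =
    (2 / k * Num.sqrt (p + k * x2) - 2 / k * Num.sqrt (p + k * x1))%:E)%E by rewrite ltry.
apply: (@ge0_FTC2_oo _ _ (fun y => 2 / k * Num.sqrt (p + k * y)) _ _ _ _ x12).
- by move=> y _; rewrite invr_ge0 sqrtr_ge0.
- move=> y /pos ?; apply: continuousV => //.
  by rewrite gt_eqF// sqrtr_gt0.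
- move=> y /pos h; have s0 : 0 < Num.sqrt (p + k * y) by rewrite sqrtr_gt0.
  have ? := is_derive_sqrt_affine h.
  apply: is_derive_eq; rewrite /GRing.scale/=; field.
  by rewrite k0 gt_eqF.
- exact/cvg_at_right_filter/cF.
- exact/cvg_at_left_filter/cF.
Qed.

Lemma measurable_rectint_top :
  measurable_fun setT (fun y : R => rectint (1 - y ^+ 2) (wid y) (Num.sqrt (1 - y / a))).
Proof.
apply: measurable_fun_rectint.
- by apply: measurable_funB => //; exact: measurable_funX.
- exact: measurable_width.
- by apply: measurable_fun_sqrt; apply: measurable_funB => //; apply: measurable_funM.
Qed.

(** [Num.sqrt (1 - y / a)] is the largest height that the column over y reaches for any h. A single
    function thus dominates all the slice integrals, and its inverse square root singularity at
    [a / rr] is integrable. *)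
Lemma rectint_top_finite :
  (\int[mu]_(y in ydom) (rectint (1 - y ^+ 2) (wid y) (Num.sqrt (1 - y / a)))%:E < +oo)%E.
Proof.
have r0 := rsq_gt0 a0 b0.
pose K := 2 * Num.sqrt topbound / (1 - a ^+ 2).
have a21 := onem_sqr_gt0.
have K0 : 0 <= K by rewrite divr_ge0 ?mulr_ge0 ?sqrtr_ge0 ?ltW.
pose w y := (Num.sqrt `|a - rr * y|)^-1.
have w0 y : 0 <= w y by rewrite invr_ge0 sqrtr_ge0.
have mw D : measurable_fun D (EFin \o w).
  apply: (measurable_funS measurableT) => //; apply/measurable_EFinP.
  apply: measurable_funV; apply: measurable_fun_sqrt.
  apply: (measurableT_comp (@normr_measurable R setT)) => //.
  by apply: measurable_funB => //; apply: measurable_funM.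
have mY := measurable_ordinates a0 b0.
apply: (@le_lt_trans _ _ (\int[mu]_(y in ydom) (K%:E * (w y)%:E))%E).
  apply: ge0_le_integral => //.
  - move=> y /and3P[y0 ya nr]; rewrite lee_fin.
    have u0 : 0 < 1 - y / a by rewrite subr_gt0 ltr_pdivrMr ?mul1r.
    rewrite -(rectint0 (1 - y ^+ 2) (wid y)); apply: rectint_mono => //.
    + exact/ltW/width_gt0.
    + by rewrite sqr_sqrtr ?ltW//; have := width_ball a0 a1 b0 y0 ya nr; lra.
  - apply: (measurable_funS measurableT) => //; apply/measurable_EFinP.
    exact: measurable_rectint_top.
  - by apply: emeasurable_funM => //; exact: mw.
  - move=> y /and3P[y0 ya nr]; rewrite -EFinM lee_fin; exact: rectint_top_le.
rewrite ge0_integralZl//; [|exact: mw|by move=> y _; rewrite lee_fin].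
rewrite lte_mul_pinfty// ?lee_fin//.
have E1 : (\int[mu]_(y in `]0%R, (a / rr)%R[) (w y)%:E < +oo)%E.
  have -> : (\int[mu]_(y in `]0%R, (a / rr)%R[) (w y)%:E =
      \int[mu]_(y in `]0%R, (a / rr)%R[) ((Num.sqrt (a + (- rr) * y))^-1)%:E)%E.
    apply: eq_integral => y; rewrite inE/= in_itv/= => /andP[y0 yr].
    rewrite /w mulNr ger0_norm// subr_ge0 mulrC -ler_pdivlMr// ltW//.
  apply: integral_invsqrt_affine; rewrite ?divr_gt0// ?oppr_eq0 ?gt_eqF//.
  move=> y; rewrite in_itv/= => /andP[y0 yr].
  by rewrite mulNr subr_gt0 mulrC -ltr_pdivlMr.
have E2 : (\int[mu]_(y in `](a / rr)%R, a[) (w y)%:E < +oo)%E.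
  have [ra|ra] := ltP (a / rr) a; last by rewrite set_itv_ge ?integral_set0 ?ltry// bnd_simp -leNgt.
  have -> : (\int[mu]_(y in `](a / rr)%R, a[) (w y)%:E =
      \int[mu]_(y in `](a / rr)%R, a[) ((Num.sqrt (- a + rr * y))^-1)%:E)%E.
    apply: eq_integral => y; rewrite inE/= in_itv/= => /andP[yr ya].
    rewrite /w ler0_norm; last by rewrite subr_le0 mulrC -ler_pdivrMr// ltW.
    by rewrite opprB addrC.
  apply: integral_invsqrt_affine; rewrite ?gt_eqF//.
  move=> y; rewrite in_itv/= => /andP[yr ya].
  by rewrite addrC subr_gt0 mulrC -ltr_pdivrMr.
apply: (@le_lt_trans _ _ (\int[mu]_(y in `]0%R, (a / rr)%R[ `|` `](a / rr)%R, a[) (w y)%:E)%E).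
  apply: ge0_subset_integral => //.
  - exact: measurableU.
  - exact: mw.
  - by move=> y _; rewrite lee_fin.
  - move=> y /and3P[y0 ya nr] /=; rewrite !in_itv/= y0 ya andbT/=.
    have : y != a / rr by apply: contraNneq nr => ->; rewrite mulrC divfK// gt_eqF.
    by rewrite neq_lt => /orP[->|->]; [left|right].
rewrite ge0_integral_setU//; first by rewrite lte_add_pinfty.
- exact: mw.
- by move=> y _; rewrite lee_fin.
- apply/disj_setPS => y [] /=; rewrite !in_itv/= => /andP[_ h1] /andP[h2 _].
  by have := lt_trans h1 h2; rewrite ltxx.
Qed.

End Finiteness.

(** * Sweeping the height parameter *)

Section Sweep.
Variables (R : realType) (a b : R).
Hypotheses (a0 : 0 < a) (a1 : a < 1) (b0 : 0 < b).
Notation mu := (@lebesgue_measure R).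
Local Notation wid := (width a b).
Local Notation hgt := (height a).
Local Notation rr := (rsq a b).
Local Notation ydom := (ordinates a b).

Lemma height_low h y : 0 < h -> 0 < y -> y < a -> h ^+ 2 * (1 - y / a) <= 1 ->
  hgt h y = h * (1 - y / a).
Proof.
move=> h0 y0 ya hu; rewrite /height; case: ifP => // _; apply/min_idPl.
by rewrite -[leRHS]mul1r ler_pdivlMr// mulrAC -expr2.
Qed.

Lemma height_high h y : 0 < h -> 0 < y -> y < a -> 1 <= h ^+ 2 * (1 - y / a) ->
  hgt h y = h^-1.
Proof.
move=> h0 y0 ya hu; rewrite /height ifF; last first.
  apply/negbTE/negP => h1; have v0 : 0 < y / a by rewrite divr_gt0.
  have u0 : 0 < 1 - y / a by rewrite subr_gt0 ltr_pdivrMr ?mul1r.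
  have hs : h ^+ 2 <= 1 by rewrite expr_le1// ltW.
  have : h ^+ 2 * (1 - y / a) <= 1 - y / a by rewrite ler_piMl// ltW.
  lra.
apply/min_idPr.
by rewrite -[leLHS]mul1r ler_pdivrMr// mulrAC -expr2.
Qed.

(** Derivative in h of the slice integral while the top side lies on the face P0 P1 P3: [segint]
    integrates the density along that side, and [1 - y / a] is the speed at which it rises. *)
Definition rise_density (y h : R) : R :=
  (1 - y / a) * segint (1 - y ^+ 2 - (h * (1 - y / a)) ^+ 2) (wid y).

(** Here the top side lies on the polar plane [z = h^-1] of P3, which sinks at speed [h ^- 2]. *)
Definition fall_density (y h : R) : R :=
  h ^- 2 * segint (1 - y ^+ 2 - h ^- 2) (wid y).

Lemma rise_integral y h1 h2 : y \in ydom -> 0 < h1 -> h1 < h2 ->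
  h2 ^+ 2 * (1 - y / a) <= 1 ->
  (\int[mu]_(h in `]h1, h2[) (rise_density y h)%:E =
   (rectint (1 - y ^+ 2) (wid y) (hgt h2 y) -
    rectint (1 - y ^+ 2) (wid y) (hgt h1 y))%:E)%E.
Proof.
rewrite inE/= => /and3P[y0 ya nr] h10 h12 h2u.
have u0 : 0 < 1 - y / a by rewrite subr_gt0 ltr_pdivrMr ?mul1r.
have wb := width_ball a0 a1 b0 y0 ya nr.
have X0 := width_gt0 a0 a1 b0 y0 ya.
have low h : 0 < h -> h <= h2 -> h ^+ 2 * (1 - y / a) <= 1.
  move=> h0 hh2; apply: le_trans h2u; rewrite ler_pM2r// ler_sqr ?nnegrE//; lra.
have ball h : 0 < h -> h <= h2 -> wid y ^+ 2 + (h * (1 - y / a)) ^+ 2 < 1 - y ^+ 2.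
  move=> h0 /(low h h0) hu; have : (h * (1 - y / a)) ^+ 2 <= 1 - y / a.
    by rewrite exprMn (expr2 (1 - y / a)) mulrA ler_piMl// ltW.
  lra.
have pos h : h \in `]h1, h2[ -> 0 < h /\ h <= h2.
  by rewrite in_itv/= => /andP[? /ltW ?]; split => //; lra.
have cF h : 0 < h -> h <= h2 ->
  {for h, continuous (fun h : R => rectint (1 - y ^+ 2) (wid y) (h * (1 - y / a)))}.
  move=> h0 hh2.
  apply: (@continuous_comp _ _ _ (fun h : R => h * (1 - y / a)) (rectint (1 - y ^+ 2) (wid y))).
    by apply/differentiable_continuous/derivable1_diffP; exact: ex_derive.
  by apply: rectint_cont; exact: ball.
rewrite !height_low//; [|exact: low h10 (ltW h12)|by lra].
apply: (@ge0_FTC2_oo R (rise_density y) (fun h => rectint (1 - y ^+ 2) (wid y) (h * (1 - y / a))) _ _ _ _ h12).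
- move=> h /pos[h0 hh2]; rewrite mulr_ge0 ?(ltW u0)// segint_ge0 ?(ltW X0)//.
  by rewrite ltrBrDr; exact: ball.
- move=> h /pos[h0 hh2]; apply: continuousM; first exact: cvg_cst.
  apply: (@segint_cont _ (fun h => 1 - y ^+ 2 - (h * (1 - y / a)) ^+ 2) (fun=> wid y)).
  - by apply: derivableB; [exact: derivable_cst|exact: ex_derive].
  - exact: derivable_cst.
  by rewrite ltrBrDr; exact: ball.
- move=> h /pos[h0 hh2]; have dr := is_derive_rectint (ball h h0 hh2).
  have dl : is_derive h 1 (fun h : R => h * (1 - y / a)) (1 - y / a).
    by apply: is_derive_eq; rewrite /GRing.scale/=; ring.
  have -> : rise_density y h = segint (1 - y ^+ 2 - (h * (1 - y / a)) ^+ 2) (wid y) * (1 - y / a).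
    by rewrite /rise_density mulrC.
  exact: (@is_derive1_comp _ (rectint (1 - y ^+ 2) (wid y)) (fun h : R => h * (1 - y / a))).
- by apply: cvg_at_right_filter; apply: cF => //; exact: ltW.
- by apply: cvg_at_left_filter; apply: cF => //; lra.
Qed.

Lemma fall_integral y h1 h2 : y \in ydom -> 0 < h1 -> h1 < h2 ->
  1 <= h1 ^+ 2 * (1 - y / a) ->
  (\int[mu]_(h in `]h1, h2[) (fall_density y h)%:E =
   (rectint (1 - y ^+ 2) (wid y) (hgt h1 y) -
    rectint (1 - y ^+ 2) (wid y) (hgt h2 y))%:E)%E.
Proof.
rewrite inE/= => /and3P[y0 ya nr] h10 h12 h1u.
have u0 : 0 < 1 - y / a by rewrite subr_gt0 ltr_pdivrMr ?mul1r.
have wb := width_ball a0 a1 b0 y0 ya nr.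
have X0 := width_gt0 a0 a1 b0 y0 ya.
have high h : h1 <= h -> 1 <= h ^+ 2 * (1 - y / a).
  move=> hh1; apply: le_trans h1u _; rewrite ler_pM2r// ler_sqr ?nnegrE//; lra.
have ball h : h1 <= h -> wid y ^+ 2 + (h^-1) ^+ 2 < 1 - y ^+ 2.
  move=> hh1; have h0 : 0 < h by lra.
  have : (h^-1) ^+ 2 <= 1 - y / a.
    by rewrite exprVn -[leLHS]mul1r ler_pdivrMr ?exprn_gt0// mulrC; exact: high.
  lra.
have pos h : h \in `]h1, h2[ -> 0 < h /\ h1 <= h.
  by rewrite in_itv/= => /andP[/ltW ? _]; split => //; lra.
have cF h : h1 <= h ->
  {for h, continuous (fun h : R => - rectint (1 - y ^+ 2) (wid y) h^-1)}.
  move=> hh1; apply: continuousN.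
  apply: (@continuous_comp _ _ _ (fun h : R => h^-1) (rectint (1 - y ^+ 2) (wid y))).
    by apply: inv_continuous; rewrite gt_eqF//; lra.
  by apply: rectint_cont; exact: ball.
rewrite !height_high//; [|exact: lt_trans h12|exact: high (ltW h12)].
rewrite -[X in (X - _)%:E]opprK [X in X%:E]addrC.
apply: (@ge0_FTC2_oo R (fall_density y) (fun h => - rectint (1 - y ^+ 2) (wid y) h^-1) _ _ _ _ h12).
- move=> h /pos[h0 hh1]; rewrite mulr_ge0 ?invr_ge0 ?sqr_ge0// segint_ge0 ?(ltW X0)//.
  by rewrite ltrBrDr -exprVn; exact: ball.
- move=> h /pos[h0 hh1].
  have dV : derivable (fun h : R => h ^- 2) h 1.
    by apply: derivableV; [rewrite gt_eqF// exprn_gt0|exact: ex_derive].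
  apply: continuousM.
    by apply/differentiable_continuous/derivable1_diffP.
  apply: (@segint_cont _ (fun h => 1 - y ^+ 2 - h ^- 2) (fun=> wid y)).
  - by apply: derivableB; [exact: derivable_cst|exact: dV].
  - exact: derivable_cst.
  by rewrite ltrBrDr -exprVn; exact: ball.
- move=> h /pos[h0 hh1]; have dr := is_derive_rectint (ball h hh1).
  have dl : is_derive h 1 (fun h : R => h^-1) (- h ^- 2).
    rewrite -[X in is_derive _ _ _ X]mulr1.
    by apply: (@is_deriveV _ (fun h : R => h)); rewrite gt_eqF.
  have -> : fall_density y h = - (segint (1 - y ^+ 2 - (h^-1) ^+ 2) (wid y) * - h ^- 2).
    by rewrite /fall_density exprVn mulrN opprK mulrC.
  have dc : is_derive h 1 (fun h : R => rectint (1 - y ^+ 2) (wid y) h^-1)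
      (segint (1 - y ^+ 2 - (h^-1) ^+ 2) (wid y) * - h ^- 2).
    exact: (@is_derive1_comp _ (rectint (1 - y ^+ 2) (wid y)) (fun h : R => h^-1)).
  exact: (@is_deriveN _ _ _ (fun h : R => rectint (1 - y ^+ 2) (wid y) h^-1)).
- by apply: cvg_at_right_filter; exact: cF.
- by apply: cvg_at_left_filter; apply: cF; exact: ltW.
Qed.

(* Volume gained on the face P0 P1 P3, resp. lost on the polar plane of P3, per
   unit of h. *)
Definition rise (h : R) : \bar R :=
  (\int[mu]_(y in ydom `&` [set y | (h ^+ 2 * (1 - y / a) < 1)%R]) (rise_density y h)%:E)%E.

Definition fall (h : R) : \bar R :=
  (\int[mu]_(y in ydom `&` [set y | (1 < h ^+ 2 * (1 - y / a))%R]) (fall_density y h)%:E)%E.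

Definition vol (h : R) : \bar R :=
  (\int[mu]_(y in ydom) (rectint (1 - y ^+ 2) (wid y) (hgt h y))%:E)%E.

Lemma measurable_volI h :
  measurable_fun setT (fun y : R => rectint (1 - y ^+ 2) (wid y) (hgt h y)).
Proof.
apply: measurable_fun_rectint.
- by apply: measurable_funB => //; exact: measurable_funX.
- exact: measurable_width.
- exact: measurable_height.
Qed.

Lemma volI_ge0 h y : 0 < h -> ydom y ->
  0 <= rectint (1 - y ^+ 2) (wid y) (hgt h y).
Proof.
move=> h0 /and3P[y0 ya nr]; rewrite -(rectint0 (1 - y ^+ 2) (wid y)).
apply: rectint_mono => //; [exact/ltW/width_gt0|exact/ltW/height_gt0|exact: height_ball].
Qed.

Lemma volI_le h y : 0 < h -> ydom y ->
  rectint (1 - y ^+ 2) (wid y) (hgt h y) <=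
  rectint (1 - y ^+ 2) (wid y) (Num.sqrt (1 - y / a)).
Proof.
move=> h0 /and3P[y0 ya nr].
have u0 : 0 < 1 - y / a by rewrite subr_gt0 ltr_pdivrMr ?mul1r.
have t0 := height_gt0 a0 h0 ya.
apply: rectint_mono => //; [exact/ltW/width_gt0|exact: ltW| |].
- by rewrite -[leLHS](gtr0_norm t0) -sqrtr_sqr ler_wsqrtr// height_le.
- by rewrite sqr_sqrtr ?(ltW u0)//; have := width_ball a0 a1 b0 y0 ya nr; lra.
Qed.

(** Up to h = 1 the vertex P3 is not truncated and the columns only grow. This settles the range
    that the evaluation for [1 < h] leaves aside. *)
Lemma vol_le1 h : 0 < h -> h <= 1 -> (vol h <= vol 1)%E.
Proof.
move=> h0 h1; have mY := measurable_ordinates a0 b0.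
have mm k : measurable_fun ydom (fun y : R => (rectint (1 - y ^+ 2) (wid y) (hgt k y))%:E).
  apply: (measurable_funS measurableT) => //.
  by apply/measurable_EFinP; exact: measurable_volI.
apply: ge0_le_integral => //.
- by move=> y Yy; rewrite lee_fin volI_ge0.
- exact: mm.
- exact: mm.
- move=> y Yy; have /and3P[y0 ya nr] := Yy; rewrite lee_fin.
  have u0 : 0 < 1 - y / a by rewrite subr_gt0 ltr_pdivrMr ?mul1r.
  apply: rectint_mono; [exact/ltW/width_gt0|exact/ltW/height_gt0| |exact: height_ball].
  by rewrite /height h1 lexx ler_pM2r.
Qed.

(** Extension by zero to the whole plane of pairs (y, h), on which Tonelli exchanges the two
    integrals. *)
Let riseK h1 h2 (q : R * R) : \bar R :=
  if [&& 0 < q.1, q.1 < a, rr * q.1 != a, h1 < q.2, q.2 < h2 & q.2 ^+ 2 * (1 - q.1 / a) < 1]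
  then (rise_density q.1 q.2)%:E else 0%:E.

Let fallK h1 h2 (q : R * R) : \bar R :=
  if [&& 0 < q.1, q.1 < a, rr * q.1 != a, h1 < q.2, q.2 < h2 & 1 < q.2 ^+ 2 * (1 - q.1 / a)]
  then (fall_density q.1 q.2)%:E else 0%:E.

Let m1 : measurable_fun [set: R * R] (fun p : R * R => p.1).
Proof. exact: measurable_fst. Qed.

Let m2 : measurable_fun [set: R * R] (fun p : R * R => p.2).
Proof. exact: measurable_snd. Qed.

Let mu1 : measurable_fun [set: R * R] (fun p : R * R => 1 - p.1 / a).
Proof. by apply: measurable_funB => //; exact: measurable_funM. Qed.

Let mX1 : measurable_fun [set: R * R] (fun p : R * R => wid p.1).
Proof. exact: (measurableT_comp (measurable_width a b)). Qed.

Lemma measurable_riseK h1 h2 : measurable_fun setT (riseK h1 h2).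
Proof.
apply: measurable_fun_ifT => //.
  apply: measurable_and; first exact: measurable_fun_ltr.
  apply: measurable_and; first exact: measurable_fun_ltr.
  apply: measurable_and.
    by apply: measurable_neg; apply: measurable_fun_eqr => //; exact: measurable_funM.
  apply: measurable_and; first exact: measurable_fun_ltr.
  apply: measurable_and; first exact: measurable_fun_ltr.
  by apply: measurable_fun_ltr => //; apply: measurable_funM => //; exact: measurable_funX.
apply/measurable_EFinP; apply: measurable_funM => //.
apply: measurable_fun_segint => //.
apply: measurable_funB; first by apply: measurable_funB => //; exact: measurable_funX.
by apply: measurable_funX; exact: measurable_funM.
Qed.

Lemma measurable_fallK h1 h2 : measurable_fun setT (fallK h1 h2).
Proof.
apply: measurable_fun_ifT => //.
  apply: measurable_and; first exact: measurable_fun_ltr.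
  apply: measurable_and; first exact: measurable_fun_ltr.
  apply: measurable_and.
    by apply: measurable_neg; apply: measurable_fun_eqr => //; exact: measurable_funM.
  apply: measurable_and; first exact: measurable_fun_ltr.
  apply: measurable_and; first exact: measurable_fun_ltr.
  by apply: measurable_fun_ltr => //; apply: measurable_funM => //; exact: measurable_funX.
have mV : measurable_fun [set: R * R] (fun p : R * R => p.2 ^- 2).
  by apply: measurable_funV; exact: measurable_funX.
apply/measurable_EFinP; apply: measurable_funM => //.
apply: measurable_fun_segint => //.
by apply: measurable_funB => //; apply: measurable_funB => //; exact: measurable_funX.
Qed.

Lemma rise_density_ge0 y h : 0 < y -> y < a -> 0 < h -> h ^+ 2 * (1 - y / a) < 1 -> 0 <= rise_density y h.
Proof.
move=> y0 ya h0 hu.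
have u0 : 0 < 1 - y / a by rewrite subr_gt0 ltr_pdivrMr ?mul1r.
rewrite mulr_ge0 ?(ltW u0)// segint_ge0 ?(ltW (width_gt0 a0 a1 b0 y0 ya))//.
apply: width_ball_lt => //.
by rewrite exprMn (expr2 (1 - y / a)) mulrA gtr_pMl.
Qed.

Lemma fall_density_ge0 y h : 0 < y -> y < a -> 0 < h -> 1 < h ^+ 2 * (1 - y / a) -> 0 <= fall_density y h.
Proof.
move=> y0 ya h0 hu.
have u0 : 0 < 1 - y / a by rewrite subr_gt0 ltr_pdivrMr ?mul1r.
rewrite mulr_ge0 ?invr_ge0 ?sqr_ge0// segint_ge0 ?(ltW (width_gt0 a0 a1 b0 y0 ya))//.
rewrite -exprVn; apply: width_ball_lt => //.
by rewrite exprVn -[ltLHS]mul1r ltr_pdivrMr ?exprn_gt0// mulrC.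
Qed.

Lemma riseK_ge0 h1 h2 q : 0 < h1 -> (0 <= riseK h1 h2 q)%E.
Proof.
move=> h10; rewrite /riseK; case: ifP => // /and5P[y0 ya _ hh /andP[_ hu]].
by rewrite lee_fin rise_density_ge0//; exact: lt_trans hh.
Qed.

Lemma fallK_ge0 h1 h2 q : 0 < h1 -> (0 <= fallK h1 h2 q)%E.
Proof.
move=> h10; rewrite /fallK; case: ifP => // /and5P[y0 ya _ hh /andP[_ hu]].
by rewrite lee_fin fall_density_ge0//; exact: lt_trans hh.
Qed.

(* The parameter in [h1, h2] at which the column over y is highest: the column
   grows as long as h ^+ 2 * (1 - y / a) < 1 and shrinks afterwards. *)
Let peak h1 h2 y : R := Num.min (Num.max (Num.sqrt (1 - y / a))^-1 h1) h2.

Lemma sqrt_inv_lt (h u : R) : 0 < h -> 0 < u -> (h < (Num.sqrt u)^-1) = (h ^+ 2 * u < 1).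
Proof.
move=> h0 u0; have s0 : 0 < Num.sqrt u by rewrite sqrtr_gt0.
have hs : 0 < h * Num.sqrt u by rewrite mulr_gt0.
rewrite -[X in h < X]mul1r ltr_pdivlMr// -[in RHS](sqr_sqrtr (ltW u0)) -exprMn.
by rewrite expr_lt1// ltW.
Qed.

Lemma sqrt_inv_gt (h u : R) : 0 < h -> 0 < u -> ((Num.sqrt u)^-1 < h) = (1 < h ^+ 2 * u).
Proof.
move=> h0 u0; have s0 : 0 < Num.sqrt u by rewrite sqrtr_gt0.
have hs : 0 < h * Num.sqrt u by rewrite mulr_gt0.
rewrite -[X in X < h]mul1r ltr_pdivrMr// -[in RHS](sqr_sqrtr (ltW u0)) -exprMn.
by rewrite expr_gt1// ltW.
Qed.

(** Within []h1, h2[] the column over y rises exactly while [h < peak h1 h2 y], so [rise_integral]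
    applies between [h1] and the peak; if the peak is [h1], nothing is gained. *)
Lemma riseK_slice h1 h2 y : 0 < h1 -> h1 < h2 -> ydom y ->
  ((rectint (1 - y ^+ 2) (wid y) (hgt h1 y))%:E + \int[mu]_h riseK h1 h2 (y, h) =
   (rectint (1 - y ^+ 2) (wid y) (hgt (peak h1 h2 y) y))%:E)%E.
Proof.
move=> h10 h12 Yy; have /and3P[y0 ya nr] := Yy.
have u0 : 0 < 1 - y / a by rewrite subr_gt0 ltr_pdivrMr ?mul1r.
have -> : (\int[mu]_h riseK h1 h2 (y, h) =
    \int[mu]_(h in `]h1, peak h1 h2 y[) (rise_density y h)%:E)%E.
  have -> : `]h1, peak h1 h2 y[%classic = [set h | [&& h1 < h, h < h2 & h ^+ 2 * (1 - y / a) < 1]].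
    apply/seteqP; split=> h /=; rewrite in_itv/= /peak lt_min lt_max.
      move=> /and3P[hh /orP[hs|hs] ->]; last by have := lt_trans hh hs; rewrite ltxx.
      by rewrite hh/= -sqrt_inv_lt//; exact: lt_trans hh.
    move=> /and3P[hh -> hu]; rewrite hh andbT/= sqrt_inv_lt ?hu//; exact: lt_trans hh.
  rewrite integral_if; apply: eq_integral => h _.
  by rewrite /riseK/= y0 ya nr.
have [ph|ph] := leP (peak h1 h2 y) h1.
  rewrite set_itv_ge ?integral_set0 ?adde0; last by rewrite bnd_simp -leNgt.
  by congr (rectint _ _ (hgt _ _))%:E; apply/eqP; rewrite eq_le ph andbT /peak le_min le_max lexx orbT ltW.
rewrite rise_integral ?inE//.
  by rewrite -EFinD; congr _%:E; ring.
rewrite leNgt -sqrt_inv_gt//; last exact: lt_trans ph.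
rewrite -leNgt; move: ph; rewrite /peak lt_min lt_max ltxx orbF => /andP[hs _].
by rewrite (max_idPl (ltW hs)) ge_min lexx.
Qed.

Lemma fallK_slice h1 h2 y : 0 < h1 -> h1 < h2 -> ydom y ->
  ((rectint (1 - y ^+ 2) (wid y) (hgt h2 y))%:E + \int[mu]_h fallK h1 h2 (y, h) =
   (rectint (1 - y ^+ 2) (wid y) (hgt (peak h1 h2 y) y))%:E)%E.
Proof.
move=> h10 h12 Yy; have /and3P[y0 ya nr] := Yy.
have u0 : 0 < 1 - y / a by rewrite subr_gt0 ltr_pdivrMr ?mul1r.
have -> : (\int[mu]_h fallK h1 h2 (y, h) =
    \int[mu]_(h in `]peak h1 h2 y, h2[) (fall_density y h)%:E)%E.
  have -> : `]peak h1 h2 y, h2[%classic = [set h | [&& h1 < h, h < h2 & 1 < h ^+ 2 * (1 - y / a)]].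
    apply/seteqP; split=> h /=; rewrite in_itv/= /peak gt_min gt_max.
      move=> /andP[/orP[/andP[hs hh]|hh] h2h]; last by have := lt_trans hh h2h; rewrite ltxx.
      by rewrite hh h2h/= -sqrt_inv_gt//; exact: lt_trans hh.
    move=> /and3P[hh -> hu]; rewrite hh andbT/= sqrt_inv_gt ?hu//; exact: lt_trans hh.
  rewrite integral_if; apply: eq_integral => h _.
  by rewrite /fallK/= y0 ya nr.
have [ph|ph] := leP h2 (peak h1 h2 y).
  rewrite set_itv_ge ?integral_set0 ?adde0; last by rewrite bnd_simp -leNgt.
  by congr (rectint _ _ (hgt _ _))%:E; apply/eqP; rewrite eq_le ph /peak ge_min lexx orbT.
have p0 : 0 < peak h1 h2 y by rewrite /peak lt_min lt_max h10 orbT (lt_trans h10).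
rewrite fall_integral ?inE//.
  by rewrite -EFinD; congr _%:E; ring.
rewrite leNgt -sqrt_inv_lt// -leNgt; move: ph; rewrite /peak gt_min ltxx orbF => hs.
by rewrite (min_idPl (ltW hs)) le_max lexx.
Qed.

(** Every column stands at its own highest point over the parameters in [h1, h2], so this need not
    be the volume of one [R_h]. It equals both [vol h1] plus the gains and [vol h2] plus the losses,
    which relates the two volumes without a subtraction in the extended reals. *)
Definition vol_max h1 h2 : \bar R :=
  (\int[mu]_(y in ydom) (rectint (1 - y ^+ 2) (wid y) (hgt (peak h1 h2 y) y))%:E)%E.

Lemma peak_gt0 h1 h2 y : 0 < h1 -> h1 < h2 -> 0 < peak h1 h2 y.
Proof. by move=> h10 h12; rewrite /peak lt_min lt_max h10 orbT (lt_trans h10). Qed.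

(** Common to gains and losses: [h] is the end of the interval from which the columns climb to their
    peaks, [h1] for the gains and [h2], with the parameter run backwards, for the losses. *)
Lemma sweepK h1 h2 (K : R * R -> \bar R) (I : R -> R -> R) (p : R -> R -> bool) h :
  0 < h -> measurable_fun setT K -> (forall q, 0 <= K q)%E ->
  (forall y k, K (y, k) = if [&& 0 < y, y < a, rr * y != a, h1 < k, k < h2 & p y k]
     then (I y k)%:E else 0%:E) ->
  (forall y, ydom y -> (rectint (1 - y ^+ 2) (wid y) (hgt h y))%:E + \int[mu]_k K (y, k) =
    (rectint (1 - y ^+ 2) (wid y) (hgt (peak h1 h2 y) y))%:E)%E ->
  let S k := (\int[mu]_(y in ydom `&` [set y | p y k]) (I y k)%:E)%E in
  measurable_fun `]h1, h2[ S /\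
  (vol h + \int[mu]_(k in `]h1, h2[) S k = vol_max h1 h2)%E.
Proof.
move=> h0 mK K0 KE slice S; have mY := measurable_ordinates a0 b0.
have SE k : k \in `]h1, h2[ -> S k = (\int[mu]_y K (y, k))%E.
  rewrite in_itv/= => /andP[k1 k2].
  have -> : S k = (\int[mu]_(y in [set y : R | [&& 0 < y, y < a, rr * y != a & p y k]%R]) (I y k)%:E)%E.
    congr (integral _ _ _); apply/seteqP; split=> y /=.
      by move=> [/and3P[-> -> ->] ->].
    by move=> /and4P[? ? ? ?]; split => //; apply/and3P.
  rewrite integral_if; apply: eq_integral => y _.
  by rewrite KE k1 k2.
have mG : measurable_fun setT (fun k => \int[mu]_y K (y, k))%E.
  exact: (@measurable_fun_fubini_tonelli_G _ _ _ _ _ mu K).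
have mF : measurable_fun setT (fun y => \int[mu]_k K (y, k))%E.
  exact: (@measurable_fun_fubini_tonelli_F _ _ _ _ _ mu K).
split.
  apply: (eq_measurable_fun (fun k => \int[mu]_y K (y, k))%E).
    by move=> k; rewrite inE/= => /SE.
  exact: measurable_funS mG.
have -> : (\int[mu]_(k in `]h1, h2[) S k = \int[mu]_k \int[mu]_y K (y, k))%E.
  rewrite integral_mkcond; apply: eq_integral => k _; rewrite patchE.
  case: ifPn; rewrite ?inE ?notin_setE/=; first exact: SE.
  move=> nk; transitivity (\int[mu]_(y in [set: R]) (0%:E : \bar R))%E.
    by rewrite integral0.
  apply: eq_integral => y _; rewrite KE.
  case: ifP => // /and5P[_ _ _ k1 /andP[k2 _]]; exfalso; apply: nk.
  by rewrite in_itv/= k1 k2.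
rewrite -(@fubini_tonelli _ _ _ _ R mu mu K)//.
have -> : (\int[mu]_y \int[mu]_k K (y, k) = \int[mu]_(y in ydom) \int[mu]_k K (y, k))%E.
  rewrite [RHS]integral_mkcond; apply: eq_integral => y _; rewrite patchE.
  case: ifPn; rewrite ?inE ?notin_setE// => ny.
  transitivity (\int[mu]_(k in [set: R]) (0%:E : \bar R))%E; last by rewrite integral0.
  apply: eq_integral => k _; rewrite KE.
  by case: ifP => // /and5P[? ? ? _ _]; exfalso; apply: ny; apply/and3P.
rewrite /vol -ge0_integralD//.
- by apply: eq_integral => y; rewrite inE; exact: slice.
- by move=> y Yy; rewrite lee_fin volI_ge0.
- apply: (measurable_funS measurableT) => //.
  by apply/measurable_EFinP; exact: measurable_volI.
- by move=> y _; apply: integral_ge0.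
- exact: (measurable_funS measurableT).
Qed.

Lemma rise_sweep (h1 h2 : R) : 0 < h1 -> h1 < h2 ->
  measurable_fun `]h1, h2[ rise /\
  (vol h1 + \int[mu]_(h in `]h1, h2[) rise h = vol_max h1 h2)%E.
Proof.
move=> h10 h12.
apply: (@sweepK h1 h2 (riseK h1 h2) rise_density (fun y h => h ^+ 2 * (1 - y / a) < 1)) => //.
- exact: measurable_riseK.
- by move=> q; exact: riseK_ge0.
- by move=> y; exact: riseK_slice.
Qed.

Lemma fall_sweep (h1 h2 : R) : 0 < h1 -> h1 < h2 ->
  measurable_fun `]h1, h2[ fall /\
  (vol h2 + \int[mu]_(h in `]h1, h2[) fall h = vol_max h1 h2)%E.
Proof.
move=> h10 h12.
apply: (@sweepK h1 h2 (fallK h1 h2) fall_density (fun y h => 1 < h ^+ 2 * (1 - y / a))) => //.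
- exact: lt_trans h12.
- exact: measurable_fallK.
- by move=> q; exact: fallK_ge0.
- by move=> y; exact: fallK_slice.
Qed.

Lemma vol_max_finite (h1 h2 : R) : 0 < h1 -> h1 < h2 -> (vol_max h1 h2 < +oo)%E.
Proof.
move=> h10 h12; have mY := measurable_ordinates a0 b0.
apply: le_lt_trans (rectint_top_finite a0 a1 b0).
have [mr E] := rise_sweep h10 h12.
apply: ge0_le_integral => //.
- by move=> y Yy; rewrite lee_fin volI_ge0// peak_gt0.
- apply: (measurable_funS measurableT) => //; apply/measurable_EFinP.
  have mp : measurable_fun setT (peak h1 h2).
    apply: measurable_minr => //; apply: measurable_maxr => //.
    apply: measurable_funV; apply: measurable_fun_sqrt.
    by apply: measurable_funB => //; exact: measurable_funM.
  apply: measurable_fun_rectint.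
  + by apply: measurable_funB => //; exact: measurable_funX.
  + exact: measurable_width.
  + rewrite /height.
    have m3 : measurable_fun setT (fun y => peak h1 h2 y * (1 - y / a)).
      by apply: measurable_funM => //; apply: measurable_funB => //; exact: measurable_funM.
    apply: measurable_fun_ifT => //; first exact: measurable_fun_ler.
    by apply: measurable_minr => //; exact: measurable_funV.
- apply: (measurable_funS measurableT) => //; apply/measurable_EFinP.
  exact: measurable_rectint_top.
- by move=> y Yy; rewrite lee_fin volI_le// peak_gt0.
Qed.

Lemma vol_ge0 h : 0 < h -> (0 <= vol h)%E.
Proof. by move=> h0; apply: integral_ge0 => y Yy; rewrite lee_fin volI_ge0. Qed.

Lemma rise_ge0 h : 0 < h -> (0 <= rise h)%E.
Proof.
move=> h0; apply: integral_ge0 => y [/and3P[y0 ya _] /= hu].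
by rewrite lee_fin rise_density_ge0.
Qed.

Lemma fall_ge0 h : 0 < h -> (0 <= fall h)%E.
Proof.
move=> h0; apply: integral_ge0 => y [/and3P[y0 ya _] /= hu].
by rewrite lee_fin fall_density_ge0.
Qed.

(** A finite common total forces all four nonnegative terms to be finite; the comparison is then
    real arithmetic. *)
Lemma ereal_balance (v1 v2 i1 i2 M : \bar R) : (0 <= v1 -> 0 <= v2 -> 0 <= i1 ->
  0 <= i2 -> v1 + i1 = M -> v2 + i2 = M -> M < +oo ->
  [/\ i1 < +oo, i2 < +oo & i2 < i1 -> v1 < v2])%E.
Proof.
move=> v10 v20 i10 i20 e1 e2 fin.
have i1f : (i1 < +oo)%E by apply: le_lt_trans fin; rewrite -e1 leeDr.
have i2f : (i2 < +oo)%E by apply: le_lt_trans fin; rewrite -e2 leeDr.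
have v1f : (v1 < +oo)%E by apply: le_lt_trans fin; rewrite -e1 leeDl.
have v2f : (v2 < +oo)%E by apply: le_lt_trans fin; rewrite -e2 leeDl.
split => // lt.
move: lt e2; rewrite -e1.
have /fineK <- : v1 \is a fin_num by rewrite ge0_fin_numE.
have /fineK <- : v2 \is a fin_num by rewrite ge0_fin_numE.
have /fineK <- : i1 \is a fin_num by rewrite ge0_fin_numE.
have /fineK <- : i2 \is a fin_num by rewrite ge0_fin_numE.
by rewrite -!EFinD !lte_fin => lt [] e; lra.
Qed.

Lemma integral_rise_ge0 (h1 h2 : R) : 0 < h1 ->
  (0 <= \int[mu]_(h in `]h1, h2[) rise h)%E.
Proof.
move=> h10; apply: integral_ge0 => h /=; rewrite in_itv/= => /andP[/(lt_trans h10) hh _].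
exact: rise_ge0.
Qed.

Lemma integral_fall_ge0 (h1 h2 : R) : 0 < h1 ->
  (0 <= \int[mu]_(h in `]h1, h2[) fall h)%E.
Proof.
move=> h10; apply: integral_ge0 => h /=; rewrite in_itv/= => /andP[/(lt_trans h10) hh _].
exact: fall_ge0.
Qed.

Lemma vol_increasing (h1 h2 : R) : 0 < h1 -> h1 < h2 ->
  (forall h, h \in `]h1, h2[ -> (fall h < rise h)%E) -> (vol h1 < vol h2)%E.
Proof.
move=> h10 h12 fr; have h20 : 0 < h2 by exact: lt_trans h12.
have [mr rE] := rise_sweep h10 h12; have [mf fE] := fall_sweep h10 h12.
have [_ ifin] := ereal_balance (vol_ge0 h10) (vol_ge0 h20) (integral_rise_ge0 h2 h10)
  (integral_fall_ge0 h2 h10) rE fE (vol_max_finite h10 h12).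
apply; apply: lt_integral_itv => // h; rewrite in_itv/= => /andP[/(lt_trans h10) hh _].
exact: fall_ge0.
Qed.

Lemma vol_decreasing (h1 h2 : R) : 0 < h1 -> h1 < h2 ->
  (forall h, h \in `]h1, h2[ -> (rise h < fall h)%E) -> (vol h2 < vol h1)%E.
Proof.
move=> h10 h12 fr; have h20 : 0 < h2 by exact: lt_trans h12.
have [mr rE] := rise_sweep h10 h12; have [mf fE] := fall_sweep h10 h12.
have [_ ifin] := ereal_balance (vol_ge0 h20) (vol_ge0 h10) (integral_fall_ge0 h2 h10)
  (integral_rise_ge0 h2 h10) fE rE (vol_max_finite h10 h12).
apply; apply: lt_integral_itv => // h; rewrite in_itv/= => /andP[/(lt_trans h10) hh _].
exact: rise_ge0.
Qed.

End Sweep.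

(** * Primitives of the face integrals *)

Section Evaluation.
Variables (R : realType) (a b h : R).
Hypotheses (a0 : 0 < a) (a1 : a < 1) (b0 : 0 < b) (h1 : 1 < h).
Notation mu := (@lebesgue_measure R).
Local Notation wid := (width a b).
Local Notation rr := (rsq a b).
Local Notation ydom := (ordinates a b).
Local Notation riseI := (rise_density a b).
Local Notation fallI := (fall_density a b).

(* The slice is bounded by the plane of P0 P2 P3 or by the polar plane of P0. *)
Definition side_diag (y : R) : R := b * y / a.
Definition side_polar (y : R) : R := (1 - a * y) / b.
(* 1 - y ^+ 2 - z ^+ 2 on the polar plane z = 1 / h of P3, resp. on the face
   z = h (1 - y / a); the two planes meet at the ordinate ycrit. *)
Definition disc_fall (y : R) : R := 1 - y ^+ 2 - h ^- 2.
Definition disc_rise (y : R) : R := 1 - y ^+ 2 - (h * (1 - y / a)) ^+ 2.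
Definition ycrit : R := a * (1 - h ^- 2).
(** The K of Schlaefli's formula. Divided by [a ^+ 2 + h ^+ 2], it is the squared radius of the disc
    that the plane of P0 P1 P3 cuts from the ball. *)
Definition kdet : R := a ^+ 2 + h ^+ 2 - a ^+ 2 * h ^+ 2.

Let h0 : 0 < h. Proof. exact: lt_trans h1. Qed.
Let r0 : 0 < rr. Proof. exact: rsq_gt0. Qed.
Let h2 : 1 < h ^+ 2. Proof. by rewrite expr_gt1// ltW. Qed.
Let hV0 : 0 < h ^- 2. Proof. by rewrite invr_gt0 exprn_gt0. Qed.
Let hV1 : h ^- 2 < 1. Proof. by rewrite invf_lt1 ?exprn_gt0. Qed.
Let crit0 : 0 < ycrit. Proof. by rewrite mulr_gt0// subr_gt0. Qed.
Let crita : ycrit < a. Proof. by rewrite -[ltRHS]mulr1 ltr_pM2l// ltrBlDr ltrDl. Qed.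
Let K0 : 0 < kdet.
Proof.
rewrite (_ : kdet = a ^+ 2 + h ^+ 2 * (1 - a ^+ 2)); last by rewrite /kdet; ring.
by rewrite addr_gt0 ?mulr_gt0 ?exprn_gt0 ?(onem_sqr_gt0 a0 a1).
Qed.

(** Strict inclusion in the ball is wanted up to the ends of the pieces of integration. It has two
    sources: [z2] lies strictly below [1 - y / a], or y avoids both zeros, 0 and [a / rr], of the
    factored difference in [width_ball]. *)
Lemma diag_ball y z2 : 0 <= y -> rr * y <= a -> z2 <= 1 - y / a ->
  (z2 < 1 - y / a) || ((0 < y) && (rr * y < a)) -> side_diag y ^+ 2 < 1 - y ^+ 2 - z2.
Proof.
move=> y0 ry zu strict.
have E : side_diag y ^+ 2 = 1 - y ^+ 2 - (1 - y / a) - y / a ^+ 2 * (a - rr * y).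
  by rewrite /side_diag /rsq; field; rewrite gt_eqF.
have p0 : 0 <= y / a ^+ 2 by rewrite divr_ge0 ?sqr_ge0.
have q0 : 0 <= y / a ^+ 2 * (a - rr * y) by rewrite mulr_ge0// subr_ge0.
case/orP: strict => [?|/andP[y1 ry1]]; first by lra.
have : 0 < y / a ^+ 2 * (a - rr * y) by rewrite mulr_gt0 ?divr_gt0 ?exprn_gt0 ?subr_gt0.
lra.
Qed.

Lemma polar_ball y z2 : y <= a -> a <= rr * y -> z2 <= 1 - y / a ->
  (z2 < 1 - y / a) || (a < rr * y) -> side_polar y ^+ 2 < 1 - y ^+ 2 - z2.
Proof.
move=> ya ry zu strict.
have E : side_polar y ^+ 2 = 1 - y ^+ 2 - (1 - y / a) - (rr * y - a) * (1 - a * y) / (a * b ^+ 2).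
  by rewrite /side_polar /rsq; field; rewrite !gt_eqF.
have ay : 0 < 1 - a * y.
  have : a * y <= a ^+ 2 by rewrite expr2 ler_pM2l.
  by have := onem_sqr_gt0 a0 a1; lra.
have ab : 0 < a * b ^+ 2 by rewrite mulr_gt0 ?exprn_gt0.
have q0 : 0 <= (rr * y - a) * (1 - a * y) / (a * b ^+ 2).
  by rewrite divr_ge0 ?(ltW ab)// mulr_ge0 ?(ltW ay)// subr_ge0.
case/orP: strict => [?|ry1]; first by lra.
have : 0 < (rr * y - a) * (1 - a * y) / (a * b ^+ 2).
  by rewrite divr_gt0 ?mulr_gt0 ?(subr_gt0 a).
lra.
Qed.

Lemma fall_z y : y <= ycrit -> h ^- 2 <= 1 - y / a.
Proof.
move=> yc; have : y / a <= 1 - h ^- 2 by rewrite ler_pdivrMr// mulrC.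
lra.
Qed.

Lemma fall_zlt y : y < ycrit -> h ^- 2 < 1 - y / a.
Proof.
move=> yc; have : y / a < 1 - h ^- 2 by rewrite ltr_pdivrMr// mulrC.
lra.
Qed.

Lemma rise_z y : ycrit <= y -> y <= a -> (h * (1 - y / a)) ^+ 2 <= 1 - y / a.
Proof.
move=> cy ya; have u0 : 0 <= 1 - y / a by rewrite subr_ge0 ler_pdivrMr ?mul1r.
have hu : 1 - y / a <= h ^- 2.
  by have : 1 - h ^- 2 <= y / a; [rewrite ler_pdivlMr// mulrC|lra].
rewrite exprMn (expr2 (1 - y / a)) mulrA ler_piMl//.
by rewrite mulrC -ler_pdivlMr ?exprn_gt0// mul1r.
Qed.

Lemma rise_zlt y : ycrit < y -> y < a -> (h * (1 - y / a)) ^+ 2 < 1 - y / a.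
Proof.
move=> cy ya; have u0 : 0 < 1 - y / a by rewrite subr_gt0 ltr_pdivrMr ?mul1r.
have hu : 1 - y / a < h ^- 2.
  by have : 1 - h ^- 2 < y / a; [rewrite ltr_pdivlMr// mulrC|lra].
rewrite exprMn (expr2 (1 - y / a)) mulrA gtr_pMl//.
by rewrite mulrC -ltr_pdivlMr ?exprn_gt0// mul1r.
Qed.

(** [y / (h ^+ 2 - 1)] is the affine numerator for which the weight in [is_derive_artq_wronskian] is
    [h ^- 2], the factor of [fall_density]. *)
Definition prim_fall (X : R -> R) (y : R) : R :=
  y / (h ^+ 2 - 1) / (2 * Num.sqrt (disc_fall y)) * artq (disc_fall y) (X y).

(** This affine numerator gives the weight [1 - y / a], the factor of [rise_density]. *)
Definition prim_rise (X : R -> R) (y : R) : R :=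
  - (a * (1 - a * y) / kdet) / (2 * Num.sqrt (disc_rise y)) * artq (disc_rise y) (X y).

Lemma is_derive_disc_fall (y : R) : is_derive y 1 disc_fall (- (2 * y)).
Proof.
rewrite /disc_fall; apply: is_derive_eq; rewrite /GRing.scale/=; ring.
Qed.

Lemma is_derive_disc_rise (y : R) : is_derive y 1 disc_rise (- (2 * y) + 2 * h ^+ 2 * (1 - y / a) / a).
Proof.
rewrite /disc_rise; apply: is_derive_eq; rewrite /GRing.scale/=; ring.
Qed.

Lemma is_derive_prim_fall (X : R -> R) (x' y : R) : is_derive y 1 X x' -> X y ^+ 2 < disc_fall y ->
  is_derive y 1 (prim_fall X) (h ^- 2 * segint (disc_fall y) (X y) -
    (X y - y * x') / (h ^+ 2 - 1) / (2 * (disc_fall y - X y ^+ 2))).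
Proof.
move=> dX XD; have dD := is_derive_disc_fall y.
have hn : h ^+ 2 - 1 != 0 by rewrite gt_eqF// subr_gt0.
have dN : is_derive y 1 (fun y : R => y / (h ^+ 2 - 1)) (h ^+ 2 - 1)^-1.
  by apply: is_derive_eq; rewrite /GRing.scale/=; ring.
have -> : (X y - y * x') / (h ^+ 2 - 1) / (2 * (disc_fall y - X y ^+ 2)) =
  (X y * (h ^+ 2 - 1)^-1 - y / (h ^+ 2 - 1) * x') / (2 * (disc_fall y - X y ^+ 2)).
  by congr (_ / _); ring.
apply: (@is_derive_artq_wronskian R disc_fall (fun y => y / (h ^+ 2 - 1)) X) => //.
by rewrite /disc_fall; field; rewrite hn gt_eqF.
Qed.

Lemma is_derive_prim_rise (X : R -> R) (x' y : R) : is_derive y 1 X x' -> X y ^+ 2 < disc_rise y ->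
  is_derive y 1 (prim_rise X) ((1 - y / a) * segint (disc_rise y) (X y) -
    (X y * a + (1 - a * y) * x') * a / kdet / (2 * (disc_rise y - X y ^+ 2))).
Proof.
move=> dX XD; have dD := is_derive_disc_rise y.
have hn : kdet != 0 by rewrite gt_eqF.
have dN : is_derive y 1 (fun y : R => - (a * (1 - a * y) / kdet)) (a ^+ 2 / kdet).
  by apply: is_derive_eq; rewrite /GRing.scale/=; ring.
have -> : (X y * a + (1 - a * y) * x') * a / kdet / (2 * (disc_rise y - X y ^+ 2)) =
  (X y * (a ^+ 2 / kdet) - (- (a * (1 - a * y) / kdet)) * x') / (2 * (disc_rise y - X y ^+ 2)).
  by congr (_ / _); ring.
apply: (@is_derive_artq_wronskian R disc_rise (fun y => - (a * (1 - a * y) / kdet)) X) => //.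
have E : a ^+ 2 * disc_rise y + a * (1 - a * y) * (- (2 * y) + 2 * h ^+ 2 * (1 - y / a) / a) / 2 =
    (1 - y / a) * kdet by rewrite /disc_rise /kdet; field; rewrite gt_eqF.
rewrite -[RHS](mulfK hn) -E; ring.
Qed.

Lemma is_derive_side_diag (y : R) : is_derive y 1 side_diag (b / a).
Proof. by rewrite /side_diag; apply: is_derive_eq; rewrite /GRing.scale/=; ring. Qed.

Lemma is_derive_side_polar (y : R) : is_derive y 1 side_polar (- (a / b)).
Proof. by rewrite /side_polar; apply: is_derive_eq; rewrite /GRing.scale/=; ring. Qed.

(** [side_diag] is proportional to the numerator [y], so the Wronskian vanishes. Geometrically, the
    face P0 P2 P3 passes through P3 and is orthogonal to the polar plane of P3: their common edge
    keeps a right angle. *)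
Lemma is_derive_prim_fall_diag (y : R) : side_diag y ^+ 2 < disc_fall y ->
  is_derive y 1 (prim_fall side_diag) (h ^- 2 * segint (disc_fall y) (side_diag y)).
Proof.
move=> XD; have := is_derive_prim_fall (is_derive_side_diag y) XD.
suff -> : side_diag y - y * (b / a) = 0 by rewrite !mul0r subr0.
by rewrite /side_diag; ring.
Qed.

(** [side_polar] is proportional to the numerator [1 - a * y]. Again this is orthogonality: the face
    P0 P1 P3 passes through P0. *)
Lemma is_derive_prim_rise_polar (y : R) : side_polar y ^+ 2 < disc_rise y ->
  is_derive y 1 (prim_rise side_polar) ((1 - y / a) * segint (disc_rise y) (side_polar y)).
Proof.
move=> XD; have := is_derive_prim_rise (is_derive_side_polar y) XD.
suff -> : side_polar y * a + (1 - a * y) * - (a / b) = 0 by rewrite !mul0r subr0.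
by rewrite /side_polar; ring.
Qed.

(** Divided by [rr + h ^+ 2], this is the squared half-length of the chord that the line P0 P3 cuts
    from the ball; it is positive exactly when that line meets the ball. *)
Definition disc_edge : R := rr + h ^+ 2 - rr * h ^+ 2.
(** Affine coordinate on the line P0 P3, zero at the midpoint of its chord and scaled so that the
    sphere is met at plus or minus [Num.sqrt disc_edge]. Differences of
    [artq disc_edge (edge_coord y)] are hyperbolic lengths on that edge. *)
Definition edge_coord (y : R) : R := (rr + h ^+ 2) * (1 - y / a) - rr.

(* The last term carries the length of the edge P0 P3. *)
Definition prim_rise_diag (y : R) : R := prim_rise side_diag y - a * b / (2 * kdet * Num.sqrt disc_edge) * artq disc_edge (edge_coord y).

Lemma disc_rise_diag y : disc_rise y - side_diag y ^+ 2 = (disc_edge - edge_coord y ^+ 2) / (rr + h ^+ 2).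
Proof.
have rh : rr + h ^+ 2 != 0 by rewrite gt_eqF// addr_gt0// exprn_gt0.
move: rh; rewrite /disc_rise /side_diag /disc_edge /edge_coord /rsq => rh.
by field; rewrite rh gt_eqF.
Qed.

Lemma edge_coord_lt y : side_diag y ^+ 2 < disc_rise y -> edge_coord y ^+ 2 < disc_edge.
Proof.
rewrite -subr_gt0 disc_rise_diag pmulr_lgt0 ?subr_gt0//.
by rewrite invr_gt0 addr_gt0// exprn_gt0.
Qed.

Lemma is_derive_prim_rise_diag (y : R) : side_diag y ^+ 2 < disc_rise y ->
  is_derive y 1 prim_rise_diag ((1 - y / a) * segint (disc_rise y) (side_diag y)).
Proof.
move=> XD; have qs := edge_coord_lt XD.
have s0 : 0 < disc_edge by apply: le_lt_trans qs; exact: sqr_ge0.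
have d1 := is_derive_prim_rise (is_derive_side_diag y) XD.
have dq : is_derive y 1 edge_coord (- (rr + h ^+ 2) / a).
  by rewrite /edge_coord; apply: is_derive_eq; rewrite /GRing.scale/=; ring.
have dS : is_derive y 1 (fun _ : R => disc_edge) 0 by exact: is_derive_cst.
have d2 := is_derive_artq dS dq qs.
have -> : prim_rise_diag = prim_rise side_diag - (a * b / (2 * kdet * Num.sqrt disc_edge)) \*: (fun y => artq disc_edge (edge_coord y)).
  by apply/funext => x; rewrite /prim_rise_diag.
apply: is_derive_eq; rewrite /GRing.scale/= disc_rise_diag.
set s := Num.sqrt disc_edge.
have s1 : 0 < s by rewrite sqrtr_gt0.
have sE : disc_edge = s ^+ 2 by rewrite sqr_sqrtr// ltW.
have -> : side_diag y * a + (1 - a * y) * (b / a) = b / a by rewrite /side_diag; field; rewrite gt_eqF.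
move: (segint _ _) => S.
rewrite sE in qs *.
have rh : 0 < rr + h ^+ 2 by rewrite addr_gt0// exprn_gt0.
by field; rewrite !gt_eqF// subr_gt0.
Qed.

(** Divided by [rr * b ^+ 2], this is the squared half-length of the chord in which the planes
    [z = h^-1] and [b * x + a * y = 1] meet; [rr * y - a] is the matching coordinate, zero at the
    midpoint. *)
Definition disc_polar : R := b ^+ 2 * (rr * (1 - h ^- 2) - 1).

(* The last term carries the edge shared by the two polar planes (Lambert cube). *)
Definition prim_fall_polar (y : R) : R :=
  prim_fall side_polar y + b / (2 * (h ^+ 2 - 1) * Num.sqrt disc_polar) * artq disc_polar (rr * y - a).

Lemma disc_fall_polar y : disc_fall y - side_polar y ^+ 2 = (disc_polar - (rr * y - a) ^+ 2) / (rr * b ^+ 2).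
Proof.
have rh : rr != 0 by rewrite gt_eqF.
move: rh; rewrite /disc_fall /side_polar /disc_polar /rsq => rh.
by field; rewrite rh !gt_eqF.
Qed.

Lemma disc_polar_gt y : side_polar y ^+ 2 < disc_fall y -> (rr * y - a) ^+ 2 < disc_polar.
Proof.
rewrite -subr_gt0 disc_fall_polar pmulr_lgt0 ?subr_gt0//.
by rewrite invr_gt0 mulr_gt0// exprn_gt0.
Qed.

Lemma is_derive_prim_fall_polar (y : R) : side_polar y ^+ 2 < disc_fall y ->
  is_derive y 1 prim_fall_polar (h ^- 2 * segint (disc_fall y) (side_polar y)).
Proof.
move=> XD; have qs := disc_polar_gt XD.
have s0 : 0 < disc_polar by apply: le_lt_trans qs; exact: sqr_ge0.
have d1 := is_derive_prim_fall (is_derive_side_polar y) XD.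
have dq : is_derive y 1 (fun y : R => rr * y - a) rr.
  by apply: is_derive_eq; rewrite /GRing.scale/=; ring.
have dS : is_derive y 1 (fun _ : R => disc_polar) 0 by exact: is_derive_cst.
have d2 := is_derive_artq dS dq qs.
have -> : prim_fall_polar = prim_fall side_polar + (b / (2 * (h ^+ 2 - 1) * Num.sqrt disc_polar)) \*: (fun y => artq disc_polar (rr * y - a)).
  by apply/funext => x; rewrite /prim_fall_polar.
apply: is_derive_eq; rewrite /GRing.scale/= disc_fall_polar.
set s := Num.sqrt disc_polar.
have s1 : 0 < s by rewrite sqrtr_gt0.
have sE : disc_polar = s ^+ 2 by rewrite sqr_sqrtr// ltW.
have -> : side_polar y - y * - (a / b) = b^-1 by rewrite /side_polar; field; rewrite gt_eqF.
move: (segint _ _) => S.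
rewrite sE in qs *.
have hn : 0 < h ^+ 2 - 1 by rewrite subr_gt0.
by field; rewrite !gt_eqF// subr_gt0.
Qed.

Lemma FTC_segint (w D X F : R -> R) (x1 x2 : R) : x1 < x2 ->
  (forall y : R, derivable w y 1) -> (forall y : R, derivable D y 1) -> (forall y : R, derivable X y 1) ->
  {in `]x1, x2[, forall y, 0 <= w y} -> {in `]x1, x2[, forall y, 0 <= X y} ->
  (forall y, x1 <= y <= x2 -> X y ^+ 2 < D y) ->
  (forall y : R, x1 <= y <= x2 -> is_derive y 1 F (w y * segint (D y) (X y))) ->
  (\int[mu]_(y in `]x1, x2[) (w y * segint (D y) (X y))%:E = (F x2 - F x1)%:E)%E.
Proof.
move=> x12 dw dD dX w0 X0 XD dF.
have oc y : y \in `]x1, x2[ -> x1 <= y <= x2.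
  by rewrite in_itv/= => /andP[/ltW -> /ltW ->].
have cF y : x1 <= y <= x2 -> {for y, continuous F}.
  move=> yx; apply/differentiable_continuous/derivable1_diffP.
  by have ? := dF y yx; exact: ex_derive.
apply: (@ge0_FTC2_oo R (fun y => w y * segint (D y) (X y)) F x1 x2 _ _ x12).
- by move=> y yx; rewrite mulr_ge0 ?w0// segint_ge0 ?X0// XD// oc.
- move=> y yx; apply: continuousM.
    by apply/differentiable_continuous/derivable1_diffP; exact: dw.
  by apply: segint_cont; [exact: dD|exact: dX|apply: XD; exact: oc].
- by move=> y yx; apply: dF; exact: oc.
- by apply: cvg_at_right_filter; apply: cF; rewrite lexx ltW.
- by apply: cvg_at_left_filter; apply: cF; rewrite lexx ltW.
Qed.

Lemma fall_piece (X F : R -> R) (x1 x2 : R) : x1 < x2 -> 0 <= x1 -> x2 <= ycrit ->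
  (forall y : R, derivable X y 1) ->
  (forall y, x1 < y < x2 -> wid y = X y) ->
  (forall y, x1 <= y <= x2 -> X y ^+ 2 < disc_fall y) ->
  (forall y : R, X y ^+ 2 < disc_fall y -> is_derive y 1 F (h ^- 2 * segint (disc_fall y) (X y))) ->
  (\int[mu]_(y in `]x1, x2[) (fallI y h)%:E = (F x2 - F x1)%:E)%E.
Proof.
move=> x12 x10 x2c dX wX XD dF.
have -> : (\int[mu]_(y in `]x1, x2[) (fallI y h)%:E =
   \int[mu]_(y in `]x1, x2[) ((fun=> h ^- 2) y * segint (disc_fall y) (X y))%:E)%E.
  by apply: eq_integral => y; rewrite inE/= in_itv/= => /wX E; rewrite /fall_density E.
apply: FTC_segint => //.
- by move=> y _; exact: ltW.
- move=> y; rewrite in_itv/= => yx; rewrite -wX// ltW// width_gt0//; have := crita; have := crit0; lra.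
- by move=> y yx; apply: dF; exact: XD.
Qed.

Lemma rise_piece (X F : R -> R) (x1 x2 : R) : x1 < x2 -> ycrit <= x1 -> x2 <= a ->
  (forall y : R, derivable X y 1) ->
  (forall y, x1 < y < x2 -> wid y = X y) ->
  (forall y, x1 <= y <= x2 -> X y ^+ 2 < disc_rise y) ->
  (forall y : R, X y ^+ 2 < disc_rise y -> is_derive y 1 F ((1 - y / a) * segint (disc_rise y) (X y))) ->
  (\int[mu]_(y in `]x1, x2[) (riseI y h)%:E = (F x2 - F x1)%:E)%E.
Proof.
move=> x12 x1c x2a dX wX XD dF.
have -> : (\int[mu]_(y in `]x1, x2[) (riseI y h)%:E =
   \int[mu]_(y in `]x1, x2[) ((fun y : R => 1 - y / a) y * segint (disc_rise y) (X y))%:E)%E.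
  by apply: eq_integral => y; rewrite inE/= in_itv/= => /wX E; rewrite /rise_density E.
apply: FTC_segint => //.
- move=> y; rewrite in_itv/= => /andP[_ yx]; rewrite subr_ge0 ler_pdivrMr// mul1r; lra.
- move=> y; rewrite in_itv/= => yx; rewrite -wX// ltW// width_gt0//; have := crita; have := crit0; lra.
- by move=> y yx; apply: dF; exact: XD.
Qed.

Lemma derivable_side_diag (y : R) : derivable side_diag y 1.
Proof. by have ? := is_derive_side_diag y; exact: ex_derive. Qed.

Lemma derivable_side_polar (y : R) : derivable side_polar y 1.
Proof. by have ? := is_derive_side_polar y; exact: ex_derive. Qed.

Lemma fallE : fall a b h =
  (\int[mu]_(y in [set y : R | [&& 0 < y, y < ycrit & rr * y != a]%R]) (fallI y h)%:E)%E.
Proof.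
congr (integral _ _ _); apply/seteqP; split=> y /=.
  move=> [/and3P[-> ya ->] hu]; rewrite andbT/=.
  have : h ^- 2 < 1 - y / a by rewrite -[ltLHS]mul1r ltr_pdivrMr ?exprn_gt0// mulrC.
  move=> hy; have yv : y / a < 1 - h ^- 2 by lra.
  by rewrite /ycrit mulrC -ltr_pdivrMr.
move=> /and3P[y0 yc nr]; split; first by apply/and3P; split => //; exact: lt_trans crita.
by have := fall_zlt yc; rewrite -[ltLHS]mul1r ltr_pdivrMr ?exprn_gt0// mulrC.
Qed.

Lemma riseE : rise a b h =
  (\int[mu]_(y in [set y : R | [&& ycrit < y, y < a & rr * y != a]%R]) (riseI y h)%:E)%E.
Proof.
congr (integral _ _ _); apply/seteqP; split=> y /=.
  move=> [/and3P[y0 -> ->] hu]; rewrite andbT/=.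
  have : 1 - y / a < h ^- 2 by rewrite -[ltRHS]mul1r ltr_pdivlMr ?exprn_gt0// mulrC.
  move=> hy; have yv : 1 - h ^- 2 < y / a by lra.
  by rewrite andbT /ycrit mulrC -ltr_pdivlMr.
move=> /and3P[yc ya nr]; split; first by apply/and3P; split => //; exact: lt_trans yc.
have yc' : 1 - h ^- 2 < y / a by rewrite ltr_pdivlMr// mulrC.
have : 1 - y / a < h ^- 2 by lra.
by rewrite -[ltRHS]mul1r ltr_pdivlMr ?exprn_gt0// mulrC.
Qed.

Lemma measurable_fall_density : measurable_fun setT (fun y : R => (fallI y h)%:E).
Proof.
apply/measurable_EFinP; apply: measurable_funM => //.
apply: measurable_fun_segint; last exact: measurable_width.
by apply: measurable_funB => //; apply: measurable_funB => //; exact: measurable_funX.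
Qed.

Lemma measurable_rise_density : measurable_fun setT (fun y : R => (riseI y h)%:E).
Proof.
have mu1 : measurable_fun setT (fun y : R => 1 - y / a).
  by apply: measurable_funB => //; exact: measurable_funM.
apply/measurable_EFinP; apply: measurable_funM => //.
apply: measurable_fun_segint; last exact: measurable_width.
apply: measurable_funB; first by apply: measurable_funB => //; exact: measurable_funX.
by apply: measurable_funX; exact: measurable_funM.
Qed.

End Evaluation.

(** * Values of the face integrals *)

Section Values.
Variables (R : realType) (a b h : R).
Hypotheses (a0 : 0 < a) (a1 : a < 1) (b0 : 0 < b) (h1 : 1 < h).
Notation mu := (@lebesgue_measure R).
Local Notation wid := (width a b).
Local Notation rr := (rsq a b).
Local Notation riseI := (rise_density a b).
Local Notation fallI := (fall_density a b).
Local Notation X1 := (side_diag a b).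
Local Notation X2 := (side_polar a b).
Local Notation DA := (disc_fall h).
Local Notation DB := (disc_rise a h).
Local Notation crit := (ycrit a h).
Local Notation KK := (kdet a h).
Local Notation PA := (prim_fall h).
Local Notation PB := (prim_rise a h).
Local Notation PB1 := (prim_rise_diag a b h).
Local Notation PA2 := (prim_fall_polar a b h).
Local Notation ss := (disc_edge a b h).
Local Notation SS := (disc_polar a b h).
Local Notation qq := (edge_coord a b h).

Lemma gt1_gt0 : 0 < h. Proof. exact: lt_trans h1. Qed.
Lemma sqrB1_gt0 : 0 < h ^+ 2 - 1. Proof. by rewrite subr_gt0 expr_gt1// ltW// gt1_gt0. Qed.
Lemma invsq_gt0 : 0 < h ^- 2. Proof. by rewrite invr_gt0 exprn_gt0// gt1_gt0. Qed.
Lemma invsq_lt1 : h ^- 2 < 1.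
Proof. by rewrite invf_lt1 ?exprn_gt0 ?gt1_gt0// -subr_gt0 sqrB1_gt0. Qed.
Lemma ycrit_gt0 : 0 < crit. Proof. by rewrite mulr_gt0// subr_gt0 invsq_lt1. Qed.
Lemma ycrit_lt : crit < a.
Proof. by rewrite -[ltRHS]mulr1 ltr_pM2l// ltrBlDr ltrDl invsq_gt0. Qed.
Lemma kdet_gt0 : 0 < KK.
Proof.
rewrite (_ : KK = a ^+ 2 + h ^+ 2 * (1 - a ^+ 2)); last by rewrite /kdet; ring.
by rewrite addr_gt0 ?mulr_gt0 ?exprn_gt0 ?(onem_sqr_gt0 a0 a1)// gt1_gt0.
Qed.

(* Contribution of the edge where the face P0 P1 P3 meets the polar plane of P3:
   these planes being orthogonal, it cancels in rise - fall. *)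
Definition crit_edge (x : R) : R := a * h ^- 2 / (2 * Num.sqrt (DA crit)) * artq (DA crit) x.

(** The constant of Schlaefli's formula: up to a factor free of h, the hyperbolic length of the edge
    P0 P1, taken up to P0 for [x = b] and up to the polar plane of P0 for [x = (1 - a ^+ 2) / b]. *)
Definition base_edge (x : R) : R := a * Num.sqrt (1 - a ^+ 2) * artq (1 - a ^+ 2) x.

Lemma ycritE : 1 - crit / a = h ^- 2.
Proof. by rewrite /ycrit mulrAC divff ?gt_eqF// mul1r opprB addrCA subrr addr0. Qed.

Lemma disc_rise_ycrit : DB crit = DA crit.
Proof.
rewrite /disc_rise /disc_fall ycritE; congr (_ - _).
have hn : h != 0 by rewrite gt_eqF// gt1_gt0.
by field.
Qed.

Lemma prim_fall_ycrit X : PA X crit = crit_edge (X crit).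
Proof.
rewrite /prim_fall /crit_edge; congr (_ / _ * _).
have hn : h != 0 by rewrite gt_eqF// gt1_gt0.
have hn1 : h ^+ 2 - 1 != 0 by rewrite gt_eqF// sqrB1_gt0.
by rewrite /ycrit; field; rewrite hn hn1.
Qed.

Lemma prim_rise_ycrit X : PB X crit = - crit_edge (X crit).
Proof.
rewrite /prim_rise /crit_edge disc_rise_ycrit.
have hn : h != 0 by rewrite gt_eqF// gt1_gt0.
have kn : KK != 0 by rewrite gt_eqF// kdet_gt0.
have E : a * (1 - a * crit) = a * h ^- 2 * KK.
  by rewrite /ycrit /kdet; field.
by rewrite E mulfK// !mulNr.
Qed.

Lemma prim_rise_top X : PB X a = - (base_edge (X a) / (2 * KK)).
Proof.
have DE : DB a = 1 - a ^+ 2 by rewrite /disc_rise divff ?gt_eqF// subrr mulr0 expr0n/= subr0.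
rewrite /prim_rise DE /base_edge.
have kn : KK != 0 by rewrite gt_eqF// kdet_gt0.
set s := Num.sqrt (1 - a ^+ 2).
have s0 : 0 < s by rewrite sqrtr_gt0 onem_sqr_gt0.
have -> : 1 - a * a = s ^+ 2 by rewrite sqr_sqrtr -?expr2// ltW// onem_sqr_gt0.
by move: (artq _ _) => A; field; rewrite kn gt_eqF.
Qed.

Lemma prim_fall0 X : PA X 0 = 0.
Proof. by rewrite /prim_fall !mul0r. Qed.

Lemma side_foot : X1 (a / rr) = X2 (a / rr).
Proof.
have rn : rr != 0 by rewrite gt_eqF// rsq_gt0.
rewrite /side_diag /side_polar; move: rn; rewrite /rsq => rn.
by field; rewrite rn !gt_eqF.
Qed.

Lemma edge_coord_ycrit : qq crit = ss * h ^- 2.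
Proof.
rewrite /edge_coord ycritE /disc_edge.
have hn : h != 0 by rewrite gt_eqF// gt1_gt0.
by field.
Qed.

Lemma edge_coord_top : qq a = - rr.
Proof. by rewrite /edge_coord divff ?gt_eqF// subrr mulr0 add0r. Qed.

Lemma edge_coord_foot : qq (a / rr) = - (ss / rr).
Proof.
have rn : rr != 0 by rewrite gt_eqF// rsq_gt0.
by rewrite /edge_coord /disc_edge; field; rewrite rn gt_eqF.
Qed.

Lemma artqN (D X : R) : artq D (- X) = - artq D X.
Proof. by rewrite /artq mulNr atanhN. Qed.

Lemma foot_gt0 : 0 < a / rr.
Proof. by rewrite divr_gt0// rsq_gt0. Qed.

Lemma lt_foot y : (rr * y < a) = (y < a / rr).
Proof. by rewrite ltr_pdivlMr ?rsq_gt0// mulrC. Qed.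

Lemma gt_foot y : (a < rr * y) = (a / rr < y).
Proof. by rewrite ltr_pdivrMr ?rsq_gt0// mulrC. Qed.

Lemma eq_foot y : (rr * y == a) = (y == a / rr).
Proof. by rewrite eq_le !leNgt lt_foot gt_foot -!leNgt -eq_le. Qed.

Lemma rr_foot : rr * (a / rr) = a.
Proof. by rewrite mulrC divfK// gt_eqF// rsq_gt0. Qed.

Lemma diag_ball_fall y : 0 <= y -> y <= crit -> rr * y <= a ->
  (y < crit) || (rr * y < a) -> X1 y ^+ 2 < DA y.
Proof.
move=> y0 yc ry st; apply: diag_ball => //; first exact: fall_z.
have [->|yn] := eqVneq y 0; first by rewrite mul0r subr0 invsq_lt1.
case/orP: st => [/(fall_zlt a0) -> //|->].
by rewrite andbT (lt_neqAle 0 y) eq_sym yn y0 orbT.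
Qed.

Lemma diag_ball_rise y : crit <= y -> y <= a -> rr * y <= a ->
  (rr * y < a) || ((crit < y) && (y < a)) -> X1 y ^+ 2 < DB y.
Proof.
move=> cy ya ry st; have y0 : 0 < y by apply: lt_le_trans ycrit_gt0 cy.
apply: diag_ball => //; [exact: ltW|exact: rise_z|].
by case/orP: st => [->|/andP[? ?]]; [rewrite y0 orbT|rewrite rise_zlt].
Qed.

Lemma polar_ball_rise y : crit <= y -> y <= a -> a <= rr * y ->
  (a < rr * y) || ((crit < y) && (y < a)) -> X2 y ^+ 2 < DB y.
Proof.
move=> cy ya ry st.
apply: polar_ball => //; first exact: rise_z.
by case/orP: st => [->|/andP[? ?]]; [rewrite orbT|rewrite rise_zlt].
Qed.

Lemma polar_ball_fall y : y <= crit -> a <= rr * y ->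
  (y < crit) || (a < rr * y) -> X2 y ^+ 2 < DA y.
Proof.
move=> yc ry st.
apply: polar_ball => //; [exact: le_trans (ltW ycrit_lt)|exact: fall_z|].
by case/orP: st => [/(fall_zlt a0) ->//|->]; rewrite orbT.
Qed.

Lemma integral_two_pieces (f : R -> R) (x1 x2 x3 v1 v2 : R) : x1 < x2 -> x2 < x3 ->
  measurable_fun setT (fun y : R => (f y)%:E) ->
  (forall y, x1 < y < x3 -> y != x2 -> 0 <= f y) ->
  (\int[mu]_(y in `]x1, x2[) (f y)%:E = v1%:E)%E ->
  (\int[mu]_(y in `]x2, x3[) (f y)%:E = v2%:E)%E ->
  (\int[mu]_(y in [set y : R | [&& x1 < y, y < x3 & y != x2]%R]) (f y)%:E = (v1 + v2)%:E)%E.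
Proof.
move=> x12 x23 mf f0 e1 e2.
have -> : [set y : R | [&& x1 < y, y < x3 & y != x2]] = `]x1, x2[ `|` `]x2, x3[.
  apply/seteqP; split=> y /=; rewrite !in_itv/=.
    move=> /and3P[l1 l2]; rewrite neq_lt => /orP[l3|l3]; [left|right]; apply/andP; split => //.
  case=> /andP[l1 l2]; apply/and3P; split => //.
  - exact: lt_trans x23.
  - by rewrite lt_eqF.
  - exact: lt_trans l1.
  - by rewrite gt_eqF.
rewrite ge0_integral_setU//.
- by rewrite e1 e2 EFinD.
- exact: measurable_funS mf.
- move=> y; rewrite /= !in_itv/= => -[/andP[l1 l2]|/andP[l1 l2]]; rewrite lee_fin f0//.
  + by rewrite l1 (lt_trans l2).
  + by rewrite lt_eqF.
  + by rewrite l2 (lt_trans x12).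
  + by rewrite gt_eqF.
- apply/disj_setPS => y [] /=; rewrite !in_itv/= => /andP[_ l1] /andP[l2 _].
  by have := lt_trans l1 l2; rewrite ltxx.
Qed.

(** The hypothesis puts all the sinking slices before the ordinate [a / rr], where [side_diag]
    bounds them. The primitive vanishes at 0, so only the term at [ycrit] is left. *)
Lemma fall_frustum : rr * crit < a -> fall a b h = (crit_edge (X1 crit))%:E.
Proof.
move=> rc; rewrite fallE//.
have ry y : 0 <= y -> y <= crit -> rr * y < a.
  by move=> y0 yc; apply: le_lt_trans rc; rewrite ler_pM2l ?rsq_gt0.
have -> : [set y : R | [&& 0 < y, y < crit & rr * y != a]] = `]0, crit[%classic.
  apply/seteqP; split=> y /=; rewrite in_itv/=; first by move=> /and3P[-> ->].
  by move=> /andP[y0 yc]; rewrite y0 yc lt_eqF// ry// ltW.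
have -> : crit_edge (X1 crit) = PA X1 crit - PA X1 0 by rewrite prim_fall0 subr0 prim_fall_ycrit.
apply: (fall_piece a0 a1 b0 h1 ycrit_gt0 (lexx _) (lexx _) (@derivable_side_diag _ a b)).
- move=> y /andP[y0 yc]; apply: width_diag => //; first exact: lt_trans ycrit_lt.
  by rewrite ltW// ry// ltW.
- move=> y /andP[y0 yc]; have yr := ry y y0 yc.
  by apply: diag_ball_fall => //; [exact: ltW|rewrite yr orbT].
- by move=> y; exact: is_derive_prim_fall_diag.
Qed.

(** The edge P0 P3 runs from the polar plane of P3, with coordinate [ss * h ^- 2], to P0, with
    coordinate [- rr]; the sum of the two [artq] is its length. *)
Lemma rise_ordinary : rr < 1 -> rise a b h =
  (crit_edge (X1 crit) + (a * b / Num.sqrt ss * (artq ss (ss * h ^- 2) + artq ss rr)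
     - base_edge b) / (2 * KK))%:E.
Proof.
move=> r1; rewrite riseE//.
have ry y : y <= a -> rr * y < a.
  move=> ya; apply: le_lt_trans (_ : rr * a < a); first by rewrite ler_pM2l ?rsq_gt0.
  by rewrite gtr_pMl.
have -> : [set y : R | [&& crit < y, y < a & rr * y != a]] = `]crit, a[%classic.
  apply/seteqP; split=> y /=; rewrite in_itv/=; first by move=> /and3P[-> ->].
  by move=> /andP[y0 yc]; rewrite y0 yc lt_eqF// ry// ltW.
rewrite [X in _ = X%:E](_ : _ = PB1 a - PB1 crit); last first.
  rewrite /prim_rise_diag prim_rise_top prim_rise_ycrit edge_coord_ycrit edge_coord_top artqN.
  have -> : X1 a = b by rewrite /side_diag mulfK// gt_eqF.
  have s0 : 0 < ss.
    rewrite /disc_edge (_ : _ - _ = rr + h ^+ 2 * (1 - rr)); last by ring.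
    by rewrite addr_gt0 ?rsq_gt0// mulr_gt0 ?exprn_gt0 ?gt1_gt0// subr_gt0.
  have s1 : 0 < Num.sqrt ss by rewrite sqrtr_gt0.
  by field; rewrite !gt_eqF// kdet_gt0.
apply: (rise_piece a0 a1 b0 h1 ycrit_lt (lexx _) (lexx _) (@derivable_side_diag _ a b)).
- by move=> y /andP[yc ya]; apply: width_diag => //; [exact: lt_trans ycrit_gt0 yc|rewrite ltW// ry// ltW].
- move=> y /andP[yc ya]; have yr := ry y ya.
  by apply: diag_ball_rise => //; [exact: ltW|rewrite yr].
- by move=> y; exact: is_derive_prim_rise_diag.
Qed.

Lemma rise_density_pos y : crit < y -> y < a -> 0 <= riseI y h.
Proof.
move=> cy ya; have y0 : 0 < y by exact: lt_trans ycrit_gt0 cy.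
have u0 : 0 < 1 - y / a by rewrite subr_gt0 ltr_pdivrMr ?mul1r.
rewrite mulr_ge0 ?(ltW u0)// segint_ge0 ?(ltW (width_gt0 a0 a1 b0 y0 ya))//.
by apply: width_ball_lt => //; exact: rise_zlt.
Qed.

Lemma fall_density_pos y : 0 < y -> y < crit -> 0 <= fallI y h.
Proof.
move=> y0 yc; have ya : y < a by exact: lt_trans ycrit_lt.
rewrite mulr_ge0 ?(ltW invsq_gt0)// segint_ge0 ?(ltW (width_gt0 a0 a1 b0 y0 ya))//.
by rewrite -exprVn; apply: width_ball_lt => //; rewrite exprVn; exact: fall_zlt.
Qed.

(** The edge P0 P3 now ends on the polar plane of P0, at ordinate [a / rr] and coordinate
    [- (ss / rr)]. The two side functions agree there, so the [prim_rise] terms of the two pieces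
    cancel. *)
Lemma rise_frustum : 1 < rr -> rr * crit < a -> rise a b h =
  (crit_edge (X1 crit) + (a * b / Num.sqrt ss * (artq ss (ss * h ^- 2) + artq ss (ss / rr))
     - base_edge ((1 - a ^+ 2) / b)) / (2 * KK))%:E.
Proof.
move=> r1 rc; rewrite riseE//.
have cf : crit < a / rr by rewrite -lt_foot.
have fa : a / rr < a by rewrite -gt_foot ltr_pMl.
have s0 : 0 < ss.
  have XD : X1 crit ^+ 2 < DB crit.
    by apply: diag_ball_rise; rewrite ?rc ?(ltW rc) ?(ltW ycrit_lt).
  by apply: le_lt_trans (edge_coord_lt a0 b0 h1 XD); exact: sqr_ge0.
have s1 : 0 < Num.sqrt ss by rewrite sqrtr_gt0.
have -> : [set y : R | [&& crit < y, y < a & rr * y != a]] =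
    [set y : R | [&& crit < y, y < a & y != a / rr]].
  by apply/seteqP; split=> y /=; rewrite eq_foot.
have p1 : (\int[mu]_(y in `]crit, (a / rr)%R[) (riseI y h)%:E = (PB1 (a / rr) - PB1 crit)%:E)%E.
  apply: (rise_piece a0 a1 b0 h1 cf (lexx _) (ltW fa) (@derivable_side_diag _ a b)).
  - move=> y /andP[cy yf]; apply: width_diag => //; [exact: lt_trans ycrit_gt0 cy|exact: lt_trans fa|].
    by rewrite ltW// lt_foot.
  - move=> y /andP[cy]; rewrite le_eqVlt => /predU1P[->|yf].
      by apply: diag_ball_rise; rewrite ?(ltW cf) ?(ltW fa) ?rr_foot// cf fa orbT.
    have yr : rr * y < a by rewrite lt_foot.
    apply: diag_ball_rise => //; [exact/ltW/(lt_trans yf)|exact: ltW|by rewrite yr].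
  - by move=> y; exact: is_derive_prim_rise_diag.
have p2 : (\int[mu]_(y in `](a / rr)%R, a[) (riseI y h)%:E = (PB X2 a - PB X2 (a / rr))%:E)%E.
  apply: (rise_piece a0 a1 b0 h1 fa (ltW cf) (lexx a) (@derivable_side_polar _ a b)).
  - move=> y /andP[fy ya]; apply: width_polar => //; first exact: lt_trans foot_gt0 fy.
    by rewrite ltW// gt_foot.
  - move=> y /andP[]; rewrite le_eqVlt => /predU1P[<-|fy] ya.
      by apply: polar_ball_rise; rewrite ?(ltW cf) ?(ltW fa) ?rr_foot// cf fa orbT.
    have yr : a < rr * y by rewrite gt_foot.
    apply: polar_ball_rise => //; [exact/ltW/(lt_trans cf)|exact: ltW|by rewrite yr].
  - by move=> y; exact: is_derive_prim_rise_polar.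
rewrite (integral_two_pieces cf fa _ _ p1 p2).
- congr _%:E; rewrite /prim_rise_diag prim_rise_top prim_rise_ycrit edge_coord_ycrit edge_coord_foot artqN.
  have -> : X2 a = (1 - a ^+ 2) / b by rewrite /side_polar expr2.
  have -> : PB X1 (a / rr) = PB X2 (a / rr) by rewrite /prim_rise side_foot.
  by field; rewrite !gt_eqF// kdet_gt0.
- exact: measurable_rise_density.
- by move=> y /andP[cy ya] _; exact: rise_density_pos.
Qed.

Lemma rise_lambert : 1 < rr -> a < rr * crit -> rise a b h =
  (crit_edge (X2 crit) - base_edge ((1 - a ^+ 2) / b) / (2 * KK))%:E.
Proof.
move=> r1 rc; rewrite riseE//.
have fc : a / rr < crit by rewrite -gt_foot.
have yr y : crit <= y -> a < rr * y.
  by move=> cy; rewrite gt_foot; exact: lt_le_trans cy.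
have -> : [set y : R | [&& crit < y, y < a & rr * y != a]] = `]crit, a[%classic.
  apply/seteqP; split=> y /=; rewrite in_itv/=; first by move=> /and3P[-> ->].
  by move=> /andP[y0 yc]; rewrite y0 yc gt_eqF// yr// ltW.
rewrite [X in _ = X%:E](_ : _ = PB X2 a - PB X2 crit); last first.
  rewrite prim_rise_top prim_rise_ycrit.
  have -> : X2 a = (1 - a ^+ 2) / b by rewrite /side_polar expr2.
  by ring.
apply: (rise_piece a0 a1 b0 h1 ycrit_lt (lexx _) (lexx _) (@derivable_side_polar _ a b)).
- move=> y /andP[cy ya]; apply: width_polar => //; first exact: lt_trans ycrit_gt0 cy.
  by rewrite ltW// yr// ltW.
- move=> y /andP[cy ya]; have ar := yr y cy.
  by apply: polar_ball_rise => //; [exact: ltW|rewrite ar].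
- by move=> y; exact: is_derive_prim_rise_polar.
Qed.

Lemma fall_lambert : 1 < rr -> a < rr * crit -> fall a b h =
  (crit_edge (X2 crit) + b / (2 * (h ^+ 2 - 1) * Num.sqrt SS) * artq SS (rr * crit - a))%:E.
Proof.
move=> r1 rc; rewrite fallE//.
have fc : a / rr < crit by rewrite -gt_foot.
have fa : a / rr < a by exact: lt_trans ycrit_lt.
have -> : [set y : R | [&& 0 < y, y < crit & rr * y != a]] =
    [set y : R | [&& 0 < y, y < crit & y != a / rr]].
  by apply/seteqP; split=> y /=; rewrite eq_foot.
have p1 : (\int[mu]_(y in `]0%R, (a / rr)%R[) (fallI y h)%:E = (PA X1 (a / rr) - PA X1 0)%:E)%E.
  apply: (fall_piece a0 a1 b0 h1 foot_gt0 (lexx _) (ltW fc) (@derivable_side_diag _ a b)).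
  - move=> y /andP[y0 yf]; apply: width_diag => //; first exact: lt_trans fa.
    by rewrite ltW// lt_foot.
  - move=> y /andP[y0 yf]; have yc := le_lt_trans yf fc.
    apply: diag_ball_fall => //; [exact: ltW| |by rewrite yc].
    by rewrite leNgt gt_foot -leNgt.
  - by move=> y; exact: is_derive_prim_fall_diag.
have p2 : (\int[mu]_(y in `](a / rr)%R, crit[) (fallI y h)%:E = (PA2 crit - PA2 (a / rr))%:E)%E.
  apply: (fall_piece a0 a1 b0 h1 fc (ltW foot_gt0) (lexx _) (@derivable_side_polar _ a b)).
  - move=> y /andP[fy yc]; apply: width_polar => //.
    + by apply: lt_trans fy; exact: foot_gt0.
    + exact: lt_trans ycrit_lt.
    + by rewrite ltW// gt_foot.
  - move=> y /andP[fy yc]; apply: polar_ball_fall => //; first by rewrite leNgt lt_foot -leNgt.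
    move: fy; rewrite le_eqVlt => /predU1P[<-|fy]; first by rewrite fc.
    by rewrite gt_foot fy orbT.
  - by move=> y; exact: is_derive_prim_fall_polar.
rewrite (integral_two_pieces foot_gt0 fc _ _ p1 p2).
- congr _%:E; rewrite /prim_fall_polar prim_fall_ycrit prim_fall0 rr_foot subrr.
  have -> : artq SS 0 = 0 by rewrite /artq mul0r atanh0.
  have -> : PA X1 (a / rr) = PA X2 (a / rr) by rewrite /prim_fall side_foot.
  by ring.
- exact: measurable_fall_density.
- by move=> y /andP[y0 yc] _; exact: fall_density_pos.
Qed.

(** [crit_edge] separates the two integrals: the edge P0 P3 is gone, so the rise falls short of it
    by the term of P0 P1, while the fall adds to it the nonnegative term of the edge shared by the
    polar planes. *)
Lemma lambert_decreasing : 1 < rr -> a < rr * crit -> (rise a b h < fall a b h)%E.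
Proof.
move=> r1 rc; rewrite rise_lambert// fall_lambert// lte_fin.
apply: (@lt_le_trans _ _ (crit_edge (X2 crit))).
  rewrite gtrDl oppr_lt0; apply: divr_gt0; last by rewrite mulr_gt0 ?kdet_gt0.
  have a2 := onem_sqr_gt0 a0 a1.
  apply: mulr_gt0; first by rewrite mulr_gt0// sqrtr_gt0.
  apply: artq_gt0; first by rewrite divr_gt0.
  rewrite expr_div_n ltr_pdivrMr ?exprn_gt0// expr2 ltr_pM2l//.
  by move: r1; rewrite /rsq; lra.
rewrite lerDl mulr_ge0//.
  by rewrite divr_ge0 ?(ltW b0)// mulr_ge0 ?sqrtr_ge0// mulr_ge0// ltW// sqrB1_gt0.
apply: artq_ge0; first by rewrite subr_ge0 ltW.
by apply: disc_polar_gt => //; apply: polar_ball_fall; rewrite ?lexx ?rc ?orbT// ltW.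
Qed.

End Values.

(** * The borderline case r = 1, where P0 is ideal *)

Section IdealVertex.
Variables (R : realType) (a b h : R).
Hypotheses (a0 : 0 < a) (a1 : a < 1) (b0 : 0 < b) (h1 : 1 < h).
Notation mu := (@lebesgue_measure R).
Local Notation rr := (rsq a b).
Local Notation X1 := (side_diag a b).
Local Notation DB := (disc_rise a h).
Local Notation crit := (ycrit a h).
Local Notation KK := (kdet a h).
Local Notation PB := (prim_rise a h).
Local Notation PB1 := (prim_rise_diag a b h).
Local Notation ss := (disc_edge a b h).
Local Notation qq := (edge_coord a b h).

(** Isolates the logarithm that diverges when [X ^+ 2] tends to [D]. *)
Lemma artqE (D X : R) : X ^+ 2 < D ->
  artq D X = ln (Num.sqrt D + X) - ln (D - X ^+ 2) / 2.
Proof.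
move=> XD; have [] := ratio_sqrt_itv XD.
have D0 : 0 < D by apply: le_lt_trans XD; exact: sqr_ge0.
have s0 : 0 < Num.sqrt D by rewrite sqrtr_gt0.
rewrite ltr_pdivlMr// ltr_pdivrMr// mulN1r mul1r => l1 l2.
have p0 : 0 < Num.sqrt D + X by lra.
have m0 : 0 < Num.sqrt D - X by lra.
have -> : D - X ^+ 2 = (Num.sqrt D + X) * (Num.sqrt D - X).
  by rewrite mulrC -subr_sqr sqr_sqrtr// ltW.
rewrite lnM ?posrE// /artq /atanh.
have -> : 1 + X / Num.sqrt D = (Num.sqrt D + X) / Num.sqrt D.
  by rewrite mulrDl divff// gt_eqF.
have -> : 1 - X / Num.sqrt D = (Num.sqrt D - X) / Num.sqrt D.
  by rewrite mulrBl divff// gt_eqF.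
by rewrite !ln_div ?posrE//; field.
Qed.

(** Bookkeeping for the cancellation at P0. [uu] is the factor of [disc_rise - side_diag ^+ 2] that
    vanishes there and [ee] the other one; [al] and [- al0] are the coefficients of [ln (uu y)] in
    [prim_rise] and in the edge term; [be] is the quotient of [al - al0] by [uu ^+ 2], and [Breg]
    the part continuous at a. *)
Let al (y : R) : R := a * (1 - a * y) / KK / (4 * Num.sqrt (DB y)).
Let al0 : R := a * b / (4 * KK).
Let be (y : R) : R := a / (4 * Num.sqrt (DB y) * ((1 - a * y) + b * Num.sqrt (DB y))).
Let uu (y : R) : R := 1 - y / a.
Let ee (y : R) : R := 2 - (1 + h ^+ 2) * uu y.
Let Breg (y : R) : R := - 2 * al y * ln (Num.sqrt (DB y) + X1 y) +
  (al y + al0) * ln (ee y) - al0 * ln (1 + h ^+ 2).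

(** Squeezed between [- uu y] and 0, because [- ln u < u^-1]. *)
Lemma usqlnu_cvg : (uu y ^+ 2 * ln (uu y)) @[y --> a^'-] --> (0 : R).
Proof.
have cu : uu y @[y --> a^'-] --> (0 : R).
  rewrite (_ : 0 = uu a); last by rewrite /uu divff ?subrr// gt_eqF.
  have cuu : {for a, continuous uu}.
    by rewrite /uu; apply/differentiable_continuous/derivable1_diffP; exact: ex_derive.
  exact: cvg_at_left_filter cuu.
apply: (@squeeze_cvgr _ _ _ _ (fun y => - uu y) (fun=> 0)).
- near=> y.
  have ya : y < a by near: y; exact: nbhs_left_lt.
  have y0 : 0 < y by near: y; exact: nbhs_left_gt.
  have u0 : 0 < uu y by rewrite subr_gt0 ltr_pdivrMr ?mul1r.
  have u1 : uu y < 1 by rewrite ltrBlDr ltrDl divr_gt0.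
  have l0 : ln (uu y) < 0 by rewrite ln_lt0// u0.
  have l1 : - ln (uu y) < (uu y)^-1.
    by rewrite -lnV ?posrE// ln_sublinear// invr_gt0.
  have l2 : uu y * (- ln (uu y)) <= 1.
    by rewrite -(divff (lt0r_neq0 u0)) ler_pM2l// ltW.
  apply/andP; split; last by rewrite pmulr_rle0 ?exprn_gt0// ltW.
  rewrite expr2 -mulrA -subr_ge0 opprK -[X in _ + X]mulr1 -mulrDr mulr_ge0 ?(ltW u0)//.
  lra.
- by rewrite -oppr0; exact: cvgN.
- exact: cvg_cst.
Unshelve. all: by end_near. Qed.

Lemma sqrt_disc_rise_cont : {for a, continuous (fun y : R => Num.sqrt (DB y))}.
Proof.
apply: (@continuous_comp _ _ _ DB (@Num.sqrt R)); last exact: sqrt_continuous.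
have ? := @is_derive_disc_rise R a h a.
by apply/differentiable_continuous/derivable1_diffP; exact: ex_derive.
Qed.

Hypothesis r1 : rr = 1.

Lemma b_sqrE : b ^+ 2 = 1 - a ^+ 2.
Proof. by move: r1; rewrite /rsq => <-; ring. Qed.

Lemma sqrt_disc_rise_top : Num.sqrt (DB a) = b.
Proof.
have -> : DB a = b ^+ 2.
  by rewrite b_sqrE /disc_rise divff ?gt_eqF// subrr mulr0 expr0n/= subr0.
by rewrite sqrtr_sqr gtr0_norm.
Qed.

Lemma disc_edge1 : ss = 1.
Proof. by rewrite /disc_edge r1; ring. Qed.

Lemma disc_rise_ideal y : DB y - X1 y ^+ 2 = uu y * ee y.
Proof.
rewrite disc_rise_diag// disc_edge1 /edge_coord r1 /ee /uu.
have hn : 1 + h ^+ 2 != 0 by rewrite gt_eqF// ltr_wpDr ?sqr_ge0.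
by field; rewrite hn gt_eqF.
Qed.

(** Both terms of [prim_rise_diag] diverge logarithmically at P0. The coefficients of the two
    logarithms agree up to order [uu y ^+ 2], which is enough to make the singular part tend to
    0. *)
Lemma prim_rise_diag_ideal y : crit < y -> y < a ->
  PB1 y = be y * (uu y ^+ 2 * ln (uu y)) + Breg y.
Proof.
move=> cy ya; have y0 := lt_trans (ycrit_gt0 a0 h1) cy.
have u0 : 0 < uu y by rewrite subr_gt0 ltr_pdivrMr ?mul1r.
have XD : X1 y ^+ 2 < DB y.
  by apply: diag_ball_rise => //; rewrite ?r1 ?mul1r ?ya// ltW.
have DX0 : 0 < uu y * ee y by rewrite -disc_rise_ideal subr_gt0.
have e0 : 0 < ee y by move: DX0; rewrite pmulr_rgt0.
have k0 := kdet_gt0 a0 a1 h1.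
have hh : 0 < 1 + h ^+ 2 by rewrite ltr_wpDr ?sqr_ge0.
have D0 : 0 < DB y by apply: le_lt_trans XD; exact: sqr_ge0.
set s := Num.sqrt (DB y).
have s0 : 0 < s by rewrite sqrtr_gt0.
have sE : s ^+ 2 = DB y by rewrite sqr_sqrtr// ltW.
have ay := onemM_gt0 a0 a1 ya.
have w0 : 0 < (1 - a * y) + b * s by rewrite addr_gt0// mulr_gt0.
(* Multiplication by the conjugate: as [b ^+ 2 = 1 - a ^+ 2], the difference of squares is exactly
   [uu y ^+ 2 * KK]. *)
have key : (1 - a * y) - b * s = uu y ^+ 2 * KK / ((1 - a * y) + b * s).
  apply: (canRL (mulfK (lt0r_neq0 w0))).
  rewrite -subr_sqr exprMn sE b_sqrE /uu /disc_rise /kdet; field.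
  by rewrite gt_eqF.
have E1 : al y - al0 = be y * uu y ^+ 2.
  rewrite /al /al0 /be -/s.
  rewrite (_ : _ - _ = a * ((1 - a * y) - b * s) / (4 * KK * s)); last first.
    by field; rewrite !gt_eqF.
  by rewrite key; field; rewrite !gt_eqF.
have PBE : PB X1 y = - 2 * al y * artq (DB y) (X1 y).
  by rewrite /prim_rise /al -/s; field; rewrite !gt_eqF.
rewrite /prim_rise_diag PBE artqE// -/s disc_rise_ideal lnM ?posrE// disc_edge1 sqrtr1.
have -> : artq 1 (qq y) = (ln (1 + h ^+ 2) + ln (uu y) - ln (ee y)) / 2.
  rewrite /artq sqrtr1 divr1 /atanh.
  have -> : 1 + qq y = (1 + h ^+ 2) * uu y by rewrite /edge_coord r1 /uu; ring.
  have -> : 1 - qq y = ee y by rewrite /edge_coord r1 /ee /uu; ring.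
  by rewrite lnM ?posrE.
rewrite (mulrA (be y)) -E1 /Breg -/s /al0; field.
by rewrite gt_eqF.
Qed.

Lemma prim_rise_diag_ideal_cvg :
  PB1 y @[y --> a^'-] --> - al0 * (2 * ln b + ln (1 + h ^+ 2)).
Proof.
have k0 := kdet_gt0 a0 a1 h1.
have cs := sqrt_disc_rise_cont.
have cc (c : R) : {for a, continuous (fun _ : R => c)} by exact: cvg_cst.
have cpoly : {for a, continuous (fun y : R => 1 - a * y)}.
  by apply/differentiable_continuous/derivable1_diffP; exact: ex_derive.
have cal : {for a, continuous al}.
  rewrite /al; apply: continuousM.
    by apply: continuousM; [apply: continuousM|].
  apply: continuousV; first by rewrite sqrt_disc_rise_top mulf_neq0// gt_eqF.
  exact: continuousM.
have cbe : {for a, continuous be}.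
  rewrite /be; apply: continuousM => //.
  apply: continuousV.
    rewrite sqrt_disc_rise_top mulf_neq0 ?mulf_neq0 ?gt_eqF// addr_gt0 ?mulr_gt0//.
    by rewrite -expr2 onem_sqr_gt0.
  apply: continuousM; first exact: continuousM.
  by apply: continuousD => //; exact: continuousM.
have lncont (f : R -> R) : 0 < f a -> {for a, continuous f} -> {for a, continuous (fun y => ln (f y))}.
  by move=> f0 cf; apply: (@continuous_comp _ _ _ f (@ln R)) => //; exact: continuous_ln.
have cX : {for a, continuous X1}.
  have ? := @is_derive_side_diag R a b a.
  by apply/differentiable_continuous/derivable1_diffP; exact: ex_derive.
have cee : {for a, continuous ee}.
  by rewrite /ee /uu; apply/differentiable_continuous/derivable1_diffP; exact: ex_derive.
have eea : ee a = 2 by rewrite /ee /uu divff ?gt_eqF// subrr mulr0 subr0.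
have X1a : X1 a = b by rewrite /side_diag mulfK// gt_eqF.
have cB : {for a, continuous Breg}.
  rewrite /Breg; apply: continuousB; last exact: cc.
  apply: continuousD; apply: continuousM.
  - exact: continuousM.
  - by apply: lncont; [rewrite sqrt_disc_rise_top X1a addr_gt0|exact: continuousD].
  - exact: continuousD.
  - by apply: lncont; rewrite ?eea.
have ala : al a = al0.
  rewrite /al /al0 sqrt_disc_rise_top -expr2 -b_sqrE; field.
  by rewrite !gt_eqF.
have Ba : Breg a = - al0 * (2 * ln b + ln (1 + h ^+ 2)).
  rewrite /Breg ala eea sqrt_disc_rise_top X1a (_ : b + b = 2 * b) ?lnM ?posrE//; last by ring.
  by ring.
rewrite -Ba -[X in _ --> X]add0r -(mulr0 (be a)).
apply: (@cvg_trans _ ((fun y => be y * (uu y ^+ 2 * ln (uu y)) + Breg y) @ a^'-)).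
  apply: near_eq_cvg; near=> y; apply/esym/prim_rise_diag_ideal.
    by near: y; apply: nbhs_left_gt; exact: ycrit_lt.
  by near: y; exact: nbhs_left_lt.
apply: cvgD; last exact: cvg_at_left_filter.
by apply: cvgM; [exact: cvg_at_left_filter|exact: usqlnu_cvg].
Unshelve. all: by end_near. Qed.

(** The two infinite lengths leave a finite difference, so the bracket in Schlaefli's formula
    becomes one logarithm, which changes sign at [h ^+ 2 = 1 + b ^- 2]. *)
Lemma rise_ideal : rise a b h =
  (crit_edge a h (X1 crit) - a * b / (4 * KK) * ln (b ^+ 2 * (h ^+ 2 - 1)))%:E.
Proof.
rewrite riseE//; have k0 := kdet_gt0 a0 a1 h1.
have ca := ycrit_lt a0 h1.
have hp := sqrB1_gt0 h1.
have -> : [set y : R | [&& crit < y, y < a & rr * y != a]] = `]crit, a[%classic.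
  apply/seteqP; split=> y /=; rewrite in_itv/=; first by move=> /and3P[-> ->].
  by move=> /andP[y0 yc]; rewrite y0 yc r1 mul1r lt_eqF.
have XD y : crit <= y -> y < a -> X1 y ^+ 2 < DB y.
  by move=> cy ya; apply: diag_ball_rise => //; rewrite ?r1 ?mul1r ?ya// ltW.
rewrite [X in _ = X%:E](_ : _ = - al0 * (2 * ln b + ln (1 + h ^+ 2)) - PB1 crit); last first.
  rewrite /prim_rise_diag prim_rise_ycrit// edge_coord_ycrit// disc_edge1 sqrtr1 mulr1 mul1r.
  have -> : artq 1 (h ^- 2) = (ln (1 + h ^+ 2) - ln (h ^+ 2 - 1)) / 2.
    have h20 : 0 < h ^+ 2 by rewrite exprn_gt0// (gt1_gt0 h1).
    rewrite /artq sqrtr1 divr1 /atanh.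
    have -> : 1 + h ^- 2 = (1 + h ^+ 2) / h ^+ 2 by rewrite mulrDl mul1r divff ?gt_eqF// addrC.
    have -> : 1 - h ^- 2 = (h ^+ 2 - 1) / h ^+ 2 by rewrite mulrBl mul1r divff ?gt_eqF.
    rewrite !ln_div ?posrE//; last by rewrite addr_gt0.
    by congr (_ / _); ring.
  rewrite lnM ?posrE ?exprn_gt0// lnXn// -mulr_natl /al0.
  by field; rewrite gt_eqF.
have -> : (\int[mu]_(y in `]crit, a[) (rise_density a b y h)%:E =
   \int[mu]_(y in `]crit, a[) ((1 - y / a) * segint (DB y) (X1 y))%:E)%E.
  apply: eq_integral => y; rewrite inE/= in_itv/= => /andP[cy ya].
  rewrite /rise_density width_diag//; first exact: lt_trans (ycrit_gt0 a0 h1) cy.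
  by rewrite r1 mul1r ltW.
have dD y := @is_derive_disc_rise R a h y.
apply: (@ge0_FTC2_oo R (fun y => (1 - y / a) * segint (DB y) (X1 y)) PB1 crit a _ _ ca).
- move=> y; rewrite in_itv/= => /andP[cy ya].
  have y0 := lt_trans (ycrit_gt0 a0 h1) cy.
  rewrite mulr_ge0// ?segint_ge0 ?XD ?(ltW cy)//.
    by rewrite subr_ge0 ler_pdivrMr// mul1r ltW.
  by rewrite divr_ge0 ?mulr_ge0 ?ltW.
- move=> y; rewrite in_itv/= => /andP[cy ya]; apply: continuousM.
    by apply/differentiable_continuous/derivable1_diffP; exact: ex_derive.
  apply: segint_cont; [|exact: derivable_side_diag|by apply: XD => //; exact: ltW].
  by have ? := dD y; exact: ex_derive.
- by move=> y; rewrite in_itv/= => /andP[cy ya]; apply: is_derive_prim_rise_diag => //; apply: XD => //; exact: ltW.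
- apply: cvg_at_right_filter.
  have ? := is_derive_prim_rise_diag a0 a1 b0 h1 (XD crit (lexx _) ca).
  by apply/differentiable_continuous/derivable1_diffP; exact: ex_derive.
- exact: prim_rise_diag_ideal_cvg.
Qed.

End IdealVertex.

(** * The turning point *)

Section AtanhGrowth.
Variable R : realType.

(** Convexity: by the mean value theorem, the slopes of [atanh] over [0, x] and [x, y] are values of
    the increasing derivative at two ordered points. *)
Lemma atanh_ratio_le (x y : R) : 0 < x -> x <= y -> y < 1 -> atanh x / x <= atanh y / y.
Proof.
move=> x0; rewrite le_eqVlt => /predU1P[->//|xy y1].
have der (z : R) : -1 < z -> z < 1 -> is_derive z 1 (@atanh R) (1 - z ^+ 2)^-1.
  exact: is_derive_atanh.
have cont (z : R) : -1 < z -> z < 1 -> {for z, continuous (@atanh R)}.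
  move=> z1 z2; have ? := der z z1 z2.
  by apply/differentiable_continuous/derivable1_diffP; exact: ex_derive.
have mvt (p q : R) : 0 <= p -> p < q -> q < 1 ->
    exists2 c, c \in `]p, q[ & atanh q - atanh p = (1 - c ^+ 2)^-1 * (q - p).
  move=> p0 pq q1; apply: (@MVT R (@atanh R) (fun z => (1 - z ^+ 2)^-1) p q pq).
    by move=> z; rewrite in_itv/= => /andP[? ?]; apply: der; lra.
  apply: continuous_in_subspaceT => z; rewrite inE/= in_itv/= => /andP[? ?].
  by apply: cont; lra.
have [c1 /[!in_itv]/= /andP[c10 c1x] E1] := mvt 0 x (lexx _) x0 (lt_trans xy y1).
have [c2 /[!in_itv]/= /andP[xc2 c2y] E2] := mvt x y (ltW x0) xy y1.
move: E1; rewrite atanh0 !subr0 => E1.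
have k : (1 - c1 ^+ 2)^-1 <= (1 - c2 ^+ 2)^-1.
  by rewrite lef_pV2 ?posrE; nra.
have y0 : 0 < y by lra.
rewrite E1 mulfK ?gt_eqF// ler_pdivlMr//.
have -> : atanh y = (1 - c2 ^+ 2)^-1 * (y - x) + (1 - c1 ^+ 2)^-1 * x by rewrite -E2 -E1; ring.
have : (1 - c1 ^+ 2)^-1 * (y - x) <= (1 - c2 ^+ 2)^-1 * (y - x).
  by apply: ler_wpM2r => //; lra.
lra.
Qed.

Lemma atanh_unbounded (M : R) : exists p : R, [/\ 1 / 2 <= p, p < 1 & M <= atanh p].
Proof.
(* The witness [(E - 1) / (E + 1)] is the hyperbolic tangent of [N]; the floor 1 on [N] gives
   [3 <= E], hence a witness of at least 1/2. *)
pose N := Num.max M 1; pose E := expR (2 * N).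
have N1 : 1 <= N by rewrite le_max lexx orbT.
have E3 : 3 <= E by apply: le_trans (expR_ge1Dx (2 * N)); lra.
exists ((E - 1) / (E + 1)); have E0 : 0 < E + 1 by lra.
have l1 : 1 / 2 <= (E - 1) / (E + 1) by rewrite ler_pdivlMr//; lra.
have l2 : (E - 1) / (E + 1) < 1 by rewrite ltr_pdivrMr//; lra.
split => //.
rewrite atanh_ratio//; last by lra.
have -> : (1 + (E - 1) / (E + 1)) / (1 - (E - 1) / (E + 1)) = E.
  have n1 : E + 1 != 0 by rewrite gt_eqF.
  by field; rewrite n1 (_ : _ - _ = 2) ?pnatr_eq0//; ring.
by rewrite expRK (mulrC 2 N) mulfK// /N le_max lexx.
Qed.

(** [hs] is the supremum of the points of [dom] where [g] is positive; monotonicity replaces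
    continuity. The function [g] may stay positive on all of a bounded [dom]: [hs] is then its end,
    and the last clause keeps it from going further. *)
Lemma sign_change (g : R -> R) (dom : R -> Prop) :
  (forall h k, dom k -> 1 < h -> h < k -> dom h) ->
  (forall h k, dom k -> 1 < h -> h < k -> g k < g h) ->
  (exists h, [/\ 1 < h, dom h & 0 < g h]) ->
  (exists B, forall h, 1 < h -> dom h -> 0 < g h -> h <= B) ->
  exists hs, [/\ 1 < hs, forall h, 1 < h -> h < hs -> dom h /\ 0 < g h,
    forall h, hs < h -> dom h -> g h < 0 &
    forall B, (forall h, 1 < h -> dom h -> h <= B) -> hs <= B].
Proof.
move=> dd gd [h0 [h01 dh0 gh0]] [B0 Bub].
pose S := [set h | [/\ 1 < h, dom h & 0 < g h]].
have S0 : S !=set0 by exists h0.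
have hS : has_sup S by split => //; exists B0 => h [? ? ?]; exact: Bub.
have ubS h : S h -> h <= sup S by exact: sup_upper_bound.
have key h : 1 < h -> h < sup S -> dom h /\ 0 < g h.
  move=> h1 hs; have e0 : 0 < sup S - h by rewrite subr_gt0.
  have [k [k1 dk gk] hk] := sup_adherent e0 hS.
  have {}hk : h < k by lra.
  by split; [exact: dd hk|apply: lt_trans gk _; exact: gd].
have s1 : 1 < sup S by apply: (lt_le_trans h01); apply: ubS; split.
exists (sup S); split => //.
- move=> h sh dh.
  have m1 : sup S < (sup S + h) / 2 by lra.
  have m2 : (sup S + h) / 2 < h by lra.
  apply: (@lt_le_trans _ _ (g ((sup S + h) / 2))); first by apply: gd => //; lra.
  rewrite leNgt; apply/negP => gm.
  have : (sup S + h) / 2 <= sup S.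
    by apply: ubS; split => //; [lra|apply: dd dh _ m2; lra].
  lra.
- move=> B Bu; apply: ge_sup => // h [h1 dh _]; exact: Bu.
Qed.

End AtanhGrowth.

(** * The sign of rise - fall, and the maximum *)

Section Maximum.
Variables (R : realType) (a b : R).
Hypotheses (a0 : 0 < a) (a1 : a < 1) (b0 : 0 < b).
Local Notation rr := (rsq a b).
Local Notation ss := (disc_edge a b).

(** [2 * kdet a h] times the difference of rise and fall when P0 lies in the ball: weight times the
    length of P0 P3, minus the constant. *)
Definition ord_speed (h : R) : R :=
  a * b / Num.sqrt (ss h) * (artq (ss h) (ss h * h ^- 2) + artq (ss h) rr) - base_edge a b.

(** The same quantity when P0 is ultraideal, both edges being cut at its polar plane. *)
Definition fru_speed (h : R) : R :=
  a * b / Num.sqrt (ss h) * (artq (ss h) (ss h * h ^- 2) + artq (ss h) (ss h / rr))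
  - base_edge a ((1 - a ^+ 2) / b).

(** Polynomial form of the condition that part of the edge P0 P3 survives, meaningful for every
    r. *)
Definition frustum (h : R) : Prop := h ^+ 2 * (rr - 1) < rr.

Lemma frustumP h : 1 < h -> (rr * ycrit a h < a) <-> frustum h.
Proof.
move=> h1; have h0 := gt1_gt0 h1.
have -> : (rr * ycrit a h < a) = (h ^+ 2 * (rr - 1) < rr).
  rewrite /ycrit mulrCA gtr_pMr//.
  rewrite -(ltr_pM2r (exprn_gt0 2 h0)) mul1r -mulrA mulrBl mul1r mulVf ?gt_eqF ?exprn_gt0//.
  by apply/idP/idP; lra.
by [].
Qed.

Lemma disc_edgeE h : ss h = rr + h ^+ 2 * (1 - rr).
Proof. by rewrite /disc_edge; ring. Qed.

Lemma artq_self (D c : R) : 0 < D -> artq D (D * c) = atanh (Num.sqrt D * c).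
Proof.
move=> D0; rewrite /artq mulrAC; congr (atanh (_ * _)).
have s0 : 0 < Num.sqrt D by rewrite sqrtr_gt0.
by rewrite -[X in X / _](sqr_sqrtr (ltW D0)) expr2 mulfK// gt_eqF.
Qed.

Lemma base_edge_gt0 x : 0 < x -> x ^+ 2 < 1 - a ^+ 2 -> 0 < base_edge a x.
Proof.
move=> x0 xa; apply: mulr_gt0; last exact: artq_gt0.
by rewrite mulr_gt0// sqrtr_gt0 onem_sqr_gt0.
Qed.

(** * P0 inside the ball *)

Section Ordinary.
Hypothesis r1 : rr < 1.

Let r0 : 0 < rr. Proof. exact: rsq_gt0. Qed.

Lemma disc_edge_ord_gt0 h : 0 < ss h.
Proof. by rewrite disc_edgeE ltr_pwDl// mulr_ge0 ?sqr_ge0// subr_ge0 ltW. Qed.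

Lemma ord_speedE h : ord_speed h = a * b / Num.sqrt (ss h) *
  (atanh (Num.sqrt (ss h) * h ^- 2) + atanh (rr / Num.sqrt (ss h))) - base_edge a b.
Proof. by rewrite /ord_speed artq_self// disc_edge_ord_gt0. Qed.

Lemma ord_p h : 1 < h -> 0 < Num.sqrt (ss h) * h ^- 2 /\ Num.sqrt (ss h) * h ^- 2 < 1.
Proof.
move=> h1; have h0 := gt1_gt0 h1; have s0 := disc_edge_ord_gt0 h.
have hp := sqrB1_gt0 h1; have rn := r0.
split; first by rewrite mulr_gt0 ?sqrtr_gt0// invsq_gt0.
rewrite ltr_pdivrMr ?exprn_gt0// mul1r -[ltRHS]gtr0_norm ?exprn_gt0// -sqrtr_sqr.
by rewrite ltr_sqrt ?exprn_gt0// disc_edgeE; nra.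
Qed.

Lemma ord_q h : 1 < h -> 0 < rr / Num.sqrt (ss h) /\ rr / Num.sqrt (ss h) < 1.
Proof.
move=> h1; have h0 := gt1_gt0 h1; have s0 := disc_edge_ord_gt0 h.
have hp := sqrB1_gt0 h1; have rn := r0.
split; first by rewrite divr_gt0 ?sqrtr_gt0.
rewrite ltr_pdivrMr ?sqrtr_gt0// mul1r -[ltLHS]gtr0_norm// -sqrtr_sqr.
have hint : 0 < (1 - rr) * (rr + h ^+ 2) by rewrite mulr_gt0 ?subr_gt0// addr_gt0// exprn_gt0.
by rewrite ltr_sqrt// disc_edgeE; nra.
Qed.

(** Since [rr < 1], [ss] increases with h, so the weight and the term at P0 decrease. At the other
    end, [ss h * (h ^- 2) ^+ 2 = rr * (h ^- 2) ^+ 2 + (1 - rr) * h ^- 2]. *)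
Lemma ord_mono h k : 1 < h -> h < k ->
  [/\ Num.sqrt (ss h) < Num.sqrt (ss k), Num.sqrt (ss k) * k ^- 2 < Num.sqrt (ss h) * h ^- 2 &
      rr / Num.sqrt (ss k) < rr / Num.sqrt (ss h)].
Proof.
move=> h1 hk; have h0 := gt1_gt0 h1; have rn := r0.
have k0 : 0 < k by lra.
have hk2 : h ^+ 2 < k ^+ 2 by rewrite ltr_sqr ?nnegrE//; lra.
have h20 : 0 < h ^+ 2 by rewrite exprn_gt0.
have hint : 0 < (k ^+ 2 - h ^+ 2) * (1 - rr) by rewrite mulr_gt0 ?subr_gt0.
have sl : ss h < ss k by rewrite !disc_edgeE; nra.
have l1 : Num.sqrt (ss h) < Num.sqrt (ss k) by rewrite ltr_sqrt ?disc_edge_ord_gt0.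
split => //; last first.
  by rewrite ltr_pM2l// ltf_pV2 ?posrE ?sqrtr_gt0 ?disc_edge_ord_gt0.
have norm x : 0 < x -> Num.sqrt (ss x) * x ^- 2 = Num.sqrt (ss x * (x ^- 2) ^+ 2).
  by move=> x0; rewrite sqrtrM ?(ltW (disc_edge_ord_gt0 x))// sqrtr_sqr ger0_norm// invr_ge0 sqr_ge0.
rewrite !norm// ltr_sqrt; last by rewrite mulr_gt0 ?disc_edge_ord_gt0// exprn_gt0// invr_gt0.
have E x : 0 < x -> ss x * (x ^- 2) ^+ 2 = rr * (x ^- 2) ^+ 2 + (1 - rr) * x ^- 2.
  by move=> x0; rewrite disc_edgeE; field; rewrite gt_eqF.
rewrite !E//.
have v0 : 0 < k ^- 2 by rewrite invr_gt0 exprn_gt0.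
have vl : k ^- 2 < h ^- 2 by rewrite ltf_pV2 ?posrE// exprn_gt0.
have vl2 : (k ^- 2) ^+ 2 < (h ^- 2) ^+ 2 by rewrite ltr_sqr ?nnegrE; lra.
by apply: ltrD; rewrite ltr_pM2l// subr_gt0.
Qed.

Lemma ord_speed_decr h k : 1 < h -> h < k -> ord_speed k < ord_speed h.
Proof.
move=> h1 hk; have k1 : 1 < k by exact: lt_trans hk.
have [m1 m2 m3] := ord_mono h1 hk.
have [p0 p1] := ord_p h1; have [q0 q1] := ord_q h1.
have [p0' p1'] := ord_p k1; have [q0' q1'] := ord_q k1.
have s0 : 0 < Num.sqrt (ss h) by rewrite sqrtr_gt0 disc_edge_ord_gt0.
have s0' : 0 < Num.sqrt (ss k) by rewrite sqrtr_gt0 disc_edge_ord_gt0.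
rewrite !ord_speedE ltrD2r.
have A1 : atanh (Num.sqrt (ss k) * k ^- 2) < atanh (Num.sqrt (ss h) * h ^- 2).
  by apply: ltr_atanh => //; lra.
have A2 : atanh (rr / Num.sqrt (ss k)) < atanh (rr / Num.sqrt (ss h)).
  by apply: ltr_atanh => //; lra.
have A3 := atanh_gt0 p0' p1'; have A4 := atanh_gt0 q0' q1'.
have ab : 0 < a * b by rewrite mulr_gt0.
rewrite -!mulrA !ltr_pM2l//.
apply: ltr_pM; rewrite ?invr_ge0 ?(ltW s0')//; [lra|by rewrite ltf_pV2|exact: ltrD].
Qed.

(** As h decreases to 1 the vertex P3 becomes ideal: the length of P0 P3 is unbounded, while the
    weight stays away from 0. *)
Lemma ord_speed_pos : exists h, [/\ 1 < h, True & 0 < ord_speed h].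
Proof.
have ab : 0 < a * b by rewrite mulr_gt0.
(* The factor 2 pays for [Num.sqrt (ss h) <= 2], which follows from [h ^+ 2 <= 2], that is, from
   [1 / 2 <= p]. *)
have [p [p12 p1 Mp]] := atanh_unbounded (2 * (base_edge a b + 1) / (a * b)).
have p0 : 0 < p by lra.
have rp : 0 < Num.sqrt p by rewrite sqrtr_gt0.
(* Then [h ^- 2 = p], and [1 <= ss h] makes the argument of the first [atanh] at least p. *)
pose h := (Num.sqrt p)^-1.
have h1 : 1 < h.
  by rewrite /h -[ltLHS]invr1 ltf_pV2 ?posrE// -[ltRHS]sqrtr1 ltr_sqrt.
have h0 := gt1_gt0 h1.
have hE : h ^- 2 = p by rewrite /h exprVn invrK sqr_sqrtr// ltW.
exists h; split => //.
have s0 := disc_edge_ord_gt0 h; have rn := r0; have hp := sqrB1_gt0 h1.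
have [q0 q1] := ord_q h1; have [pp0 pp1] := ord_p h1.
have hint : 0 < (h ^+ 2 - 1) * (1 - rr) by rewrite mulr_gt0 ?(subr_gt0 rr).
have disc_edge1 : 1 <= ss h by rewrite disc_edgeE; nra.
have h22 : h ^+ 2 <= 2.
  by rewrite -[leLHS]invrK hE -[leRHS]invrK lef_pV2 ?posrE ?invr_gt0//; lra.
have hint2 : 0 <= (2 - h ^+ 2) * (1 - rr) by rewrite mulr_ge0// subr_ge0// ltW.
have ss4 : ss h <= 4 by rewrite disc_edgeE; nra.
have q1s : 1 <= Num.sqrt (ss h) by rewrite -[leLHS]sqrtr1 ler_wsqrtr.
have q2s : Num.sqrt (ss h) <= 2.
  have -> : (2 : R) = Num.sqrt (2 ^+ 2) by rewrite sqrtr_sqr gtr0_norm.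
  by apply: ler_wsqrtr; lra.
have A0 : atanh p <= atanh (Num.sqrt (ss h) * h ^- 2).
  by rewrite hE in pp1 *; apply: ler_atanh => //; [lra|rewrite ler_peMl// ltW].
have A1 := atanh_gt0 q0 q1.
rewrite ord_speedE subr_gt0.
have T0 : (base_edge a b + 1) * 2 <= a * b * atanh p.
  by move: Mp; rewrite ler_pdivrMr// mulrC (mulrC (atanh p)).
have be0 : 0 < base_edge a b.
  by apply: base_edge_gt0 => //; move: r1; rewrite /rsq; lra.
rewrite mulrAC ltr_pdivlMr ?sqrtr_gt0//.
have : a * b * atanh p <= a * b * (atanh (Num.sqrt (ss h) * h ^- 2) + atanh (rr / Num.sqrt (ss h))).
  by rewrite ler_pM2l//; lra.
nra.
Qed.

(** Beyond 2 the length is at most its value [N] at 2 and the weight at most [a * b / (h * w)], so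
    their product finally drops below the positive constant. *)
Lemma ord_speed_bound : exists B, forall h, 1 < h -> True -> 0 < ord_speed h -> h <= B.
Proof.
have ab : 0 < a * b by rewrite mulr_gt0.
have be0 : 0 < base_edge a b.
  by apply: base_edge_gt0 => //; move: r1; rewrite /rsq; lra.
have two : (1 : R) < 2 by lra.
have [p0 p1] := ord_p two; have [q0 q1] := ord_q two.
pose N := atanh (Num.sqrt (ss 2) * 2 ^- 2) + atanh (rr / Num.sqrt (ss 2)).
have N0 : 0 < N by rewrite addr_gt0 ?atanh_gt0.
have w0 : 0 < 1 - rr by rewrite subr_gt0.
pose w := Num.sqrt (1 - rr).
have w1 : 0 < w by rewrite sqrtr_gt0.
exists (Num.max 2 (a * b * N / (base_edge a b * w))) => h h1 _ gh.
rewrite le_max; have [//|h2] := leP h 2; apply/orP; right.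
have h0 : 0 < h by lra.
have [m1 m2 m3] := ord_mono two h2.
have [pp0 pp1] := ord_p h1; have [qq0 qq1] := ord_q h1.
have s0 : 0 < Num.sqrt (ss h) by rewrite sqrtr_gt0 disc_edge_ord_gt0.
have A : atanh (Num.sqrt (ss h) * h ^- 2) + atanh (rr / Num.sqrt (ss h)) <= N.
  by apply: lerD; apply: ler_atanh => //; lra.
have hw : h * w <= Num.sqrt (ss h).
  have -> : h * w = Num.sqrt (h ^+ 2 * (1 - rr)).
    by rewrite sqrtrM ?sqr_ge0// sqrtr_sqr gtr0_norm.
  by apply: ler_wsqrtr; rewrite disc_edgeE lerDr ltW.
move: gh; rewrite ord_speedE subr_gt0 mulrAC ltr_pdivlMr// => gh.
have bw : 0 < base_edge a b * w by exact: mulr_gt0.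
rewrite ler_pdivlMr//.
have g2 : base_edge a b * Num.sqrt (ss h) <= a * b * N.
  by apply: le_trans (ltW gh) _; rewrite ler_pM2l.
apply: le_trans g2.
by rewrite mulrCA ler_pM2l.
Qed.

Lemma turning_ordinary : exists hs, [/\ 1 < hs,
  forall h, 1 < h -> h < hs -> (fall a b h < rise a b h)%E &
  forall h, hs < h -> (rise a b h < fall a b h)%E].
Proof.
have [hs [hs1 inc dec _]] := sign_change (fun h k (_ : True) _ _ => I)
  (fun h k _ h1 hk => ord_speed_decr h1 hk) ord_speed_pos ord_speed_bound.
have fr h : 1 < h -> rr * ycrit a h < a.
  move=> h1; apply/(frustumP h1); rewrite /frustum.
  have : 0 < h ^+ 2 by rewrite exprn_gt0// (gt1_gt0 h1).
  have := r0; have := r1; nra.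
have K0 h : 1 < h -> 0 < 2 * kdet a h by move=> h1; rewrite mulr_gt0// kdet_gt0.
exists hs; split => // h.
- move=> h1 hh; have [_ g0] := inc h h1 hh.
  rewrite fall_frustum ?fr// rise_ordinary// lte_fin ltrDl.
  by rewrite divr_gt0// K0.
- move=> hh; have h1 : 1 < h by exact: lt_trans hh.
  have g0 := dec h hh I.
  rewrite fall_frustum ?fr// rise_ordinary// lte_fin gtrDl.
  by rewrite pmulr_llt0// invr_gt0 K0.
Qed.

End Ordinary.

(** [hs] solves [b ^+ 2 * (hs ^+ 2 - 1) = 1], where the logarithm of [rise_ideal] vanishes. *)
Lemma turning_ideal : rr = 1 -> exists hs, [/\ 1 < hs,
  forall h, 1 < h -> h < hs -> (fall a b h < rise a b h)%E &
  forall h, hs < h -> (rise a b h < fall a b h)%E].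
Proof.
move=> r1; have bb : 0 < b ^+ 2 by rewrite exprn_gt0.
have b2 : 0 < b ^- 2 by rewrite invr_gt0.
pose hs := Num.sqrt (1 + b ^- 2).
have hs0 : 0 < hs by rewrite sqrtr_gt0; lra.
have hsE : hs ^+ 2 = 1 + b ^- 2 by rewrite sqr_sqrtr//; lra.
have hs1 : 1 < hs by rewrite -[ltLHS]sqrtr1 ltr_sqrt; lra.
have fr h : 1 < h -> rr * ycrit a h < a.
  by move=> h1; rewrite r1 mul1r ycrit_lt.
have K0 h : 1 < h -> 0 < a * b / (4 * kdet a h).
  by move=> h1; rewrite divr_gt0 ?mulr_gt0// kdet_gt0.
have cmp h : b ^+ 2 * (h ^+ 2 - 1) - 1 = b ^+ 2 * (h ^+ 2 - hs ^+ 2).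
  by rewrite hsE; field; rewrite gt_eqF.
exists hs; split => // h.
- move=> h1 hh; rewrite fall_frustum ?fr// rise_ideal// lte_fin ltrDl oppr_gt0.
  rewrite pmulr_rlt0 ?K0//; apply: ln_lt0; rewrite mulr_gt0 ?(sqrB1_gt0 h1)//=.
  have : h ^+ 2 < hs ^+ 2 by rewrite ltr_sqr ?nnegrE ?ltW// (gt1_gt0 h1).
  have := cmp h; nra.
- move=> hh; have h1 : 1 < h by exact: lt_trans hh.
  rewrite fall_frustum ?fr// rise_ideal// lte_fin gtrDl oppr_lt0.
  rewrite mulr_gt0 ?K0//; apply: ln_gt0.
  have : hs ^+ 2 < h ^+ 2 by rewrite ltr_sqr ?nnegrE ?ltW// (gt1_gt0 h1).
  have := cmp h; nra.
Qed.

(** * P0 ultraideal *)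

Section Truncated.
Hypothesis r1 : 1 < rr.

Lemma disc_edge_fru h : 1 < h -> frustum h -> 0 < ss h /\ ss h < 1.
Proof.
move=> h1 fh; rewrite disc_edgeE; have hp := sqrB1_gt0 h1; move: fh; rewrite /frustum => fh.
have hint : 0 < (h ^+ 2 - 1) * (rr - 1) by apply: mulr_gt0 => //; rewrite subr_gt0.
by split; nra.
Qed.

Lemma fru_p h : 1 < h -> frustum h ->
  0 < Num.sqrt (ss h) * h ^- 2 /\ Num.sqrt (ss h) * h ^- 2 < 1.
Proof.
move=> h1 fh; have [s0 s1] := disc_edge_fru h1 fh.
have q0 : 0 < Num.sqrt (ss h) by rewrite sqrtr_gt0.
have q1 : Num.sqrt (ss h) < 1 by rewrite -[ltRHS]sqrtr1 ltr_sqrt.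
have v0 := invsq_gt0 h1; have v1 := invsq_lt1 h1.
by split; [rewrite mulr_gt0|rewrite mulr_ilt1// ltW].
Qed.

Lemma fru_q h : 1 < h -> frustum h ->
  0 < Num.sqrt (ss h) * rr^-1 /\ Num.sqrt (ss h) * rr^-1 < 1.
Proof.
have r1' := r1.
move=> h1 fh; have [s0 s1] := disc_edge_fru h1 fh.
have q0 : 0 < Num.sqrt (ss h) by rewrite sqrtr_gt0.
have q1 : Num.sqrt (ss h) < 1 by rewrite -[ltRHS]sqrtr1 ltr_sqrt.
have rn : 0 < rr by lra.
by split; [rewrite divr_gt0|rewrite ltr_pdivrMr// mul1r (lt_trans q1)].
Qed.

Lemma fru_speedE h : 1 < h -> frustum h -> fru_speed h = a * b / Num.sqrt (ss h) *
  (atanh (Num.sqrt (ss h) * h ^- 2) + atanh (Num.sqrt (ss h) * rr^-1))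
  - base_edge a ((1 - a ^+ 2) / b).
Proof. by move=> h1 fh; have [s0 _] := disc_edge_fru h1 fh; rewrite /fru_speed !artq_self. Qed.

Lemma frustum_down h k : frustum k -> 1 < h -> h < k -> frustum h.
Proof.
rewrite /frustum => fk h1 hk; apply: lt_trans fk.
rewrite ltr_pM2r ?subr_gt0// ltr_sqr ?nnegrE//; have := gt1_gt0 h1; lra.
Qed.

(** The root s of [ss] decreases here, so the weight grows and is merged with the length: [s^-1 *
    atanh (s * c) = c * (atanh (s * c) / (s * c))]. The ratio does not increase by [atanh_ratio_le];
    the factor [c = h ^- 2] strictly decreases and [c = rr^-1] is constant. *)
Lemma fru_speed_decr h k : frustum k -> 1 < h -> h < k -> fru_speed k < fru_speed h.
Proof.
have r1' := r1.
move=> fk h1 hk; have k1 : 1 < k by exact: lt_trans hk.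
have fh := frustum_down fk h1 hk.
have [s0 s1] := disc_edge_fru h1 fh; have [s0' s1'] := disc_edge_fru k1 fk.
have [p0 p1] := fru_p h1 fh; have [q0 q1] := fru_q h1 fh.
have [p0' p1'] := fru_p k1 fk; have [q0' q1'] := fru_q k1 fk.
have h0 := gt1_gt0 h1; have k0 := gt1_gt0 k1.
have hk2 : h ^+ 2 < k ^+ 2 by rewrite ltr_sqr ?nnegrE// ltW.
have vl : k ^- 2 < h ^- 2 by rewrite ltf_pV2 ?posrE ?exprn_gt0.
have v0 : 0 < k ^- 2 by rewrite invr_gt0 exprn_gt0.
have sl : ss k < ss h by rewrite !disc_edgeE; move: r1 hk2; nra.
set s := Num.sqrt (ss h) in p0 p1 q0 q1 *.
set s' := Num.sqrt (ss k) in p0' p1' q0' q1' *.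
have t0 : 0 < s by rewrite sqrtr_gt0.
have t0' : 0 < s' by rewrite sqrtr_gt0.
have tl : s' < s by rewrite ltr_sqrt.
have rn : 0 < rr^-1 by rewrite invr_gt0; lra.
have ab : 0 < a * b by rewrite mulr_gt0.
have R1 := @atanh_ratio_le R (s' * k ^- 2) (s * h ^- 2) p0'.
have R2 := @atanh_ratio_le R (s' * rr^-1) (s * rr^-1) q0'.
rewrite !fru_speedE// ltrD2r -!mulrA !ltr_pM2l// -/s -/s' !mulrDr.
have A0 := atanh_gt0 p0 p1.
apply: ltr_leD.
  have m : s' * k ^- 2 <= s * h ^- 2 by apply: ler_pM => //; exact: ltW.
  have {}R1 := R1 m p1.
  have -> : s'^-1 * atanh (s' * k ^- 2) = k ^- 2 * (atanh (s' * k ^- 2) / (s' * k ^- 2)).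
    by field; rewrite !gt_eqF.
  have -> : s^-1 * atanh (s * h ^- 2) = h ^- 2 * (atanh (s * h ^- 2) / (s * h ^- 2)).
    by field; rewrite !gt_eqF.
  apply: le_lt_trans (_ : _ <= k ^- 2 * (atanh (s * h ^- 2) / (s * h ^- 2))) _.
    by rewrite ler_pM2l.
  by rewrite ltr_pM2r// divr_gt0.
have m : s' * rr^-1 <= s * rr^-1 by rewrite ler_pM2r// ltW.
have {}R2 := R2 m q1.
have E x : 0 < x -> x^-1 * atanh (x * rr^-1) = rr^-1 * (atanh (x * rr^-1) / (x * rr^-1)).
  by move=> x0; field; rewrite !gt_eqF//; lra.
by rewrite !E// ler_pM2l.
Qed.

Lemma fru_speed_pos : exists h, [/\ 1 < h, frustum h & 0 < fru_speed h].
Proof.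
have r1' := r1.
have ab : 0 < a * b by rewrite mulr_gt0.
pose M := base_edge a ((1 - a ^+ 2) / b).
have [p [p12 p1 Mp]] := atanh_unbounded ((M + 1) / (a * b)).
have p0 : 0 < p by lra.
have pp : p ^+ 2 < 1 by rewrite expr_lt1// ltW.
have pp0 : 0 < p ^+ 2 by rewrite exprn_gt0.
have rp : 0 < 1 + rr by lra.
(* With [h ^- 2 = 1 - dl], the square of the first argument of [atanh] is [(1 - dl) * (1 - rr * dl)
   = p ^+ 2 + rr * dl ^+ 2], hence more than [p ^+ 2]. *)
pose dl := (1 - p ^+ 2) / (1 + rr).
have d0 : 0 < dl by rewrite divr_gt0// subr_gt0.
have dE : dl * (1 + rr) = 1 - p ^+ 2 by rewrite divfK// gt_eqF.
have d1 : dl < 1 by nra.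
have dr : rr * dl < 1 by nra.
have x0 : 0 < 1 - dl by lra.
pose h := (Num.sqrt (1 - dl))^-1.
have sx : 0 < Num.sqrt (1 - dl) by rewrite sqrtr_gt0.
have h1 : 1 < h.
  rewrite /h -[ltLHS]invr1 ltf_pV2 ?posrE// -[ltRHS]sqrtr1 ltr_sqrt//; lra.
have h0 := gt1_gt0 h1.
have hE : h ^- 2 = 1 - dl by rewrite /h exprVn invrK sqr_sqrtr// ltW.
have h20 : 0 < h ^+ 2 by rewrite exprn_gt0.
have hm : h ^+ 2 * (1 - dl) = 1 by rewrite -hE divff// gt_eqF.
have fh : frustum h by rewrite /frustum; nra.
exists h; split => //.
have [s0 s1] := disc_edge_fru h1 fh.
have [z0 z1] := fru_p h1 fh; have [q0 q1] := fru_q h1 fh.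
have pz : p <= Num.sqrt (ss h) * h ^- 2.
  have -> : Num.sqrt (ss h) * h ^- 2 = Num.sqrt (ss h * (h ^- 2) ^+ 2).
    by rewrite sqrtrM ?(ltW s0)// sqrtr_sqr ger0_norm// invr_ge0 sqr_ge0.
  rewrite -[leLHS]gtr0_norm// -sqrtr_sqr; apply: ler_wsqrtr.
  have -> : ss h * (h ^- 2) ^+ 2 = h ^- 2 * (1 - rr * (1 - h ^- 2)).
    by rewrite disc_edgeE; field; rewrite gt_eqF.
  rewrite hE; have : 0 < rr * dl ^+ 2 by rewrite mulr_gt0 ?exprn_gt0//; lra.
  nra.
have A : atanh p <= atanh (Num.sqrt (ss h) * h ^- 2) by apply: ler_atanh => //; lra.
have A1 := atanh_gt0 q0 q1.
have T0 : M + 1 <= a * b * atanh p by move: Mp; rewrite ler_pdivrMr// mulrC.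
have q0s : 0 < Num.sqrt (ss h) by rewrite sqrtr_gt0.
have q1s : Num.sqrt (ss h) < 1 by rewrite -[ltRHS]sqrtr1 ltr_sqrt.
rewrite fru_speedE// subr_gt0 -/M mulrAC ltr_pdivlMr//.
have a2 := onem_sqr_gt0 a0 a1.
have M0 : 0 < M.
  apply: base_edge_gt0; first by rewrite divr_gt0.
  rewrite expr_div_n ltr_pdivrMr ?exprn_gt0// expr2 ltr_pM2l//.
  by move: r1; rewrite /rsq; lra.
have : a * b * atanh p <= a * b * (atanh (Num.sqrt (ss h) * h ^- 2) + atanh (Num.sqrt (ss h) * rr^-1)).
  by rewrite ler_pM2l//; lra.
nra.
Qed.

(** The Lambert cube threshold, r / sqrt (r ^ 2 - 1). *)
Definition hlim : R := Num.sqrt (rr / (rr - 1)).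

Lemma hlim_sq : hlim ^+ 2 = rr / (rr - 1).
Proof. by rewrite sqr_sqrtr// divr_ge0; move: r1; lra. Qed.

Lemma frustum_hlim h : 0 < h -> frustum h <-> h < hlim.
Proof.
move=> h0; have rp : 0 < rr - 1 by rewrite subr_gt0.
have l0 : 0 < hlim by rewrite sqrtr_gt0 divr_gt0//; lra.
rewrite /frustum -ltr_pdivlMr// -hlim_sq ltr_sqr ?nnegrE ?ltW//.
Qed.

(** If [fru_speed] stays positive up to the threshold, then [hs = hlim] and the last clause is
    vacuous: the maximum sits at the corner. *)
Lemma turning_truncated : exists hs, [/\ 1 < hs, hs <= hlim,
  forall h, 1 < h -> h < hs -> (fall a b h < rise a b h)%E &
  forall h, hs < h -> h < hlim -> (rise a b h < fall a b h)%E].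
Proof.
have bd : exists B, forall h, 1 < h -> frustum h -> 0 < fru_speed h -> h <= B.
  by exists hlim => h h1 fh _; apply/ltW/(frustum_hlim (gt1_gt0 h1)).
have [hs [hs1 inc dec ub]] := sign_change frustum_down fru_speed_decr fru_speed_pos bd.
have K0 h : 1 < h -> 0 < 2 * kdet a h by move=> h1; rewrite mulr_gt0// kdet_gt0.
exists hs; split => //.
- by apply: ub => h h1 fh; apply/ltW/(frustum_hlim (gt1_gt0 h1)).
- move=> h h1 hh; have [fh g0] := inc h h1 hh; have /(frustumP h1) fc := fh.
  rewrite fall_frustum// rise_frustum// lte_fin ltrDl.
  by rewrite divr_gt0// K0.
- move=> h hh hl; have h1 : 1 < h by exact: lt_trans hh.
  have fh : frustum h by apply/(frustum_hlim (gt1_gt0 h1)).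
  have g0 := dec h hh fh; have /(frustumP h1) fc := fh.
  rewrite fall_frustum// rise_frustum// lte_fin gtrDl.
  by rewrite pmulr_llt0// invr_gt0 K0.
Qed.

Lemma lambert_hlim h : 1 < h -> hlim < h -> (rise a b h < fall a b h)%E.
Proof.
move=> h1 hl; apply: lambert_decreasing => //.
rewrite ltNge; apply/negP => rc.
have h0 := gt1_gt0 h1.
have rp : 0 < rr - 1 by rewrite subr_gt0.
have l0 : 0 < hlim by rewrite sqrtr_gt0 divr_gt0//; lra.
have : hlim ^+ 2 < h ^+ 2 by rewrite ltr_sqr ?nnegrE ?ltW.
rewrite hlim_sq ltr_pdivrMr// => hh.
move: rc; rewrite /ycrit mulrCA ger_pMr//.
rewrite -(ler_pM2r (exprn_gt0 2 h0)) mul1r -mulrA mulrBl mul1r mulVf ?gt_eqF ?exprn_gt0//.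
lra.
Qed.

End Truncated.

(** * From the sign of rise - fall to the maximum of the volume *)

Local Notation vol := (vol a b).

Lemma vol_lt_before hs : 1 < hs ->
  (forall h, 1 < h -> h < hs -> (fall a b h < rise a b h)%E) ->
  forall h, 0 < h -> h < hs -> (vol h < vol hs)%E.
Proof.
move=> hs1 inc h h0 hh.
have inc' k : 1 <= k -> k < hs -> (vol k < vol hs)%E.
  move=> k1 khs; apply: vol_increasing => //; first by lra.
  by move=> x; rewrite in_itv/= => /andP[? ?]; apply: inc => //; lra.
have [h1|h1] := leP h 1; last by apply: inc' => //; exact: ltW.
by apply: le_lt_trans (vol_le1 _ _ _ h0 h1) _ => //; exact: inc'.
Qed.

Lemma vol_unique_max : exists hs, [/\ 1 < hs, 1 < rr -> hs <= hlim &
  forall h, 0 < h -> h != hs -> (vol h < vol hs)%E].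
Proof.
have [r1|r1|r1] := ltgtP rr 1.
- have [hs [hs1 inc dec]] := turning_ordinary r1.
  exists hs; split => // h h0; rewrite neq_lt => /orP[hh|hh].
    exact: vol_lt_before.
  apply: vol_decreasing => //; first by lra.
  by move=> x; rewrite in_itv/= => /andP[? _]; exact: dec.
- have [hs [hs1 hl inc dec]] := turning_truncated r1.
  have dec' k : hs < k -> k <= hlim -> (vol k < vol hs)%E.
    move=> hk kl; apply: vol_decreasing => //; first by lra.
    by move=> x; rewrite in_itv/= => /andP[? ?]; apply: dec => //; lra.
  exists hs; split => // h h0; rewrite neq_lt => /orP[hh|hh].
    exact: vol_lt_before.
  have [hhl|hhl] := leP h hlim; first exact: dec'.
  have l0 : 0 < hlim by lra.
  (* In the Lambert range the volume is compared through [hlim], which may coincide with [hs]. *)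
  apply: (@lt_le_trans _ _ (vol hlim)).
    apply: vol_decreasing => // x; rewrite in_itv/= => /andP[? ?].
    by apply: lambert_hlim => //; lra.
  move: hl; rewrite le_eqVlt => /predU1P[->//|hl].
  by apply/ltW/dec'.
- have [hs [hs1 inc dec]] := turning_ideal r1.
  exists hs; split => // h h0; rewrite neq_lt => /orP[hh|hh].
    exact: vol_lt_before.
  apply: vol_decreasing => //; first by lra.
  by move=> x; rewrite in_itv/= => /andP[? _]; exact: dec.
Qed.

(** A common point of the polar planes has [z = h^-1] and, by Cauchy-Schwarz,
    [1 <= rr * (x ^+ 2 + y ^+ 2)]; inside the ball this forces [rr < h ^+ 2 * (rr - 1)], against
    [h <= hlim]. At [h = hlim] the planes are merely tangent at an ideal point. *)
Lemma not_lambert h : 1 < h -> (1 < rr -> h <= hlim) ->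
  ~ is_lambert_cube (Pt0 a b) (Pt3 h).
Proof.
move=> h1 hl [u0 [_ [[[x y] z] [ball [e0 e3]]]]].
move: u0 ball e0 e3; rewrite /ultraideal /in_ball /sqn3 /dot3 /= => u0 ball e0 e3.
have r1 : 1 < rr by move: u0; rewrite /rsq; lra.
have h0 := gt1_gt0 h1.
have rp : 0 < rr - 1 by rewrite subr_gt0.
have l0 : 0 < hlim by rewrite sqrtr_gt0 divr_gt0//; lra.
have hh : h ^+ 2 * (rr - 1) <= rr.
  rewrite -ler_pdivlMr// -hlim_sq// ler_sqr ?nnegrE ?(ltW h0) ?(ltW l0)//; exact: hl.
have e0' : x * b + y * a = 1 by lra.
have e3' : z * h = 1 by lra.
have cs : 1 <= rr * (x ^+ 2 + y ^+ 2).
  have : 0 <= (x * a - y * b) ^+ 2 by exact: sqr_ge0.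
  have : (x * b + y * a) ^+ 2 = 1 by rewrite e0' expr1n.
  by rewrite /rsq; nra.
have z2 : z ^+ 2 * h ^+ 2 = 1 by rewrite -exprMn e3' expr1n.
have h20 : 0 < h ^+ 2 by rewrite exprn_gt0.
have b1 : x ^+ 2 + y ^+ 2 < 1 - z ^+ 2 by rewrite !expr2; lra.
have : rr * (x ^+ 2 + y ^+ 2) < rr * (1 - z ^+ 2) by rewrite ltr_pM2l//; lra.
move=> b2; have b3 : 1 < rr * (1 - z ^+ 2) by lra.
have : h ^+ 2 * 1 < h ^+ 2 * (rr * (1 - z ^+ 2)) by rewrite ltr_pM2l.
nra.
Qed.

End Maximum.

Theorem theorem1 (R : realType) (r theta : R) :
  0 < r -> 0 < theta -> theta < pi / 2 -> r * cos theta < 1 ->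
  let P0 := mkpt (r * sin theta) (r * cos theta) 0 in
  let P1 := mkpt 0 (r * cos theta) 0 in
  let P2 := mkpt 0 0 0 in
  let P3 := fun h : R => mkpt 0 0 h in
  let V := fun h : R => hyp_volume (complete_orthoscheme P0 P1 P2 (P3 h)) in
  exists h : R, 1 < h /\
    (forall h' : R, 0 < h' -> (V h' <= V h)%E) /\
    (forall h' : R, 0 < h' -> V h' = V h -> h' = h) /\
    ~ is_lambert_cube P0 (P3 h).
Proof.
move=> r0 t0 t1 a1 P0 P1 P2 P3 V.
have a0 : 0 < r * cos theta.
  rewrite mulr_gt0// cos_gt0_pihalf// t1 andbT (lt_trans _ t0)//.
  by rewrite oppr_lt0 divr_gt0// pi_gt0.
have b0 : 0 < r * sin theta by rewrite mulr_gt0// sin_gt0_pihalf// t0 t1.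
have VE h : 0 < h -> V h = vol (r * cos theta) (r * sin theta) h.
  exact: (hyp_volumeE a0 a1 b0).
have [hs [hs1 hl max]] := vol_unique_max a0 a1 b0.
have hs0 : 0 < hs by exact: lt_trans hs1.
clearbody V; exists hs; split; first exact: hs1.
split; [|split].
- move=> h h0; rewrite (VE h h0) (VE hs hs0).
  by have [->|hn] := eqVneq h hs; [exact: lexx|exact/ltW/max].
- move=> h h0; rewrite (VE h h0) (VE hs hs0) => e; apply/eqP; apply: contraT => hn.
  by have := max h h0 hn; rewrite e ltxx.
- exact: (not_lambert hs1 hl).
Qed.
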